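(* Let $G\rightrightarrows Q$ be a Lie groupoid with source $\alpha$ and identity map $\varepsilon$, let $\Gamma$ be a homogeneous quadratic SODE on its Lie algebroid $\tau:AG\to Q$, let $\tilde\Gamma$ be the unique SODE on $\tilde\tau:V\alpha\to G$ which is $\Psi$-related with $\Gamma$, and let $exp^\Gamma:\mathcal U\subseteq AG\to U\subseteq G$ be the exponential map associated with $\Gamma$ (at time $1$; see the context). Then $$exp^\Gamma(0_q)=\varepsilon(q),\qquad exp^\Gamma(t\,v_{\varepsilon(q)})=\sigma_{v_{\varepsilon(q)}}(t),$$ for $q\in\tau(\mathcal U)$, $v_{\varepsilon(q)}\in\mathcal U\cap A_qG$ and $t\in[0,1]$, where $\sigma_{v_{\varepsilon(q)}}:[0,1]\to U\subseteq G$ is the trajectory of $\tilde\Gamma$ with initial velocity $v_{\varepsilon(q)}$. Moreover, under the canonical identifications $T_{0_q}\mathcal U\simeq T_qQ\times A_qG$ and $T_{\varepsilon(q)}G\simeq T_qQ\times A_qG$, the tangent map $$T_{0_q}exp^\Gamma:T_{0_q}\mathcal U\simeq T_qQ\times A_qG\to T_{\varepsilon(q)}G\simeq T_qQ\times A_qG$$ is the identity map.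
   Context: Groupoid conventions: $\alpha,\beta$ are source and target, $gh$ is defined when $\beta(g)=\alpha(h)$, with $\alpha(gh)=\alpha(g)$, $\beta(gh)=\beta(h)$; $l_g:\alpha^{-1}(\beta(g))\to\alpha^{-1}(\alpha(g))$, $h\mapsto gh$. The Lie algebroid $\tau:AG\to Q$ has fibre $A_qG=\ker T_{\varepsilon(q)}\alpha$ and anchor $\rho(v)=T_{\varepsilon(q)}\beta(v)$. $V\alpha=\ker T\alpha$, with projection $\tilde\tau:V\alpha\to G$, is a Lie algebroid over $G$ with anchor the inclusion in $TG$. $AG$ is regarded as the subset of $V\alpha$ lying over $\varepsilon(Q)$. The map $\Psi:V\alpha\to AG$, $\Psi(v_g)=T_gl_{g^{-1}}(v_g)$, is a Lie algebroid morphism over $\beta$, bijective on each fibre. A SODE on a Lie algebroid $p:A\to N$ with anchor $\rho_A$ is a smooth vector field $X$ on $A$ with $(T_ap)(X(a))=\rho_A(a)$ for all $a\in A$. It is homogeneous quadratic if $[\Delta,X]=X$, where $\Delta$ is the Euler vector field of $A$, with flow $(t,a)\mapsto e^ta$. For each SODE $\Gamma$ on $AG$ there is a unique SODE $\tilde\Gamma$ on $V\alpha$ with $T\Psi\circ\tilde\Gamma=\Gamma\circ\Psi$. A trajectory of $\tilde\Gamma$ is a curve $\sigma$ in $G$, contained in a fibre of $\alpha$, whose velocity $\dot\sigma$ is an integral curve of $\tilde\Gamma$. Exponential map: $\mathcal U\subseteq AG$ and $U\subseteq G$ are open subsets, $\mathcal U$ is starshaped about the restriction of the zero section to $\tau(\mathcal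 U)$ (i.e. $v\in\mathcal U$, $t\in[0,1]$ imply $tv\in\mathcal U$), the flow $\Phi^{\tilde\Gamma}$ of $\tilde\Gamma$ is defined on $[0,1]\times\mathcal U$, and $exp^\Gamma:\mathcal U\to U$, $exp^\Gamma(v)=\tilde\tau(\Phi^{\tilde\Gamma}_1(v))$, is a diffeomorphism. (Such $\mathcal U$ and $U$ exist around any given point of $Q$.) Canonical identifications: $T_qQ\times A_qG\to T_{0_q}AG=T_{0_q}\mathcal U$, $(u_q,v)\mapsto(T_q0)(u_q)+\frac{d}{dt}|_{t=0}(tv)$, with $0:Q\to AG$ the zero section; and $T_qQ\times A_qG\to T_{\varepsilon(q)}G$, $(u_q,v)\mapsto(T_q\varepsilon)(u_q)+v$, where $v\in A_qG=\ker T_{\varepsilon(q)}\alpha\subseteq T_{\varepsilon(q)}G$. *)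

(* Defs.v *)
From HB Require Import structures.
From mathcomp Require Import all_boot all_order all_algebra.
From mathcomp Require Import all_classical all_reals all_analysis.
Import Order.TTheory GRing.Theory Num.Theory.
Import numFieldNormedType.Exports.

Set Implicit Arguments.
Unset Strict Implicit.
Unset Printing Implicit Defensive.

Local Open Scope classical_set_scope.
Local Open Scope ring_scope.

(* Smooth manifolds are presented as differential spaces (Sikorski): a set
   together with its algebra of smooth real functions, topologized by the
   initial topology of these functions.  A (Hausdorff, second countable) smooth
   manifold is the same thing as such a space that is locally diffeomorphic to
   open subsets of R^n.  Products, tangent bundles and the subsets
   (alpha-fibres, composable pairs, V alpha, AG) carry the differential
   structure generated by the evident functions; on a tangent bundle or on an
   embedded submanifold this is the usual smooth structure. *)

Lemma near_eq_differentiable (R : realType) (V W : normedModType R)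
    (f g : V -> W) (x : V) :
  (\forall y \near x, f y = g y) -> differentiable f x -> differentiable g x.
Proof.
move=> fg df; have fgx := nbhs_singleton fg.
have dfc : continuous ('d f x) by exact: diff_continuous.
have h : g \o shift x = cst (g x) + 'd f x +o_ 0 id.
  have /eqaddoP hf := diff_locally df.
  apply/eqaddoP => e e0.
  have fg0 : \forall h \near (0 : V), f (h + x) = g (h + x).
    by move: fg; rewrite (near_shift 0) /=; apply: filterS => y; rewrite /= subr0.
  near=> h.
  have -> : (g \o shift x - (cst (g x) + 'd f x)) h
          = (f \o shift x - (cst (f x) + 'd f x)) h.
    rewrite -![(_ - _) h]/(_ - _) /= fgx; congr (_ - _).
    by rewrite (near fg0 h).
  by near: h; exact: hf.
have E := diff_unique dfc h.
by apply/diff_locallyP; rewrite E.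
Unshelve. all: by end_near. Qed.

Section Euclidean.
Context {R : realType}.

Fixpoint Ck_on (k : nat) (n : nat) (W : set 'rV[R]_n) (f : 'rV[R]_n -> R)
    {struct k} : Prop :=
  if k is k'.+1 then
    (forall x, W x -> differentiable f x) /\
    (forall v, Ck_on k' W (fun x => 'D_v f x))
  else forall x, W x -> {for x, continuous f}.

Definition smooth_on (n : nat) (W : set 'rV[R]_n) (f : 'rV[R]_n -> R) : Prop :=
  forall k, Ck_on k W f.

Lemma Ck_on_eq k n (W : set 'rV[R]_n) (f g : 'rV[R]_n -> R) :
  open W -> (forall x, W x -> f x = g x) -> Ck_on k W f -> Ck_on k W g.
Proof.
move=> oW; elim: k f g => [|k IH] f g fg.
all: have nfg x : W x -> \forall y \near x, f y = g y
  by move=> Wx; near=> y; apply: fg; near: y; exact: open_nbhs_nbhs.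
  move=> h x Wx; have := h x Wx; rewrite /prop_for /continuous_at -(fg x Wx).
  exact: cvg_trans (near_eq_cvg (nfg x Wx)).
case=> hd hD; split=> [x Wx|v].
  exact: near_eq_differentiable (nfg x Wx) (hd x Wx).
by apply: IH (hD v) => x Wx; exact: near_eq_derive (nfg x Wx).
Unshelve. all: by end_near. Qed.

Lemma Ck_onW k n (W : set 'rV[R]_n) f : Ck_on k.+1 W f -> Ck_on k W f.
Proof.
elim: k f => [f [h _] x Wx|k IH f [h hD]]; last by split=> // v; exact: IH.
exact: differentiable_continuous (h x Wx).
Qed.

Lemma Ck_onD k n (W : set 'rV[R]_n) f g :
  open W -> Ck_on k W f -> Ck_on k W g -> Ck_on k W (f + g).
Proof.
move=> oW; elim: k f g => [f g cf cg x Wx|k IH f g [df Df] [dg Dg]].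
  by apply: continuousD; [exact: cf|exact: cg].
split=> [x Wx|v]; first by apply: differentiableD; [exact: df|exact: dg].
apply: Ck_on_eq (IH _ _ (Df v) (Dg v)) => // x Wx.
by rewrite deriveD //; apply: diff_derivable; [exact: df|exact: dg].
Qed.

Lemma Ck_onM k n (W : set 'rV[R]_n) f g :
  open W -> Ck_on k W f -> Ck_on k W g -> Ck_on k W (f * g).
Proof.
move=> oW; elim: k f g => [f g cf cg x Wx|k IH f g hf hg].
  by apply: continuousM; [exact: cf|exact: cg].
have [[df Df] [dg Dg]] := (hf, hg).
split=> [x Wx|v]; first by apply: differentiableM; [exact: df|exact: dg].
have h1 := IH _ _ (Ck_onW hf) (Dg v).
have h2 := IH _ _ (Ck_onW hg) (Df v).
apply: Ck_on_eq (Ck_onD oW h1 h2) => // x Wx.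
by rewrite deriveM //; apply: diff_derivable; [exact: df|exact: dg].
Qed.

Lemma Ck_on_cst k n (W : set 'rV[R]_n) (c : R) : Ck_on k W (cst c).
Proof.
elim: k c => [c x _|k IH c]; first exact: cst_continuous.
split=> [x _|v]; first exact: differentiable_cst.
rewrite (_ : (fun x => _) = cst 0); first exact: IH.
by apply/funext => x; rewrite derive_cst.
Qed.

Lemma Ck_on_comp_linear k m n (L : {linear 'rV[R]_m -> 'rV[R]_n})
    (W : set 'rV[R]_n) (V : set 'rV[R]_m) f :
  continuous L -> V `<=` L @^-1` W -> Ck_on k W f -> Ck_on k V (f \o L).
Proof.
move=> cL VW; elim: k f => [f h x Vx|k IH f [df Df]].
  by apply: continuous_comp; [exact: cL|exact/h/VW].
split=> [x Vx|v].
  by apply: differentiable_comp; [exact: linear_differentiable|exact/df/VW].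
rewrite (_ : (fun x => _) = (fun y => 'D_(L v) f y) \o L); first exact: IH (Df _).
apply/funext => x; rewrite /comp /derive.
suff -> : (fun h : R => h^-1 *: (((f \o L) \o shift x) (h *: v) - (f \o L) x))
  = (fun h : R => h^-1 *: ((f \o shift (L x)) (h *: L v) - f (L x))) by [].
by apply/funext => h /=; congr (_ *: (f _ - _)); exact: (linearP L h v x).
Qed.

End Euclidean.

Section DifferentialSpaces.
Context {R : realType}.

Definition dtop (T : Type) (C : set (T -> R)) : Type := T.

Section InitialTopology.
Variables (T : Type) (C : set (T -> R)).

Definition init_nbhs (p : T) : set_system T := [set N |
  exists (k : nat) (a : 'I_k -> T -> R) (e : R),
    [/\ forall i, C (a i), 0 < e &
        forall q, (forall i, `|a i q - a i p| < e) -> N q]].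

Lemma init_nbhs_filter (p : T) : ProperFilter (init_nbhs p).
Proof.
split.
  move=> [k [a [e [_ e0 h]]]]; apply: (h p) => i.
  by rewrite subrr normr0.
split.
- by exists 0%N, (fun _ _ => 0), 1; split => // -[].
- move=> N1 N2 [k1 [a1 [e1 [C1 e10 h1]]]] [k2 [a2 [e2 [C2 e20 h2]]]].
  exists (k1 + k2)%N,
    (fun i : 'I_(k1 + k2) => match fintype.split i with inl j => a1 j | inr j => a2 j end),
    (Num.min e1 e2); split.
  + by move=> i; case: fintype.split.
  + by rewrite lt_min e10.
  + move=> q h; split.
    * apply: h1 => i; have := h (lshift k2 i).
      by rewrite (unsplitK (inl i)) lt_min => /andP[].
    * apply: h2 => i; have := h (rshift k1 i).
      by rewrite (unsplitK (inr i)) lt_min => /andP[].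
- move=> N1 N2 sub [k [a [e [Ca e0 h]]]].
  by exists k, a, e; split => // q /h /sub.
Qed.

Lemma init_nbhs_singleton (p : T) (N : set T) : init_nbhs p N -> N p.
Proof.
by move=> [k [a [e [_ e0 h]]]]; apply: h => i; rewrite subrr normr0.
Qed.

Lemma init_nbhs_nbhs (p : T) (N : set T) :
  init_nbhs p N -> init_nbhs p (init_nbhs^~ N).
Proof.
move=> [k [a [e [Ca e0 h]]]]; exists k, a, (e / 2); split => //.
  by rewrite divr_gt0.
move=> q hq; exists k, a, (e / 2); split => //; first by rewrite divr_gt0.
move=> r hr; apply: h => i; rewrite [e]splitr.
rewrite (_ : a i r - a i p = (a i r - a i q) + (a i q - a i p)); last first.
  by rewrite addrA subrK.
by rewrite (le_lt_trans (ler_normD _ _)) // ltrD.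
Qed.

HB.instance Definition _ := gen_eqMixin (dtop C).
HB.instance Definition _ := gen_choiceMixin (dtop C).
HB.instance Definition _ := hasNbhs.Build (dtop C) init_nbhs.
HB.instance Definition _ := Nbhs_isNbhsTopological.Build (dtop C)
  init_nbhs_filter init_nbhs_singleton init_nbhs_nbhs.

(* near p, f is a smooth function of finitely many functions of C *)
Definition smooth_wrt (p : T) (f : T -> R) : Prop :=
  exists (k : nat) (a : 'I_k -> T -> R) (phi : 'rV[R]_k -> R) (W : set 'rV[R]_k),
    [/\ forall i, C (a i), open W, W (\row_i a i p), smooth_on W phi &
        \forall q \near (p : dtop C), f q = phi (\row_i a i q)].

Definition diff_closed : Prop :=
  forall f, (forall p, smooth_wrt p f) -> C f.

End InitialTopology.

Record diffspace := DiffSpace {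
  carrier : Type;
  Cinf : set (carrier -> R);
  Cinf_closed : diff_closed Cinf
}.
Arguments Cinf : clear implicits.

Definition space (M : diffspace) : topologicalType := dtop (Cinf M).
Coercion space : diffspace >-> topologicalType.

(* smoothness of the germ of f at p *)
Definition smooth_at (M : diffspace) (p : M) (f : M -> R) : Prop :=
  smooth_wrt (Cinf M) p f.

Definition gen (T : Type) (A : set (T -> R)) : set (T -> R) :=
  [set f | forall C : set (T -> R), A `<=` C -> diff_closed C -> C f].

Lemma gen_closed (T : Type) (A : set (T -> R)) : diff_closed (gen A).
Proof.
move=> f hf C AC cC; apply: (cC) => p.
have sub : gen A `<=` C by move=> g; apply.
have [k [a [phi [W [ha oW Wp sphi nf]]]]] := hf p.
exists k, a, phi, W; split => //; first by move=> i; exact: sub.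
have [k' [a' [e [ha' e0 h]]]] := nf.
by exists k', a', e; split => // i; exact: sub.
Qed.

Definition generated (T : Type) (A : set (T -> R)) : diffspace :=
  DiffSpace (@gen_closed T A).

Lemma smooth_at_op (op : R -> R -> R) (M : diffspace) (p : M) (f g : M -> R) :
  (forall n (W : set 'rV[R]_n) (u v : 'rV[R]_n -> R), open W ->
     smooth_on W u -> smooth_on W v -> smooth_on W (fun x => op (u x) (v x))) ->
  smooth_at p f -> smooth_at p g -> smooth_at p (fun x => op (f x) (g x)).
Proof.
move=> hop [k1 [a1 [u [W1 [C1 oW1 W1p su nf]]]]].
move=> [k2 [a2 [v [W2 [C2 oW2 W2p sv ng]]]]].
pose a := fun i : 'I_(k1 + k2) => match fintype.split i with inl j => a1 j | inr j => a2 j end.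
pose W : set 'rV[R]_(k1 + k2) := lsubmx @^-1` W1 `&` rsubmx @^-1` W2.
have al q : lsubmx (\row_i a i q) = \row_i a1 i q.
  by apply/rowP => i; rewrite !mxE /a (unsplitK (inl i)).
have ar q : rsubmx (\row_i a i q) = \row_i a2 i q.
  by apply/rowP => i; rewrite !mxE /a (unsplitK (inr i)).
have oW : open W.
  apply: openI; apply: open_comp => // x _.
    exact: continuous_lsubmx.
  exact: continuous_rsubmx.
exists (k1 + k2)%N, a, (fun x => op (u (lsubmx x)) (v (rsubmx x))), W; split => //.
- by move=> i; rewrite /a; case: fintype.split.
- by split; rewrite /= ?al ?ar.
- apply: hop => // k.
    by apply: (Ck_on_comp_linear (L := lsubmx) _ _ (su k)) => [|x []//];
      exact: continuous_lsubmx.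
  by apply: (Ck_on_comp_linear (L := rsubmx) _ _ (sv k)) => [|x []//];
    exact: continuous_rsubmx.
- by apply: filterS2 nf ng => q fq gq; rewrite al ar fq gq.
Qed.

Lemma smooth_at_lin (M : diffspace) (p : M) (c : R) (f g : M -> R) :
  smooth_at p f -> smooth_at p g -> smooth_at p (fun x => c * f x + g x).
Proof.
apply: (smooth_at_op (op := fun y z => c * y + z)) => n W u v oW su sv k.
exact: (Ck_onD oW (Ck_onM oW (Ck_on_cst k W c) (su k)) (sv k)).
Qed.

Lemma smooth_at_mul (M : diffspace) (p : M) (f g : M -> R) :
  smooth_at p f -> smooth_at p g -> smooth_at p (fun x => f x * g x).
Proof.
apply: (smooth_at_op (op := fun y z => y * z)) => n W u v oW su sv k.
exact: (Ck_onM oW (su k) (sv k)).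
Qed.

Definition smooth_map_at (M N : diffspace) (F : M -> N) (p : M) : Prop :=
  forall f : N -> R, smooth_at (F p) f -> smooth_at p (f \o F).

Definition smooth_map (M N : diffspace) (F : M -> N) : Prop :=
  forall p, smooth_map_at F p.

Definition diffeo_on (M N : diffspace) (U : set M) (V : set N) (F : M -> N) :=
  [/\ forall x, U x -> V (F x) /\ smooth_map_at F x &
      exists H : N -> M,
        [/\ forall y, V y -> U (H y) /\ smooth_map_at H y,
            forall x, U x -> H (F x) = x &
            forall y, V y -> F (H y) = y]].

Definition euclidean (n : nat) : diffspace :=
  generated [set f : 'rV[R]_n -> R | exists i, f = (fun x => x 0 i)].

Definition manifold (n : nat) (M : diffspace) : Prop :=
  [/\ hausdorff_space M, @second_countable M &
      forall p : M, exists (U : set M) (V : set (euclidean n)) (F : M -> euclidean n),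
        [/\ open U, U p, open V & diffeo_on U V F]].

Definition subspace (M : diffspace) (S : set M) : diffspace :=
  generated [set f : {x : M | S x} -> R |
    exists2 h, Cinf M h & f = (fun x => h (sval x))].

Definition prodspace (M N : diffspace) : diffspace :=
  generated [set f : M * N -> R |
    (exists2 h, Cinf M h & f = (fun x => h x.1)) \/
    (exists2 h, Cinf N h & f = (fun x => h x.2))].

(* Tangent vectors are the derivations of the algebra of real functions that
   are smooth near the foot point; value 0 elsewhere makes them extensional.
   Locality is automatic: if f vanishes near p then f = f * (1 - chi) for the
   indicator chi of a neighbourhood of p. *)
Record tvec (M : diffspace) := Tvec {
  foot : M;
  act : (M -> R) -> R;
  act_lin : forall c f g, smooth_at foot f -> smooth_at foot g ->
    act (fun x => c * f x + g x) = c * act f + act g;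
  act_leibniz : forall f g, smooth_at foot f -> smooth_at foot g ->
    act (fun x => f x * g x) = act f * g foot + f foot * act g;
  act_out : forall f, ~ smooth_at foot f -> act f = 0
}.

Lemma tvec_ext (M : diffspace) (V W : tvec M) :
  foot V = foot W -> (forall f, act V f = act W f) -> V = W.
Proof.
case: V W => [p a l b o] [q a' l' b' o'] /= pq /funext aa; subst q a'.
by f_equal; exact: Prop_irrelevance.
Qed.

Local Obligation Tactic := idtac.

Section TangentOperations.
Variables (M N : diffspace).

Program Definition tzero (p : M) : tvec M := @Tvec M p (fun=> 0) _ _ _.
Next Obligation. by move=> *; rewrite mulr0 addr0. Qed.
Next Obligation. by move=> *; rewrite mul0r mulr0 addr0. Qed.
Next Obligation. by []. Qed.

Program Definition tscale (r : R) (V : tvec M) : tvec M :=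
  @Tvec M (foot V) (fun f => r * act V f) _ _ _.
Next Obligation.
by move=> r V c f g sf sg /=; rewrite (act_lin c sf sg) mulrDr mulrCA.
Qed.
Next Obligation.
by move=> r V f g sf sg /=; rewrite (act_leibniz sf sg) mulrDr mulrA (mulrCA r).
Qed.
Next Obligation. by move=> r V f nf /=; rewrite act_out // mulr0. Qed.

(* meaningful only for two vectors with the same foot *)
Definition tadd_act (V W : tvec M) (f : M -> R) : R :=
  if `[< foot W = foot V >] then act V f + act W f else act V f.

Program Definition tadd (V W : tvec M) : tvec M :=
  @Tvec M (foot V) (tadd_act V W) _ _ _.
Next Obligation.
move=> V W c f g sf sg; rewrite /tadd_act; case: asboolP => [e|_]; last exact: act_lin.
move: (sf) (sg); rewrite -e => sf' sg'.
by rewrite (act_lin c sf sg) (act_lin c sf' sg') mulrDr addrACA.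
Qed.
Next Obligation.
move=> V W f g sf sg; rewrite /tadd_act; case: asboolP => [e|_]; last exact: act_leibniz.
move: (sf) (sg); rewrite -{1 2}e => sf' sg'.
by rewrite (act_leibniz sf sg) (act_leibniz sf' sg') e mulrDl mulrDr addrACA.
Qed.
Next Obligation.
move=> V W f nf; rewrite /tadd_act; case: asboolP => [e|_].
  by rewrite !act_out ?e // addr0.
by rewrite act_out.
Qed.

(* tangent map of F at foot V (zero if F is not smooth there) *)
Definition tmap_act (F : M -> N) (V : tvec M) (f : N -> R) : R :=
  if `[< smooth_map_at F (foot V) /\ smooth_at (F (foot V)) f >]
  then act V (f \o F) else 0.

Program Definition tmap (F : M -> N) (V : tvec M) : tvec N :=
  @Tvec N (F (foot V)) (tmap_act F V) _ _ _.
Next Obligation.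
move=> F V c f g sf sg; rewrite /tmap_act.
have [sF|nF] := pselect (smooth_map_at F (foot V)); last first.
  by rewrite !asboolF ?mulr0 ?addr0 // => -[].
rewrite !asboolT //; last by split => //; exact: smooth_at_lin.
exact: (act_lin c (sF _ sf) (sF _ sg)).
Qed.
Next Obligation.
move=> F V f g sf sg; rewrite /tmap_act.
have [sF|nF] := pselect (smooth_map_at F (foot V)); last first.
  by rewrite !asboolF ?mul0r ?mulr0 ?addr0 // => -[].
rewrite !asboolT //; last by split => //; exact: smooth_at_mul.
exact: (act_leibniz (sF _ sf) (sF _ sg)).
Qed.
Next Obligation.
by move=> F V f nf; rewrite /tmap_act asboolF // => -[].
Qed.

Definition diff_curve (c : R -> M) (t : R) : Prop :=
  forall f, smooth_at (c t) f -> derivable (f \o c) t 1.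

(* velocity of c at t (zero if c is not differentiable there) *)
Definition velocity_act (c : R -> M) (t : R) (f : M -> R) : R :=
  if `[< diff_curve c t /\ smooth_at (c t) f >] then 'D_1 (f \o c) t else 0.

Program Definition velocity (c : R -> M) (t : R) : tvec M :=
  @Tvec M (c t) (velocity_act c t) _ _ _.
Next Obligation.
move=> c t r f g sf sg; rewrite /velocity_act.
have [dc|nc] := pselect (diff_curve c t); last first.
  by rewrite !asboolF ?mulr0 ?addr0 // => -[].
rewrite !asboolT //; last by split => //; exact: smooth_at_lin.
have [df dg] := (dc _ sf, dc _ sg).
rewrite (_ : _ \o c = r *: (f \o c) + (g \o c)); last exact/funext.
by rewrite deriveD ?deriveZ //; exact: derivableZ.
Qed.
Next Obligation.
move=> c t f g sf sg; rewrite /velocity_act.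
have [dc|nc] := pselect (diff_curve c t); last first.
  by rewrite !asboolF ?mul0r ?mulr0 ?addr0 // => -[].
rewrite !asboolT //; last by split => //; exact: smooth_at_mul.
have [df dg] := (dc _ sf, dc _ sg).
rewrite (_ : _ \o c = (f \o c) * (g \o c)); last exact/funext.
by rewrite deriveM // addrC; congr (_ + _); exact: mulrC.
Qed.
Next Obligation.
by move=> c t f nf; rewrite /velocity_act asboolF // => -[].
Qed.

End TangentOperations.

Definition tangent_bundle (M : diffspace) : diffspace :=
  generated [set F : tvec M -> R |
    (exists2 f, Cinf M f & F = (fun V => f (foot V))) \/
    (exists2 f, Cinf M f & F = (fun V => act V f))].

Definition submersion (M N : diffspace) (F : M -> N) : Prop :=
  smooth_map F /\
  forall (p : M) (W : tvec N), foot W = F p -> exists2 V, foot V = p & tmap F V = W.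

Definition vector_field (M : diffspace) (X : M -> tvec M) : Prop :=
  (forall p, foot (X p) = p) /\ smooth_map (X : M -> tangent_bundle M).

(* Z = [X, Y] *)
Definition is_bracket (M : diffspace) (X Y Z : M -> tvec M) : Prop :=
  forall f, Cinf M f -> forall p,
    act (Z p) f = act (X p) (fun q => act (Y q) f) - act (Y p) (fun q => act (X q) f).

Definition integral_curve (M : diffspace) (X : M -> tvec M) (J : set R) (c : R -> M) :=
  forall t, J t -> diff_curve c t /\ velocity c t = X (c t).

(* X is a SODE on the Lie algebroid proj : A -> N with anchor rho *)
Definition SODE (A N : diffspace) (proj : A -> N) (rho : A -> tvec N)
    (X : A -> tvec A) : Prop :=
  vector_field X /\ forall a, tmap proj (X a) = rho a.

End DifferentialSpaces.
Arguments diffspace : clear implicits.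
Arguments Cinf {R} d _.

(* mul g h is constrained only when tgt g = src h. *)
Record lie_groupoid (R : realType) := LieGroupoid {
  arr : diffspace R;
  obj : diffspace R;
  src : arr -> obj;
  tgt : arr -> obj;
  unit_arr : obj -> arr;
  inv_arr : arr -> arr;
  mul_arr : arr -> arr -> arr;
  arr_manifold : exists n, manifold n arr;
  obj_manifold : exists n, manifold n obj;
  src_unit : forall q, src (unit_arr q) = q;
  tgt_unit : forall q, tgt (unit_arr q) = q;
  src_mul : forall g h, tgt g = src h -> src (mul_arr g h) = src g;
  tgt_mul : forall g h, tgt g = src h -> tgt (mul_arr g h) = tgt h;
  mul_assoc : forall g h k, tgt g = src h -> tgt h = src k ->
    mul_arr (mul_arr g h) k = mul_arr g (mul_arr h k);
  unit_mul : forall g, mul_arr (unit_arr (src g)) g = g;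
  mul_unit : forall g, mul_arr g (unit_arr (tgt g)) = g;
  src_inv : forall g, src (inv_arr g) = tgt g;
  tgt_inv : forall g, tgt (inv_arr g) = src g;
  mul_inv : forall g, mul_arr g (inv_arr g) = unit_arr (src g);
  inv_mul : forall g, mul_arr (inv_arr g) g = unit_arr (tgt g);
  src_submersion : submersion src;
  tgt_submersion : submersion tgt;
  unit_smooth : smooth_map unit_arr;
  inv_smooth : smooth_map inv_arr;
  mul_smooth : smooth_map
    ((fun gh : {gh : arr * arr | tgt gh.1 = src gh.2} =>
        mul_arr (sval gh).1 (sval gh).2)
     : subspace (M := prodspace arr arr) (fun gh => tgt gh.1 = src gh.2) -> arr)
}.

Section LieAlgebroid.
Context {R : realType} (G : lie_groupoid R).

Definition vertical (V : tvec (arr G)) : Prop :=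
  tmap (@src R G) V = tzero (src (foot V)).

Definition Valpha : diffspace R :=
  subspace (M := tangent_bundle (arr G)) vertical.

Definition vtan (v : Valpha) : tvec (arr G) := sval v.

Definition tilde_tau (v : Valpha) : arr G := foot (vtan v).

Definition AG : diffspace R :=
  subspace (M := Valpha) (fun v => exists q, tilde_tau v = unit_arr q).

Definition AG_incl (a : AG) : Valpha := sval a.

Definition AG_tau (a : AG) : obj G := src (tilde_tau (AG_incl a)).

Definition AG_anchor (a : AG) : tvec (obj G) := tmap (@tgt R G) (vtan (AG_incl a)).

Lemma vertical_zero (g : arr G) : vertical (tzero g).
Proof.
by apply: tvec_ext => //= f; rewrite /tmap_act; case: asboolP.
Qed.

Lemma vertical_scale (r : R) (V : tvec (arr G)) :
  vertical V -> vertical (tscale r V).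
Proof.
move=> hV; apply: tvec_ext => //= f.
have /= h := congr1 (fun W => act W f) hV.
by move: h; rewrite /tmap_act /=; case: asboolP => // _ ->; rewrite mulr0.
Qed.

Definition zeroA (q : obj G) : AG :=
  exist _ (exist _ (tzero (unit_arr q)) (vertical_zero (unit_arr q)) : Valpha)
    (ex_intro _ q erefl).

Definition scaleA (r : R) (a : AG) : AG :=
  exist _ (exist _ (tscale r (vtan (AG_incl a))) (vertical_scale r (svalP (AG_incl a)))
           : Valpha)
    (svalP a).

Definition euler (a : AG) : tvec AG := velocity (fun t => scaleA (expR t) a) 0.

Definition homogeneous_quadratic (X : AG -> tvec AG) : Prop := is_bracket euler X X.

Definition alpha_fibre (q : obj G) : diffspace R :=
  subspace (M := arr G) (fun h => src h = q).

Definition fibre_incl (q : obj G) (h : alpha_fibre q) : arr G := sval h.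

(* w = T_g l_{g^-1} (v), where g is the foot of v and ker T_g alpha is identified
   with the tangent space at g of the alpha-fibre through g *)
Definition left_translated (v : Valpha) (w : AG) : Prop :=
  let g := tilde_tau v in
  exists V : tvec (alpha_fibre (src g)),
    tmap (@fibre_incl (src g)) V = vtan v /\
    tmap (fun h : alpha_fibre (src g) => mul_arr (inv_arr g) (fibre_incl h)) V
      = vtan (AG_incl w).

Definition Psi (v : Valpha) : AG :=
  xget (zeroA (tgt (tilde_tau v))) (left_translated v).

(* Curves on [0,1] are restrictions of curves on some open interval around it. *)
Definition around01 (d : R) : set R := [set t | - d < t < 1 + d].

Definition trajectory (X : Valpha -> tvec Valpha) (v : Valpha) (s : R -> arr G) :=
  exists2 d : R, 0 < d &
    (forall t, around01 d t -> src (s t) = src (s 0)) /\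
    exists c : R -> Valpha,
      [/\ forall t, around01 d t -> diff_curve s t /\ vtan (c t) = velocity s t,
          c 0 = v &
          integral_curve X (around01 d) c].

Definition flow01 (X : Valpha -> tvec Valpha) (D : set Valpha)
    (Phi : R -> Valpha -> Valpha) : Prop :=
  forall v, D v -> Phi 0 v = v /\
    exists2 d : R, 0 < d & integral_curve X (around01 d) (Phi^~ v).

Definition starshaped (D : set AG) : Prop :=
  forall a t, D a -> 0 <= t <= 1 -> D (scaleA t a).

Definition exp_map (Phi : R -> Valpha -> Valpha) (a : AG) : arr G :=
  tilde_tau (Phi 1 (AG_incl a)).

(* the canonical identifications at 0_q and at unit_arr q, for foot u = q = AG_tau a *)
Definition ident_AG (u : tvec (obj G)) (a : AG) : tvec AG :=
  tadd (tmap zeroA u) (velocity (fun t => scaleA t a) 0).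

Definition ident_G (u : tvec (obj G)) (a : AG) : tvec (arr G) :=
  tadd (tmap (@unit_arr R G) u) (vtan (AG_incl a)).

End LieAlgebroid.

(* Main.v *)
Require Import Defs.
From mathcomp Require Import all_boot all_order all_algebra.
From mathcomp Require Import all_classical all_reals all_analysis.
From mathcomp Require Import lra ring.
Import Order.TTheory GRing.Theory Num.Theory.
Import numFieldNormedType.Exports.

Set Implicit Arguments.
Unset Strict Implicit.
Unset Printing Implicit Defensive.

Local Open Scope classical_set_scope.
Local Open Scope ring_scope.

(* Evaluated on a fibre coordinate of AG, the equation [Delta, Gamma] = Gamma is a
   linear ODE along the orbits of Delta, so Gamma is homogeneous of degree 2 there.
   V alpha is the pull-back of AG along tgt, hence a SODE lifting Gamma is determined
   by Gamma, and the homogeneity passes to the lift.  Consequently, if c is an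
   integral curve of the lift starting at v, so is t |-> s c(s t), starting at s v;
   uniqueness of integral curves yields exp(s v) = sigma_v(s), and s = 0 gives
   exp(0_q) = eps(q).  The tangent map is then computed on the zero section, where
   exp is eps, and on the lines t |-> t v, where exp is sigma_v.

   Derivations are handled through Hadamard's lemma: they obey the chain rule for
   smooth functions of finitely many smooth functions.  That Psi is defined on all of
   V alpha needs the implicit function theorem for src: a vector killed by T src is
   tangent to the alpha-fibre as a differential space. *)

(** * Calculus on row vectors *)

(** [V alpha] and [AG] carry the functions induced from a tangent bundle, and neither is shown to be
    a manifold. Uniqueness of integral curves on [V alpha] asks for less: near each point finitely
    many global functions through which all germs factor, and smooth functions that separate points.
    Both properties come from [G] by adjoining to a function [f] on [G] the fibre coordinate
    [v |-> v f].

    Degree 2 passes to the lift because a fibre coordinate of [v] is locally a sum of products of a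
    fibre coordinate of [Psi v] with a function of the foot. Along the lift, the derivative of the
    first factor is a value of [Gamma], of degree 2; that of the second is a derivative in the
    direction [v], and it multiplies a factor already linear in [v].

    The orbits of the Euler field reach only positive multiples of a vector, so homogeneity is
    obtained for factors [s >= 0] and the comparison of [exp] with trajectories is one-sided in
    time. *)

Section Calculus.
Context {R : realType}.
Implicit Types n : nat.

Definition partial n (i : 'I_n) (f : 'rV[R]_n -> R) : 'rV[R]_n -> R :=
  fun x => 'D_(delta_mx 0 i) f x.

Lemma norm_coord_le n (x : 'rV[R]_n) i : `|x 0 i| <= `|x|.
Proof.
rewrite -[leRHS]/(mx_norm x) mx_normrE.
by apply: (le_bigmax _ (fun ij : 'I_1 * 'I_n => `|x ij.1 ij.2|) (0, i)).
Qed.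

Lemma norm_rV_le n (x : 'rV[R]_n) (M : R) :
  0 <= M -> (forall i, `|x 0 i| <= M) -> `|x| <= M.
Proof.
move=> M0 h; rewrite -[leLHS]/(mx_norm x) mx_normrE; apply/bigmax_leP; split=> //.
by move=> [i j] _ /=; rewrite (ord1 i).
Qed.

Lemma norm_rV_lt n (x : 'rV[R]_n) (M : R) :
  0 < M -> (forall i, `|x 0 i| < M) -> `|x| < M.
Proof.
move=> M0 h; rewrite -[ltLHS]/(mx_norm x) mx_normrE; apply/bigmax_ltP; split=> //.
by move=> [i j] _ /=; rewrite (ord1 i).
Qed.

Lemma derive_partial n (f : 'rV[R]_n -> R) x v : differentiable f x ->
  'D_v f x = \sum_i v 0 i * partial i f x.
Proof.
move=> df; rewrite deriveE // {1}[v]row_sum_delta linear_sum.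
by apply: eq_bigr => i _; rewrite linearZ /= /partial deriveE.
Qed.

Lemma smooth_on_diff n (W : set 'rV[R]_n) f x :
  smooth_on W f -> W x -> differentiable f x.
Proof. by move=> sf Wx; have [h _] := sf 1%N; exact: h. Qed.

Lemma smooth_on_derive n (W : set 'rV[R]_n) f v :
  smooth_on W f -> smooth_on W (fun x => 'D_v f x).
Proof. by move=> sf k; have [_ h] := sf k.+1; exact: h. Qed.

Lemma smooth_on_continuous n (W : set 'rV[R]_n) f x :
  smooth_on W f -> W x -> {for x, continuous f}.
Proof. by move=> sf Wx; exact: (sf 0%N). Qed.

Lemma smooth_onW n (W V : set 'rV[R]_n) f :
  V `<=` W -> smooth_on W f -> smooth_on V f.
Proof.
move=> VW sf k; elim: k f {sf}(sf k) => [|k IH] f /= h.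
  by move=> x /VW; exact: h.
by case: h => h1 h2; split=> [x /VW|v]; [exact: h1|exact: IH].
Qed.

Lemma smooth_on_eq n (W : set 'rV[R]_n) (f g : 'rV[R]_n -> R) :
  open W -> (forall x, W x -> f x = g x) -> smooth_on W f -> smooth_on W g.
Proof. by move=> oW fg sf k; exact: Ck_on_eq fg (sf k). Qed.

Lemma smooth_onD n (W : set 'rV[R]_n) f g :
  open W -> smooth_on W f -> smooth_on W g -> smooth_on W (fun x => f x + g x).
Proof. by move=> oW sf sg k; exact: (Ck_onD oW (sf k) (sg k)). Qed.

Lemma smooth_onM n (W : set 'rV[R]_n) f g :
  open W -> smooth_on W f -> smooth_on W g -> smooth_on W (fun x => f x * g x).
Proof. by move=> oW sf sg k; exact: (Ck_onM oW (sf k) (sg k)). Qed.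

Lemma smooth_on_cst n (W : set 'rV[R]_n) (c : R) : smooth_on W (fun=> c).
Proof. by move=> k; exact: Ck_on_cst. Qed.

Lemma Ck_on_sum j n (W : set 'rV[R]_n) k (f : 'I_k -> 'rV[R]_n -> R) :
  open W -> (forall i, Ck_on j W (f i)) -> Ck_on j W (fun x => \sum_i f i x).
Proof.
move=> oW; elim: k f => [|k IH] f sf.
  by under eq_fun do rewrite big_ord0; exact: Ck_on_cst.
under eq_fun do rewrite big_ord_recl.
by apply: (Ck_onD oW) => //; apply: IH.
Qed.

Lemma smooth_on_sum n (W : set 'rV[R]_n) k (f : 'I_k -> 'rV[R]_n -> R) :
  open W -> (forall i, smooth_on W (f i)) ->
  smooth_on W (fun x => \sum_i f i x).
Proof. by move=> oW sf j; apply: Ck_on_sum => // i; exact: sf. Qed.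

Lemma derive_coord n (i : 'I_n) (v x : 'rV[R]_n) :
  'D_v (fun y : 'rV[R]_n => y 0 i) x = v 0 i.
Proof.
have d : derivable (id : 'rV[R]_n -> 'rV[R]_n) x v by exact: derivable_id.
have E := derive_mx d.
by rewrite derive_id in E; rewrite {2}E mxE.
Qed.

Lemma smooth_on_coord n (W : set 'rV[R]_n) i : smooth_on W (fun x => x 0 i).
Proof.
case=> [|k] /=; first by move=> x _; exact: coord_continuous.
split=> [x _|v]; first exact: differentiable_coord.
rewrite (_ : (fun x => _) = cst (v 0 i)); first exact: Ck_on_cst.
by apply/funext => x; rewrite derive_coord.
Qed.

Lemma differentiable_row m n (a : 'I_n -> 'rV[R]_m -> R) x :
  (forall i, differentiable (a i) x) -> differentiable (fun y => \row_i a i y) x.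
Proof.
move=> da.
rewrite (_ : (fun y => _) =
    \sum_(i < n) (fun y => a i y *: (delta_mx 0 i : 'rV[R]_n))).
  by apply: differentiable_sum => i; exact: differentiableZl.
apply/funext => y; rewrite fct_sumE [LHS]row_sum_delta.
by apply: eq_bigr => i _; rewrite mxE.
Qed.

Lemma derive_row m n (a : 'I_n -> 'rV[R]_m -> R) x v :
  (forall i, differentiable (a i) x) ->
  'D_v (fun y => \row_i a i y) x = \row_i 'D_v (a i) x.
Proof.
move=> da; rewrite derive_mx; last by apply: diff_derivable; exact: differentiable_row.
apply/rowP => i; rewrite !mxE.
by congr ('D_v _ x); apply/funext => y; rewrite mxE.
Qed.

Lemma derive_comp_row m n (a : 'I_n -> 'rV[R]_m -> R) (f : 'rV[R]_n -> R) x v :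
  (forall i, differentiable (a i) x) -> differentiable f (\row_i a i x) ->
  'D_v (fun y => f (\row_i a i y)) x =
  \sum_i 'D_v (a i) x * partial i f (\row_i a i x).
Proof.
move=> da df; have dr := differentiable_row da.
rewrite -[fun y => _]/(f \o (fun y => \row_i a i y)) deriveE; last exact: differentiable_comp.
rewrite diff_comp //= -deriveE // -deriveE // derive_row // derive_partial //.
by apply: eq_bigr => i _; rewrite mxE.
Qed.

(** Induction on the order for all [f] at once: by the chain rule a derivative of the composite is a
    sum of products of a derivative of [a i] with a composite of the same form, [f] being replaced
    by a partial derivative. *)
Lemma smooth_on_comp m n (a : 'I_n -> 'rV[R]_m -> R) (f : 'rV[R]_n -> R) V W :
  open V -> open W -> (forall i, smooth_on V (a i)) -> smooth_on W f ->
  (forall x, V x -> W (\row_i a i x)) ->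
  smooth_on V (fun x => f (\row_i a i x)).
Proof.
move=> oV oW sa sf VW k; elim: k f sf => [|k IH] f sf /=.
  move=> x Vx; have dr : differentiable (fun y => \row_i a i y) x.
    by apply: differentiable_row => i; exact: smooth_on_diff (sa i) Vx.
  apply: (@continuous_comp _ _ _ (fun y => \row_i a i y) f).
    exact: differentiable_continuous.
  by apply: smooth_on_continuous sf _; exact: VW.
split=> [x Vx|v].
  apply: (@differentiable_comp _ _ _ _ (fun y => \row_i a i y) f).
    by apply: differentiable_row => i; exact: smooth_on_diff (sa i) Vx.
  by apply: smooth_on_diff sf _; exact: VW.
apply: (@Ck_on_eq _ k _ _ (fun x => \sum_i ('D_v (a i) x * partial i f (\row_i a i x)))) => //.
  move=> x Vx; rewrite derive_comp_row //.
    by move=> i; exact: smooth_on_diff (sa i) Vx.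
  by apply: smooth_on_diff sf _; exact: VW.
apply: (Ck_on_sum oV) => i.
apply: (Ck_onM oV); first exact: (smooth_on_derive v (sa i) k).
by apply: IH; exact: smooth_on_derive.
Qed.

Lemma ball_segment n (x0 p q : 'rV[R]_n) r (t : R) : ball x0 r p -> ball x0 r q ->
  0 <= t <= 1 -> ball x0 r (p + t *: (q - p)).
Proof.
rewrite -!ball_normE /= => hp hq /andP[t0 t1].
rewrite (_ : x0 - _ = (1 - t) *: (x0 - p) + t *: (x0 - q)); last first.
  by apply/rowP => i; rewrite !mxE; ring.
apply: le_lt_trans (ler_normD _ _) _; rewrite !normrZ.
rewrite (ger0_norm t0) ger0_norm ?subr_ge0 //.
have [->|t1'] := eqVneq t 1; first by rewrite subrr mul0r add0r mul1r.
have : (1 - t) * `|x0 - p| < (1 - t) * r by rewrite ltr_pM2l // subr_gt0 lt_neqAle t1' .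
have : t * `|x0 - q| <= t * r by rewrite ler_wpM2l // ltW.
move=> h1 h2; rewrite (_ : r = (1 - t) * r + t * r); last by ring.
exact: ltr_leD.
Qed.

Lemma derivable_line n (f : 'rV[R]_n -> R) (p v : 'rV[R]_n) (t : R) :
  differentiable f (p + t *: v) ->
  is_derive t 1 (fun s : R => f (p + s *: v)) ('D_v f (p + t *: v)).
Proof.
move=> df.
have E : (fun h : R => h^-1 *: (((fun s => f (p + s *: v)) \o shift t) (h *: 1) - f (p + t *: v)))
   = (fun h : R => h^-1 *: ((f \o shift (p + t *: v)) (h *: v) - f (p + t *: v))).
  apply/funext => h /=; congr (_ *: (f _ - _)).
  by rewrite /shift /= scaler1 scalerDl addrCA.
split; first by rewrite /derivable E; exact: diff_derivable.
by rewrite /derive E.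
Qed.

Lemma mvt_ball n (f : 'rV[R]_n -> R) (x0 p q : 'rV[R]_n) r :
  (forall x, ball x0 r x -> differentiable f x) -> ball x0 r p -> ball x0 r q ->
  exists t : R, 0 <= t <= 1 /\ f q - f p = 'D_(q - p) f (p + t *: (q - p)).
Proof.
move=> df hp hq.
have db (t : R) : 0 <= t <= 1 ->
    is_derive t 1 (fun s : R => f (p + s *: (q - p))) ('D_(q - p) f (p + t *: (q - p))).
  by move=> ht; apply: derivable_line; apply: df; exact: ball_segment.
have [||t ht] := @MVT R (fun s : R => f (p + s *: (q - p)))
    (fun t => 'D_(q - p) f (p + t *: (q - p))) 0 1 ltr01.
- move=> t; rewrite in_itv /= => /andP[t0 t1]; apply: db; by rewrite !ltW.
- apply: derivable_within_continuous => t; rewrite in_itv /= => /db h; exact: ex_derive.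
rewrite scale1r scale0r addr0 subr0 mulr1 (addrC p (q - p)) subrK => E.
by exists t; split => //; move: ht; rewrite in_itv /= => /andP[? ?]; rewrite !ltW.
Qed.

(** The closed ball of radius [r'] is compact and, as [r' < r], lies in the domain of continuity. *)
Lemma ball_bounded n (f : 'rV[R]_n -> R) x0 (r r' : R) :
  r' < r -> (forall x, ball x0 r x -> {for x, continuous f}) ->
  exists2 M : R, 0 <= M & forall x : 'rV[R]_n, ball x0 r' x -> `|f x| <= M.
Proof.
move=> r'r cf; pose K := [set x : 'rV[R]_n | `|x0 - x| <= r'].
have cK : compact K.
  apply: bounded_closed_compact.
    exists (`|x0| + r'); split; first exact: num_real.
    move=> M hM x Kx; apply: le_trans (ltW hM).
    rewrite (_ : x = x0 - (x0 - x)); last by rewrite opprB addrC subrK.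
    by apply: le_trans (ler_normB _ _) _; rewrite lerD2l.
  rewrite (_ : K = (fun x => `|x0 - x|) @^-1` [set y | y <= r']) //.
  apply: preimage_closed; last exact: closed_le.
  move=> x _; have c : continuous (fun y : 'rV[R]_n => x0 - y).
    by move=> y; apply: continuousB; [exact: cst_continuous|exact: cvg_id].
  exact: (@continuous_comp _ _ _ _ (fun y : 'rV[R]_n => `|y|) x (c x) (@norm_continuous _ _ (x0 - x))).
have /compact_bounded [M [Mr hM]] : compact (f @` K).
  apply: continuous_compact cK; apply: continuous_in_subspaceT => x.
  rewrite inE => Kx; apply: cf; rewrite -ball_normE /=; exact: le_lt_trans r'r.
exists (`|M| + 1); first by rewrite addr_ge0.
move=> x; rewrite -ball_normE /= => hx; apply: (hM (`|M| + 1)).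
  by rewrite (le_lt_trans (ler_norm _)) // ltrDl.
by exists x => //=; exact: ltW.
Qed.

Lemma ball_lipschitz n (f : 'rV[R]_n -> R) x0 (r r' : R) :
  r' < r -> smooth_on (ball x0 r) f ->
  exists2 L : R, 0 <= L & forall p q : 'rV[R]_n, ball x0 r' p -> ball x0 r' q ->
    `|f q - f p| <= L * `|q - p|.
Proof.
move=> r'r sf.
have r'W : ball x0 r' `<=` ball x0 r by move=> x; rewrite -ball_normE /= => /lt_trans; exact.
have /choice [M hM] : forall i, exists M : R, 0 <= M /\ forall x : 'rV[R]_n, ball x0 r' x -> `|partial i f x| <= M.
  move=> i; have [|M M0 hM] := @ball_bounded _ (partial i f) x0 r r' r'r; last by exists M.
  by move=> x hx; apply: smooth_on_continuous hx; exact: smooth_on_derive.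
exists (\sum_i M i); first by apply: sumr_ge0 => i _; have [] := hM i.
move=> p q hp hq.
have df x : ball x0 r' x -> differentiable f x by move=> /r'W; exact: smooth_on_diff.
have [t [ht ->]] := mvt_ball df hp hq.
have ht' := ball_segment hp hq ht.
rewrite derive_partial; last exact: df.
rewrite mulr_suml; apply: le_trans (ler_norm_sum _ _ _) _.
apply: ler_sum => i _; rewrite normrM mulrC.
by apply: ler_pM => //; [have [_] := hM i; exact|exact: norm_coord_le].
Qed.

(** [C] serves all [p] and [q] at once; this uniformity is what allows the estimate to be integrated
    over a segment later. *)
Lemma ball_taylor n (f : 'rV[R]_n -> R) x0 (r r' : R) :
  r' < r -> smooth_on (ball x0 r) f ->
  exists2 C : R, 0 <= C & forall p q : 'rV[R]_n, ball x0 r' p -> ball x0 r' q ->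
    `|f q - f p - \sum_i (q - p) 0 i * partial i f p| <= C * `|q - p| ^+ 2.
Proof.
move=> r'r sf.
have r'W : ball x0 r' `<=` ball x0 r by move=> x; rewrite -ball_normE /= => /lt_trans; exact.
have /choice [L hL] : forall i, exists L : R, 0 <= L /\ forall p q : 'rV[R]_n, ball x0 r' p ->
    ball x0 r' q -> `|partial i f q - partial i f p| <= L * `|q - p|.
  move=> i; have [|L L0 hL] := @ball_lipschitz _ (partial i f) x0 r r' r'r; last by exists L.
  exact: smooth_on_derive.
exists (\sum_i L i); first by apply: sumr_ge0 => i _; have [] := hL i.
move=> p q hp hq.
have df x : ball x0 r' x -> differentiable f x by move=> /r'W; exact: smooth_on_diff.
have [t [ht ->]] := mvt_ball df hp hq.
have ht' := ball_segment hp hq ht.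
rewrite derive_partial; last exact: df.
rewrite -sumrB mulr_suml; apply: le_trans (ler_norm_sum _ _ _) _.
apply: ler_sum => i _; rewrite -mulrBr normrM mulrC expr2 mulrA.
apply: ler_pM => //; last exact: norm_coord_le.
have [L0 hLi] := hL i; apply: le_trans (hLi _ _ hp ht') _.
rewrite ler_wpM2l // addrC addKr normrZ.
have /andP[t0 t1] := ht.
by rewrite ger0_norm // ler_piMl.
Qed.

End Calculus.

(** * Hadamard's lemma, by averages over segments *)

Section Hadamard.
Context {R : realType}.

Lemma quadratic_differentiable (V W : normedModType R) (u : V -> W) (p : V) (C : R) :
  (\forall q \near p, `|u q - u p| <= C * `|q - p| ^+ 2) ->
  differentiable u p /\ forall v, 'D_v u p = 0.
Proof.
move=> hu.
(* The differential of a constant plays the zero linear map in the expansion of [u]. *)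
have dc : continuous ('d (cst (0 : W)) p) by exact: diff_continuous.
have h : u \o shift p = cst (u p) + 'd (cst (0 : W)) p +o_ 0 id.
  apply/eqaddoP => e e0.
  (* [C] may be zero or negative; [|C| + 1] is a positive number above it. *)
  have C0 : 0 < `|C| + 1 by rewrite ltr_wpDl.
  have hu0 : \forall h \near (0 : V), `|u (h + p) - u p| <= C * `|h| ^+ 2.
    move: hu; rewrite (near_shift 0) /=; apply: filterS => y /=.
    by rewrite subr0 addrK.
  near=> h.
  have -> : (u \o shift p - (cst (u p) + 'd (cst (0 : W)) p)) h = u (h + p) - u p.
    by rewrite -![(_ - _) h]/(_ - _) /= -![(_ + _) h]/(_ + _) diff_cst /= addr0.
  have he : `|h| <= e / (`|C| + 1).
    near: h; apply: (@nbhs0_le _ _ (e / (`|C| + 1))); exact: divr_gt0.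
  apply: (@le_trans _ _ (C * `|h| ^+ 2)); first by near: h.
  rewrite /= expr2 mulrA ler_wpM2r //.
  apply: (@le_trans _ _ ((`|C| + 1) * `|h|)); last by rewrite mulrC -ler_pdivlMr.
  by rewrite ler_wpM2r // (le_trans (ler_norm _)) // lerDl.
have E := diff_unique dc h.
have du : differentiable u p by apply/diff_locallyP; rewrite E.
by split=> // v; rewrite deriveE // E diff_cst.
Unshelve. all: by end_near. Qed.

(** Subtracting the linear form with coefficients [g] leaves a function with quadratic variation at
    [p], whose derivative there is 0. *)
Lemma taylor_differentiable n (f : 'rV[R]_n -> R) (p : 'rV[R]_n) (g : 'I_n -> R) (C : R) :
  (\forall q \near p, `|f q - f p - \sum_i (q - p) 0 i * g i| <= C * `|q - p| ^+ 2) ->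
  differentiable f p /\ forall v, 'D_v f p = \sum_i v 0 i * g i.
Proof.
move=> hf; pose l (q : 'rV[R]_n) := \sum_i q 0 i * g i.
have sl : smooth_on setT l.
  apply: smooth_on_sum openT _ => i.
  by apply: smooth_onM openT _ _; [exact: smooth_on_coord|exact: smooth_on_cst].
have dl : differentiable l p by exact: smooth_on_diff sl I.
have [|du Du] := @quadratic_differentiable 'rV[R]_n R (f - l) p C.
  apply: filterS hf => q; congr (_ <= _); congr (`|_|).
  rewrite -![(f - l) _]/(_ - _) /l.
  rewrite (_ : \sum_i (q - p) 0 i * g i = \sum_i q 0 i * g i - \sum_i p 0 i * g i).
    by ring.
  by rewrite -sumrB; apply: eq_bigr => i _; rewrite !mxE mulrBl.
rewrite (_ : f = (f - l) + l); last by rewrite subrK.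
split; first exact: differentiableD.
move=> v; rewrite deriveD; [|exact: diff_derivable..].
rewrite Du add0r derive_partial //; apply: eq_bigr => i _; congr (_ * _).
rewrite /partial /l.
have E : (fun q : 'rV[R]_n => \sum_j q 0 j * g j) =
    \sum_j (g j \o* (fun q : 'rV[R]_n => q 0 j)).
  by apply/funext => q; rewrite fct_sumE.
have dc j : derivable (fun q : 'rV[R]_n => q 0 j) p (delta_mx 0 i).
  by apply: diff_derivable; exact: differentiable_coord.
rewrite E derive_sum => [|j].
  rewrite (bigD1 i) //= big1 ?addr0 => [|j ji].
    by rewrite deriveMr // derive_coord mxE !eqxx mulr1.
  by rewrite deriveMr // derive_coord mxE (negbTE ji) andbF mulr0.
apply: diff_derivable; apply: differentiableM; first exact: differentiable_coord.
exact: differentiable_cst.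
Qed.

Let mu := @lebesgue_measure R.

Definition cont01 (f : R -> R) := forall s : R, 0 <= s <= 1 -> {for s, continuous f}.

Lemma cont01_integrable f : cont01 f -> mu.-integrable `[0, 1] (EFin \o f).
Proof.
move=> cf; apply: continuous_compact_integrable; first exact: segment_compact.
by apply: continuous_in_subspaceT => s; rewrite inE /= in_itv /= => /cf.
Qed.

Lemma cont01_cst (c : R) : cont01 (cst c).
Proof. by move=> s _; exact: cst_continuous. Qed.

Lemma cont01_sum k (F : 'I_k -> R -> R) :
  (forall i, cont01 (F i)) -> cont01 (fun s => \sum_i F i s).
Proof.
elim: k F => [|k IH] F cF.
  rewrite (_ : (fun s : R => _) = cst 0); first exact: cont01_cst.
  by apply/funext => s'; rewrite big_ord0.
rewrite (_ : (fun s : R => _) = F ord0 + (fun s : R => \sum_i F (lift ord0 i) s)).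
  by move=> s s01; apply: continuousD; [exact: cF|exact: IH].
by apply/funext => s'; rewrite big_ord_recl.
Qed.

Lemma int01_lin k (F : 'I_k -> R -> R) (c : 'I_k -> R) :
  (forall i, cont01 (F i)) ->
  \int[mu]_(s in `[0, 1]) (\sum_i c i * F i s) =
  \sum_i c i * \int[mu]_(s in `[0, 1]) F i s.
Proof.
elim: k F c => [|k IH] F c cF.
  under eq_Rintegral do rewrite big_ord0.
  by rewrite big_ord0 Rintegral_cst // mul0r.
under eq_Rintegral do rewrite big_ord_recl.
rewrite big_ord_recl RintegralD //.
- rewrite RintegralZl //; last exact: cont01_integrable.
  by rewrite (IH (fun i => F (lift ord0 i)) (fun i => c (lift ord0 i))).
- apply: cont01_integrable => s s01.
  by apply: continuousM; [exact: cst_continuous|exact: cF].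
- apply: cont01_integrable; apply: cont01_sum => i s s01.
  by apply: continuousM; [exact: cst_continuous|exact: cF].
Qed.

Lemma mu01 : fine (mu `[0%R, 1%R]) = 1.
Proof. by rewrite /mu lebesgue_measure_itv /= lte_fin ltr01 oppr0 adde0. Qed.

Lemma int01_bound (f : R -> R) (M : R) : cont01 f -> (forall s : R, 0 <= s <= 1 -> `|f s| <= M) ->
  `|\int[mu]_(s in `[0, 1]) f s| <= M.
Proof.
move=> cf hM; have If := cont01_integrable cf.
apply: le_trans (le_normr_Rintegral _ If) _ => //.
apply: le_trans (_ : \int[mu]_(s in `[0, 1]) M <= M); last first.
  by rewrite Rintegral_cst // mu01 mulr1.
apply: le_Rintegral => //.
  exact: (integrable_norm If).
  by apply: cont01_integrable; exact: cont01_cst.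
Qed.

(* For w = 1 and h a partial derivative these are the coefficients in Hadamard's
   lemma; the weight w is there because differentiating in y produces a factor s. *)
Definition segment_average (w : R -> R) n (x0 : 'rV[R]_n) (h : 'rV[R]_n -> R) y :=
  \int[mu]_(s in `[0, 1]) (w s * h (x0 + s *: (y - x0))).

Lemma segment_in_ball n (x0 y : 'rV[R]_n) (r s : R) : ball x0 r y -> 0 <= s <= 1 ->
  ball x0 r (x0 + s *: (y - x0)).
Proof.
move=> hy; apply: ball_segment => //; apply: ballxx.
by move: hy; rewrite -ball_normE /=; apply: le_lt_trans.
Qed.

Section SegmentAverage.
Variables (n : nat) (x0 : 'rV[R]_n) (r : R).

Lemma cont01_segment (w : R -> R) h (y : 'rV[R]_n) : continuous w -> smooth_on (ball x0 r) h ->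
  ball x0 r y -> cont01 (fun s => w s * h (x0 + s *: (y - x0))).
Proof.
move=> cw sh hy s s01.
apply: continuousM; first exact: cw.
have [d _] := derivable_line (smooth_on_diff sh (segment_in_ball hy s01)).
by apply: differentiable_continuous; apply/derivable1_diffP.
Qed.

Lemma weight_bounded (w : R -> R) : continuous w ->
  exists2 M : R, 0 <= M & forall s : R, 0 <= s <= 1 -> `|w s| <= M.
Proof.
move=> cw; have [|c _ hc] := @EVT_max R (fun s => `|w s|) 0 1 ler01.
  by apply: continuous_subspaceT => x; apply: continuous_comp; [exact: cw|exact: norm_continuous].
by exists `|w c| => // s s01; apply: hc; rewrite in_itv.
Qed.

(** Makes room for [ball_taylor], whose estimate holds only on a strictly smaller concentric
    ball. *)
Lemma ball_shrink (y : 'rV[R]_n) : ball x0 r y ->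
  exists2 r' : R, r' < r & \forall z \near y, ball x0 r' z.
Proof.
rewrite -ball_normE /= => hy; exists ((`|x0 - y| + r) / 2); first by lra.
have e0 : 0 < (r - `|x0 - y|) / 2 by lra.
near=> z.
have hz : `|y - z| < (r - `|x0 - y|) / 2.
  have : ball y ((r - `|x0 - y|) / 2) z by near: z; exact: nbhsx_ballx.
  by rewrite -ball_normE.
rewrite /= (_ : x0 - z = (x0 - y) + (y - z)); last by rewrite addrA subrK.
by apply: le_lt_trans (ler_normD _ _) _; lra.
Unshelve. all: by end_near. Qed.

(* The quadratic error bound gives the Frechet derivative directly, without a
   theorem on differentiation under the integral sign. *)
Lemma segment_average_taylor (w : R -> R) h (y : 'rV[R]_n) :
  continuous w -> smooth_on (ball x0 r) h -> ball x0 r y ->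
  exists C : R, \forall z \near y,
    `|segment_average w x0 h z - segment_average w x0 h y
      - \sum_i (z - y) 0 i * segment_average (fun s => s * w s) x0 (partial i h) y|
    <= C * `|z - y| ^+ 2.
Proof.
move=> cw sh hy; have [r' r'r hr'] := ball_shrink hy.
have [C C0 hC] := ball_taylor r'r sh.
have [M M0 hM] := weight_bounded cw.
have cw' : continuous (fun s : R => s * w s).
  by move=> s; apply: continuousM; [exact: cvg_id|exact: cw].
exists (M * C); near=> z.
have hz' : ball x0 r' z by near: z.
have hy' : ball x0 r' y by exact: nbhs_singleton hr'.
have hz : ball x0 r z.
  by move: hz'; rewrite -ball_normE /= => /lt_trans; exact.
pose p (s : R) := x0 + s *: (y - x0).
pose q (s : R) := x0 + s *: (z - x0).
have c1 := cont01_segment cw sh hz.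
have c2 := cont01_segment cw sh hy.
have c3 i := cont01_segment cw' (smooth_on_derive (delta_mx 0 i) sh) hy.
have c3' : cont01 (fun s => \sum_i (z - y) 0 i * (s * w s * partial i h (p s))).
  by apply: cont01_sum => i s s01; apply: continuousM; [exact: cst_continuous|exact: c3].
have c12 : cont01 (fun s => w s * h (q s) - w s * h (p s)).
  by move=> s s01; apply: continuousB; [exact: c1|exact: c2].
rewrite /segment_average -(int01_lin _ c3) -RintegralB //; [|exact: cont01_integrable..].
rewrite -RintegralB //; [|exact: cont01_integrable..].
apply: int01_bound => [s s01|s s01].
  by apply: continuousB; [exact: c12|exact: c3'].
have hps : ball x0 r' (p s) by exact: segment_in_ball.
have hqs : ball x0 r' (q s) by exact: segment_in_ball.
have qp : q s - p s = s *: (z - y).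
  by rewrite /q /p opprD addrACA subrr add0r -scalerBr opprB addrA subrK.
rewrite -/(q s) -/(p s).
have -> : w s * h (q s) - w s * h (p s) - \sum_i (z - y) 0 i * (s * w s * partial i h (p s))
  = w s * (h (q s) - h (p s) - \sum_i (q s - p s) 0 i * partial i h (p s)).
  rewrite qp mulrBr mulrBr; congr (_ - _); rewrite mulr_sumr.
  by apply: eq_bigr => i _; rewrite !mxE; ring.
rewrite normrM -mulrA; apply: ler_pM => //; first exact: hM.
apply: le_trans (hC _ _ hps hqs) _; rewrite ler_wpM2l // qp normrZ exprMn.
have /andP[s0 s1] := s01.
by rewrite ler_piMl ?exprn_ge0 // ger0_norm // exprn_ile1.
Unshelve. all: by end_near. Qed.

End SegmentAverage.

(** The induction runs over all weights and integrands, since a directional derivative of an average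
    is a combination of averages of partial derivatives with another weight. *)
Lemma segment_average_smooth n (x0 : 'rV[R]_n) r w h :
  continuous w -> smooth_on (ball x0 r) h ->
  smooth_on (ball x0 r) (segment_average w x0 h).
Proof.
move=> cw sh k; elim: k w h cw sh => [|k IH] w h cw sh.
  move=> y hy; have [C hC] := segment_average_taylor cw sh hy.
  by have [d _] := taylor_differentiable hC; exact: differentiable_continuous.
have cw' : continuous (fun s : R => s * w s).
  by move=> s; apply: continuousM; [exact: cvg_id|exact: cw].
split=> [y hy|v].
  by have [C hC] := segment_average_taylor cw sh hy; have [] := taylor_differentiable hC.
have ob : open (ball x0 r) by exact: ball_open.
apply: (@Ck_on_eq _ k _ _ (fun y => \sum_i v 0 i *
    segment_average (fun s => s * w s) x0 (partial i h) y)) => //.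
  by move=> y hy; have [C hC] := segment_average_taylor cw sh hy;
    have [_ ->] := taylor_differentiable hC.
apply: Ck_on_sum => // i; apply: (Ck_onM ob); first exact: Ck_on_cst.
by apply: IH => //; exact: smooth_on_derive.
Qed.

Lemma segment_average_ftc n (x0 : 'rV[R]_n) r h (y : 'rV[R]_n) :
  smooth_on (ball x0 r) h -> ball x0 r y ->
  h y = h x0 + \sum_i (y - x0) 0 i * segment_average (fun=> 1) x0 (partial i h) y.
Proof.
move=> sh hy.
have c1 : continuous (fun _ : R => 1 : R) by move=> s; exact: cst_continuous.
have ci i := cont01_segment c1 (smooth_on_derive (delta_mx 0 i) sh) hy.
have dl (s : R) : 0 <= s <= 1 -> is_derive s 1 (fun s : R => h (x0 + s *: (y - x0)))
    ('D_(y - x0) h (x0 + s *: (y - x0))).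
  by move=> s01; exact: derivable_line (smooth_on_diff sh (segment_in_ball hy s01)).
have ct (s : R) : 0 <= s <= 1 -> {for s, continuous (fun s : R => h (x0 + s *: (y - x0)))}.
  move=> s01; have [d _] := dl s s01.
  by apply: differentiable_continuous; apply/derivable1_diffP.
rewrite /segment_average -(int01_lin _ ci).
have E : {in `[0, 1]%classic, (fun s : R => \sum_i (y - x0) 0 i * (1 * partial i h (x0 + s *: (y - x0))))
    =1 (fun s => 'D_(y - x0) h (x0 + s *: (y - x0)))}.
  move=> s; rewrite inE /= in_itv /= => s01.
  rewrite derive_partial; last exact: smooth_on_diff sh (segment_in_ball hy s01).
  by apply: eq_bigr => i _; rewrite mul1r.
rewrite (eq_Rintegral mu E).
rewrite /Rintegral (@continuous_FTC2 _ _ (fun s : R => h (x0 + s *: (y - x0)))) //=.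
- by rewrite scale1r scale0r addr0 (addrC x0) subrK (addrC (h x0)) subrK.
- apply: continuous_in_subspaceT => s; rewrite inE /= in_itv /= => s01.
  have : cont01 (fun s => _) := cont01_segment c1 (smooth_on_derive (y - x0) sh) hy.
  rewrite (_ : (fun s : R => 1 * _) = fun s : R => 'D_(y - x0) h (x0 + s *: (y - x0))).
    exact.
  by apply/funext => s'; rewrite mul1r.
- split.
  + by move=> s; rewrite in_itv /= => /andP[s0 s1]; have [] := dl s _; rewrite ?ltW.
  + by apply: cvg_at_right_filter; apply: ct; rewrite lexx ler01.
  + by apply: cvg_at_left_filter; apply: ct; rewrite lexx ler01.
- move=> s; rewrite in_itv /= => /andP[s0 s1]; rewrite derive1E.
  have [|_ ->//] := dl s; by rewrite !ltW.
Qed.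

(** The domain shrinks to a ball so that the segments from [x0] stay inside. Smooth coefficients are
    needed because derivations will be applied to products containing them. *)
Lemma hadamard n (W : set 'rV[R]_n) (x0 : 'rV[R]_n) h :
  open W -> W x0 -> smooth_on W h ->
  exists (V : set 'rV[R]_n) (g : 'I_n -> 'rV[R]_n -> R),
    [/\ open V, V x0, V `<=` W, forall i, smooth_on V (g i) &
        (forall i, g i x0 = partial i h x0) /\
        forall y, V y -> h y = h x0 + \sum_i (y - x0) 0 i * g i y].
Proof.
move=> oW Wx0 sh.
have [r /= r0 rW] : exists2 r : R, 0 < r & ball x0 r `<=` W.
  have : nbhs x0 W by exact: open_nbhs_nbhs.
  by move=> /nbhs_ballP [r /= r0 rW]; exists r.
have sh' := smooth_onW rW sh.
have c1 : continuous (fun _ : R => 1 : R) by move=> s; exact: cst_continuous.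
exists (ball x0 r), (fun i => segment_average (fun=> 1) x0 (partial i h)); split => //.
- exact: ball_open.
- exact: ballxx.
- by move=> i; apply: segment_average_smooth => //; exact: smooth_on_derive.
split=> [i|y hy]; last exact: segment_average_ftc hy.
rewrite /segment_average subrr.
under eq_Rintegral do rewrite scaler0 addr0 mul1r.
by rewrite Rintegral_cst // mu01 mulr1.
Qed.
End Hadamard.

(** * Germs of smooth functions *)

Section SmoothFamilies.
Context {R : realType}.

Section Wrt.
Variable T : Type.
Implicit Types (C A : set (T -> R)) (p : T) (f g : T -> R).

Lemma dtop_nearW C p (P : T -> Prop) : (forall q, P q) -> \forall q \near (p : dtop C), P q.
Proof. by move=> h; exact: (@filterE _ (nbhs (p : dtop C))). Qed.

Lemma dtop_continuous C p f : C f -> {for p, continuous (f : dtop C -> R)}.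
Proof.
move=> Cf; apply/(@cvgrPdist_lt _ _ _ (nbhs (p : dtop C))) => e e0.
exists 1%N, (fun=> f), e; split => // q /(_ ord0).
by rewrite distrC.
Qed.

Lemma row_continuous C p k (a : 'I_k -> T -> R) :
  (forall i, {for p, continuous (a i : dtop C -> R)}) ->
  {for p, continuous ((fun q => \row_i a i q) : dtop C -> 'rV[R]_k)}.
Proof.
move=> ca; apply/(@cvgrPdist_lt _ _ _ (nbhs (p : dtop C))) => e e0.
have h i : \forall q \near (p : dtop C), `|a i p - a i q| < e.
  by have /(@cvgrPdist_lt _ _ _ (nbhs (p : dtop C))) := ca i; apply.
have F : Filter (nbhs (p : dtop C)) by typeclasses eauto.
have := filter_forall F h; apply: filterS => q hq; apply: norm_rV_lt => // i.
by rewrite !mxE.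
Qed.

Lemma near_row C p k (a : 'I_k -> T -> R) (W : set 'rV[R]_k) :
  (forall i, {for p, continuous (a i : dtop C -> R)}) ->
  open W -> W (\row_i a i p) -> \forall q \near (p : dtop C), W (\row_i a i q).
Proof.
move=> ca oW Wp; have := row_continuous ca; apply.
exact: open_nbhs_nbhs.
Qed.

Lemma smooth_wrt_continuous C p f :
  smooth_wrt C p f -> {for p, continuous (f : dtop C -> R)}.
Proof.
move=> [k [a [phi [W [Ca oW Wp sphi nf]]]]].
have ca i : {for p, continuous (a i : dtop C -> R)} by exact: dtop_continuous.
rewrite /prop_for /continuous_at (nbhs_singleton nf).
have nf' : \forall q \near (p : dtop C), phi (\row_i a i q) = f q.
  by apply: filterS nf => q ->.
apply: (cvg_trans (near_eq_cvg nf')).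
apply: (@cvg_comp _ _ _ ((fun q => \row_i a i q) : dtop C -> 'rV[R]_k) phi
  (nbhs (p : dtop C)) (nbhs (\row_i a i p))).
  exact: row_continuous.
exact: smooth_on_continuous sphi Wp.
Qed.

Lemma near_dtop_sub A C p (N : set T) :
  (forall a, A a -> {for p, continuous (a : dtop C -> R)}) ->
  nbhs (p : dtop A) N -> nbhs (p : dtop C) N.
Proof.
move=> cA [k [a [e [Aa e0 h]]]].
have h' i : \forall q \near (p : dtop C), `|a i p - a i q| < e.
  by have /(@cvgrPdist_lt _ _ _ (nbhs (p : dtop C))) := cA _ (Aa i); apply.
have F : Filter (nbhs (p : dtop C)) by typeclasses eauto.
have := filter_forall F h'; apply: filterS => q hq; apply: h => i; rewrite distrC; exact: hq.
Qed.

Lemma smooth_wrt_eq C p f g :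
  (\forall q \near (p : dtop C), f q = g q) -> smooth_wrt C p f -> smooth_wrt C p g.
Proof.
move=> fg [k [a [phi [W [Ca oW Wp sphi nf]]]]].
exists k, a, phi, W; split => //.
by apply: filterS2 fg nf => q <-.
Qed.

Lemma smooth_wrt_mem C p f : C f -> smooth_wrt C p f.
Proof.
move=> Cf; exists 1%N, (fun=> f), (fun x => x 0 0), setT; split => //.
- exact: openT.
- exact: smooth_on_coord.
- by apply: dtop_nearW => q; rewrite mxE.
Qed.

(** Each [b i] comes with its own finite list from [C]; concatenating the lists gives one that
    serves all of them, so that compositions can be formed in a single Euclidean space. *)
Lemma smooth_wrt_family C p k (b : 'I_k -> T -> R) :
  (forall i, smooth_wrt C p (b i)) ->
  exists m (a : 'I_m -> T -> R) (psi : 'I_k -> 'rV[R]_m -> R) (V : set 'rV[R]_m),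
    [/\ forall j, C (a j), open V, V (\row_j a j p), forall i, smooth_on V (psi i) &
        \forall q \near (p : dtop C), forall i, b i q = psi i (\row_j a j q)].
Proof.
elim: k b => [|k IH] b sb.
  exists 0%N, (fun _ _ => 0), (fun _ _ => 0), setT; split => //; first by case.
  - exact: openT.
  - by move=> i; exact: smooth_on_cst.
  - by apply: dtop_nearW => q [].
have [m1 [a1 [psi1 [V1 [C1 oV1 V1p s1 n1]]]]] := IH (fun i => b (lift ord0 i)) (fun i => sb _).
have [m2 [a2 [psi2 [V2 [C2 oV2 V2p s2 n2]]]]] := sb ord0.
pose a := fun i : 'I_(m1 + m2) => match fintype.split i with inl j => a1 j | inr j => a2 j end.
have al q : lsubmx (\row_i a i q) = \row_i a1 i q.
  by apply/rowP => i; rewrite !mxE /a (unsplitK (inl i)).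
have ar q : rsubmx (\row_i a i q) = \row_i a2 i q.
  by apply/rowP => i; rewrite !mxE /a (unsplitK (inr i)).
pose V : set 'rV[R]_(m1 + m2) := lsubmx @^-1` V1 `&` rsubmx @^-1` V2.
exists (m1 + m2)%N, a, (fun i x => if unlift ord0 i is Some j then psi1 j (lsubmx x)
  else psi2 (rsubmx x)), V; split.
- by move=> i; rewrite /a; case: fintype.split.
- apply: openI; apply: open_comp => // x _.
    exact: continuous_lsubmx.
  exact: continuous_rsubmx.
- by split; rewrite /= ?al ?ar.
- move=> i n; case: (unlift ord0 i) => [j|].
    by apply: (Ck_on_comp_linear (L := lsubmx) _ _ (s1 j n)) => [|x []//];
      exact: continuous_lsubmx.
  by apply: (Ck_on_comp_linear (L := rsubmx) _ _ (s2 n)) => [|x []//];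
    exact: continuous_rsubmx.
- apply: filterS2 n1 n2 => q h1 h2 i; rewrite al ar.
  by case: unliftP => [j ->|->].
Qed.

Lemma open_preimage_row m k (V : set 'rV[R]_m) (psi : 'I_k -> 'rV[R]_m -> R)
    (W : set 'rV[R]_k) :
  open V -> open W -> (forall i, smooth_on V (psi i)) ->
  open (V `&` [set x | W (\row_i psi i x)]).
Proof.
move=> oV oW sp; rewrite openE => x [Vx Wx]; rewrite /interior.
apply: filterI; first exact: open_nbhs_nbhs.
have d : differentiable (fun y => \row_i psi i y) x.
  by apply: differentiable_row => i; exact: smooth_on_diff (sp i) Vx.
by have := differentiable_continuous d; apply; exact: open_nbhs_nbhs.
Qed.

Lemma smooth_wrt_comp C p k (b : 'I_k -> T -> R) phi W :
  (forall i, smooth_wrt C p (b i)) -> open W -> W (\row_i b i p) ->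
  smooth_on W phi -> smooth_wrt C p (fun q => phi (\row_i b i q)).
Proof.
move=> sb oW Wp sphi.
have [m [a [psi [V [Ca oV Vp sV nb]]]]] := smooth_wrt_family sb.
have bp := nbhs_singleton nb.
have oV' := open_preimage_row oV oW sV.
exists m, a, (fun x => phi (\row_i psi i x)), (V `&` [set x | W (\row_i psi i x)]).
split => //.
- split => //=; rewrite (_ : \row_i _ = \row_i b i p) //.
  by apply/rowP => i; rewrite !mxE bp.
- apply: (smooth_on_comp oV' oW _ sphi) => [i|x []//].
  by apply: smooth_onW (sV i) => x [].
- apply: filterS nb => q hq; congr phi; apply/rowP => i; rewrite !mxE; exact: hq.
Qed.

Lemma smooth_wrt_trans A C p f :
  (forall a, A a -> smooth_wrt C p a) -> smooth_wrt A p f -> smooth_wrt C p f.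
Proof.
move=> sAC [k [a [phi [W [Aa oW Wp sphi nf]]]]].
have := smooth_wrt_comp (fun i => sAC _ (Aa i)) oW Wp sphi.
apply: smooth_wrt_eq.
(* The germ identity holds near [p] for the topology of [A], which is coarser because members of [A]
   are continuous for that of [C]. *)
have : nbhs (p : dtop C) [set q | f q = phi (\row_i a i q)].
  by apply: near_dtop_sub nf => b /sAC; exact: smooth_wrt_continuous.
by apply: filterS => q /= ->.
Qed.

(** [gen A] is the least differentially closed family above [A], and the functions everywhere smooth
    with respect to [A] form such a family. *)
Lemma gen_smooth_wrt A p f : gen A f -> smooth_wrt A p f.
Proof.
move=> /(_ [set f | forall p, smooth_wrt A p f]); apply.
  by move=> a Aa q; exact: smooth_wrt_mem.
by move=> h hh q; apply: smooth_wrt_trans (hh q) => a; exact.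
Qed.

End Wrt.

(** A condition on germs, since derivations act on germs. It lets equality of tangent vectors,
    smoothness of maps and differentiability of curves be tested on [A] alone. *)
Definition generating (M : diffspace R) (A : set (M -> R)) :=
  A `<=` Cinf M /\ forall (p : M) f, smooth_at p f -> smooth_wrt A p f.

Lemma generating_generated (T : Type) (A : set (T -> R)) :
  generating (M := generated A) A.
Proof.
split; first by move=> a Aa C sAC _; exact: sAC.
move=> p f; apply: smooth_wrt_trans => a; exact: gen_smooth_wrt.
Qed.

Lemma generating_Cinf (M : diffspace R) : generating (M := M) (Cinf M).
Proof. by split. Qed.

Lemma generating_subspace (M : diffspace R) (S : set M) (A : set (M -> R)) :
  generating A ->
  generating (M := Defs.subspace S) [set f | exists2 h, A h & f = (fun x => h (sval x))].
Proof.
move=> [sAC gA]; split.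
  by move=> _ [h /sAC Ch ->] C sAC' _; apply: sAC'; exists h.
move=> p f sf; have := (generating_generated _).2 p f sf.
apply: smooth_wrt_trans => _ [h Ch ->].
have [k [a [phi [W [Aa oW Wp sphi nf]]]]] := gA (sval p) h (smooth_wrt_mem _ Ch).
exists k, (fun i x => a i (sval x)), phi, W; split => //; first by move=> i; exists (a i).
have [k' [a' [e [Aa' e0 h']]]] := nf.
exists k', (fun i x => a' i (sval x)), e; split => //; first by move=> i; exists (a' i).
by move=> q hq; exact: h'.
Qed.

Lemma Cinf_smooth (M : diffspace R) (f : M -> R) : (forall p, smooth_at p f) <-> Cinf M f.
Proof. by split=> [|Cf p]; [exact: Cinf_closed|exact: smooth_wrt_mem]. Qed.

Section Germs.
Variable M : diffspace R.
Implicit Types (p : M) (f g : M -> R).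

Lemma smooth_at_eq p f g :
  (\forall q \near p, f q = g q) -> smooth_at p f -> smooth_at p g.
Proof. exact: smooth_wrt_eq. Qed.

Lemma smooth_at_continuous p f : smooth_at p f -> {for p, continuous f}.
Proof. exact: smooth_wrt_continuous. Qed.

Lemma smooth_at_comp p k (b : 'I_k -> M -> R) phi W :
  (forall i, smooth_at p (b i)) -> open W -> W (\row_i b i p) ->
  smooth_on W phi -> smooth_at p (fun q => phi (\row_i b i q)).
Proof. exact: smooth_wrt_comp. Qed.

Lemma smooth_at_cst p (c : R) : smooth_at p (fun=> c).
Proof.
apply: (@smooth_at_comp p 0 (fun _ _ => 0) (fun=> c) setT) => //.
- by case.
- exact: openT.
- exact: smooth_on_cst.
Qed.

Lemma smooth_at_sum p k (f : 'I_k -> M -> R) :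
  (forall i, smooth_at p (f i)) -> smooth_at p (fun q => \sum_i f i q).
Proof.
elim: k f => [|k IH] f sf.
  by under eq_fun do rewrite big_ord0; exact: smooth_at_cst.
under eq_fun do rewrite big_ord_recl.
have := smooth_at_lin 1 (sf ord0) (IH (fun i => f (lift ord0 i)) (fun i => sf _)).
by under eq_fun do rewrite mul1r.
Qed.

End Germs.

End SmoothFamilies.

(** * Tangent vectors, tangent maps and curves *)

Section TangentVectors.
Context {R : realType}.

Section OneSpace.
Variable M : diffspace R.
Implicit Types (V : tvec M) (f g : M -> R).

Lemma act_zero V : act V (fun=> 0) = 0.
Proof.
have s0 := smooth_at_cst (foot V) 0.
have := act_lin 1 s0 s0.
under [X in act V X]eq_fun do rewrite mulr0 addr0.
by move=> /(congr1 (fun x => x - act V (fun=> 0))); rewrite mul1r addrK subrr => <-.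
Qed.

Lemma act_cst V c : act V (fun=> c) = 0.
Proof.
have s1 := smooth_at_cst (foot V) 1; have s0 := smooth_at_cst (foot V) 0.
have h1 : act V (fun=> 1) = 0.
  have := act_leibniz s1 s1; under [X in act V X]eq_fun do rewrite mulr1.
  rewrite mulr1 mul1r => /(congr1 (fun x => x - act V (fun=> 1))).
  by rewrite addrK subrr => <-.
have := act_lin c s1 s0; under [X in act V X]eq_fun do rewrite mulr1 addr0.
by rewrite h1 act_zero mulr0 addr0.
Qed.

Lemma act_add V f g : smooth_at (foot V) f -> smooth_at (foot V) g ->
  act V (fun x => f x + g x) = act V f + act V g.
Proof.
move=> sf sg; have := act_lin 1 sf sg; rewrite mul1r => <-.
by congr (act V _); apply/funext => x; rewrite mul1r.
Qed.

Lemma act_sum V k (f : 'I_k -> M -> R) : (forall i, smooth_at (foot V) (f i)) ->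
  act V (fun x => \sum_i f i x) = \sum_i act V (f i).
Proof.
elim: k f => [|k IH] f sf.
  rewrite big_ord0 -[RHS](act_zero V); congr (act V); apply/funext => x.
  by rewrite big_ord0.
rewrite big_ord_recl -IH // -act_add //; last exact: smooth_at_sum.
by congr (act V); apply/funext => x; rewrite big_ord_recl.
Qed.

Lemma smooth_at_add (p : M) f g : smooth_at p f -> smooth_at p g ->
  smooth_at p (fun x => f x + g x).
Proof.
move=> sf sg; rewrite (_ : (fun x => _) = fun x => 1 * f x + g x).
  exact: smooth_at_lin.
by apply/funext => x; rewrite mul1r.
Qed.

Lemma smooth_at_sub (p : M) f g : smooth_at p f -> smooth_at p g ->
  smooth_at p (fun x => f x - g x).
Proof.
move=> sf sg; rewrite (_ : (fun x => _) = fun x => -1 * g x + f x).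
  exact: smooth_at_lin.
by apply/funext => x; rewrite mulN1r addrC.
Qed.

Lemma act_sub V f g : smooth_at (foot V) f -> smooth_at (foot V) g ->
  act V (fun x => f x - g x) = act V f - act V g.
Proof.
move=> sf sg; have := act_lin (-1) sg sf; rewrite mulN1r addrC => <-.
by congr (act V _); apply/funext => x; rewrite mulN1r addrC.
Qed.

(* A function that vanishes near p is annihilated: multiply it by the indicator
   of the set where it does not vanish. *)
Lemma act_near0 V f : (\forall x \near foot V, f x = 0) -> act V f = 0.
Proof.
move=> f0; have f00 := nbhs_singleton f0.
pose chi x : R := (f x != 0)%:R.
have chi0 : \forall x \near foot V, 0 = chi x.
  by apply: filterS f0 => x fx; rewrite /chi fx eqxx.
have sf : smooth_at (foot V) f.
  apply: smooth_at_eq (smooth_at_cst _ 0); by apply: filterS f0 => x ->.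
have sc : smooth_at (foot V) chi by apply: smooth_at_eq chi0 (smooth_at_cst _ 0).
have E : f = fun x => f x * chi x.
  apply/funext => x; rewrite /chi; have [->|_] := eqVneq (f x) 0; first by rewrite mul0r.
  by rewrite mulr1.
by rewrite E act_leibniz // f00 mul0r addr0 -(nbhs_singleton chi0) mulr0.
Qed.

Lemma act_near V f g : (\forall x \near foot V, f x = g x) -> act V f = act V g.
Proof.
move=> fg; have [sf|nf] := pselect (smooth_at (foot V) f).
  have sg := smooth_at_eq fg sf.
  apply/eqP; rewrite -subr_eq0 -act_sub //; apply/eqP/act_near0.
  by apply: filterS fg => x ->; rewrite subrr.
rewrite !act_out // => sg; apply: nf; apply: smooth_at_eq sg.
by apply: filterS fg => x ->.
Qed.

(** In Hadamard's expansion at the foot the constant is annihilated, and in each product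
    [(a i - a i p) * g i] the Leibniz rule leaves only the derivative of the factor that vanishes at
    [p]. *)
Lemma act_comp V k (a : 'I_k -> M -> R) phi (W : set 'rV[R]_k) :
  (forall i, smooth_at (foot V) (a i)) -> open W -> W (\row_i a i (foot V)) ->
  smooth_on W phi ->
  act V (fun q => phi (\row_i a i q)) =
  \sum_i act V (a i) * partial i phi (\row_i a i (foot V)).
Proof.
move=> sa oW Wp sphi; set p := foot V; set x0 := \row_i a i p.
have [V' [g [oV' V'x0 V'W sg [gp E]]]] := hadamard oW Wp sphi.
have sga i : smooth_at p (fun q => g i (\row_i a i q)) by exact: smooth_at_comp (sg i).
have sd i : smooth_at p (fun q => a i q - a i p).
  by apply: smooth_at_sub => //; exact: smooth_at_cst.
have sdg i : smooth_at p (fun q => (a i q - a i p) * g i (\row_i a i q)).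
  exact: smooth_at_mul.
have nV' : \forall q \near p, V' (\row_i a i q).
  by apply: near_row => // i; exact: smooth_at_continuous.
rewrite (@act_near V _ (fun q => phi x0 + \sum_i (a i q - a i p) * g i (\row_i a i q))).
  rewrite act_add; [|exact: smooth_at_cst|exact: smooth_at_sum].
  rewrite act_cst add0r act_sum //; apply: eq_bigr => i _.
  rewrite act_leibniz // subrr mul0r addr0 gp; congr (_ * _).
  by rewrite act_sub // ?act_cst ?subr0 //; exact: smooth_at_cst.
apply: filterS nV' => q /E ->; congr (_ + _); apply: eq_bigr => i _.
by rewrite !mxE.
Qed.

Lemma act_comp_near V k (a : 'I_k -> M -> R) phi (W : set 'rV[R]_k) f :
  (forall i, smooth_at (foot V) (a i)) -> open W -> W (\row_i a i (foot V)) ->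
  smooth_on W phi -> (\forall q \near foot V, f q = phi (\row_i a i q)) ->
  act V f = \sum_i act V (a i) * partial i phi (\row_i a i (foot V)).
Proof. by move=> sa oW Wp sphi nf; rewrite (act_near nf) (act_comp sa oW). Qed.

Lemma near_of_generating (A : set (M -> R)) (p : M) (N : set M) : generating A ->
  nbhs (p : dtop A) N -> nbhs p N.
Proof.
by move=> [AC _]; apply: near_dtop_sub => a /AC; exact: dtop_continuous.
Qed.

Lemma near_generating (A : set (M -> R)) (p : M) (N : set M) : generating A ->
  nbhs p N -> nbhs (p : dtop A) N.
Proof.
move=> [sAC gA]; apply: near_dtop_sub => f Cf.
by apply: smooth_wrt_continuous; apply: gA; exact: smooth_wrt_mem.
Qed.

Lemma generating_germ (A : set (M -> R)) (p : M) f : generating A -> smooth_at p f ->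
  exists k (a : 'I_k -> M -> R) phi (W : set 'rV[R]_k),
    [/\ forall i, A (a i), open W, W (\row_i a i p), smooth_on W phi &
        \forall q \near p, f q = phi (\row_i a i q)].
Proof.
move=> gA sf; have [k [a [phi [W [Aa oW Wp sphi nf]]]]] := gA.2 _ _ sf.
by exists k, a, phi, W; split => //; exact: near_of_generating nf.
Qed.

(** The chain rule writes both values on a germ as the same combination of values on generators; on
    functions that are not smooth at the foot both are 0 by [act_out]. *)
Lemma tvec_gen (A : set (M -> R)) V (W : tvec M) : generating A -> foot V = foot W ->
  (forall a, A a -> act V a = act W a) -> V = W.
Proof.
move=> gA VW h; apply: tvec_ext => // f.
have [sf|nf] := pselect (smooth_at (foot V) f); last by rewrite !act_out // -VW.
have [k [a [phi [U [Aa oU Up sphi nf]]]]] := generating_germ gA sf.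
have sa q i : smooth_at q (a i) by apply: smooth_wrt_mem; exact: gA.1.
rewrite (act_comp_near (sa _) oU Up sphi nf).
rewrite VW in Up nf.
rewrite (act_comp_near (sa _) oU Up sphi nf) VW.
by apply: eq_bigr => i _; rewrite h.
Qed.

End OneSpace.

Section Maps.
Implicit Types M N P : diffspace R.

Lemma smooth_map_at_gen M N (B : set (N -> R)) (F : M -> N) (p : M) :
  generating B -> (forall b, B b -> smooth_at p (b \o F)) -> smooth_map_at F p.
Proof.
move=> gB h f sf.
have [k [a [phi [W [Ba oW Wp sphi [k' [a' [e [Ba' e0 h']]]]]]]]] := gB.2 _ _ sf.
have sa i : smooth_at p (a i \o F) by exact: h.
apply: smooth_at_eq (smooth_at_comp sa oW Wp sphi).
(* [F] is not assumed continuous. The points near [p] land where the germ identity holds because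
   that region is cut out by finitely many [a' i], and [a' i \o F] is continuous. *)
have c i : \forall q \near p, `|a' i (F p) - a' i (F q)| < e.
  have := smooth_at_continuous (h _ (Ba' i)).
  by move=> /(@cvgrPdist_lt _ _ _ (nbhs p)); apply.
have := filter_forall (nbhs_filter p) c; apply: filterS => q hq.
by rewrite /= h' // => i; rewrite distrC; exact: hq.
Qed.

Lemma smooth_map_at_comp M N P (F : M -> N) (H : N -> P) (p : M) :
  smooth_map_at F p -> smooth_map_at H (F p) -> smooth_map_at (H \o F) p.
Proof. by move=> sF sH f sf; exact: (sF (f \o H) (sH f sf)). Qed.

Lemma smooth_map_at_continuous M N (F : M -> N) (p : M) :
  smooth_map_at F p -> {for p, continuous F}.
Proof.
move=> sF U [k [a [e [Ca e0 h]]]].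
have c i : \forall q \near p, `|a i (F p) - a i (F q)| < e.
  have := smooth_at_continuous (sF _ (smooth_wrt_mem (F p) (Ca i))).
  by move=> /(@cvgrPdist_lt _ _ _ (nbhs p)); apply.
have := filter_forall (nbhs_filter p) c; apply: filterS => q hq.
by apply: h => i; rewrite distrC; exact: hq.
Qed.

Lemma tmap_actE M N (F : M -> N) (V : tvec M) f :
  smooth_map_at F (foot V) -> smooth_at (F (foot V)) f ->
  act (tmap F V) f = act V (f \o F).
Proof. by move=> sF sf; rewrite /= /tmap_act asboolT. Qed.

Lemma tmap_near M N (F H : M -> N) (V : tvec M) :
  smooth_map_at F (foot V) -> (\forall q \near foot V, F q = H q) -> tmap F V = tmap H V.
Proof.
move=> sF FH; have e := nbhs_singleton FH.
have sH : smooth_map_at H (foot V).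
  move=> f; rewrite -e => sf; apply: smooth_at_eq (sF f sf).
  by apply: filterS FH => q /= ->.
apply: tvec_ext => //= f; rewrite /tmap_act.
have [sf|nf] := pselect (smooth_at (F (foot V)) f).
  rewrite !asboolT //; last by rewrite -e.
  by apply: act_near; apply: filterS FH => q /= ->.
by rewrite !asboolF // => -[] //; rewrite -e.
Qed.

Lemma tmap_comp M N P (F : M -> N) (H : N -> P) (V : tvec M) :
  smooth_map_at F (foot V) -> smooth_map_at H (F (foot V)) ->
  tmap H (tmap F V) = tmap (H \o F) V.
Proof.
move=> sF sH; apply: tvec_gen (@generating_Cinf _ P) _ _ => // f Cf.
have sf q : smooth_at q f by exact: smooth_wrt_mem.
transitivity (act (tmap F V) (f \o H)); first exact: tmap_actE.
transitivity (act V ((f \o H) \o F)); first by apply: tmap_actE => //; exact: sH.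
by rewrite tmap_actE //; exact: smooth_map_at_comp.
Qed.

Lemma tmap_tadd M N (F : M -> N) (V W : tvec M) : foot V = foot W ->
  smooth_map_at F (foot V) -> tmap F (tadd V W) = tadd (tmap F V) (tmap F W).
Proof.
move=> VW sF; apply: tvec_gen (@generating_Cinf _ N) _ _ => // f Cf.
have sf q : smooth_at q f by exact: smooth_wrt_mem.
have sFW : smooth_map_at F (foot W) by rewrite -VW.
rewrite tmap_actE // -[act (tadd V W) _]/(tadd_act V W _).
rewrite -[RHS]/(tadd_act (tmap F V) (tmap F W) f) /tadd_act.
rewrite (asboolT (esym VW)) asboolT; last by rewrite /= VW.
rewrite (tmap_actE sF (sf _)); congr (_ + _).
by rewrite (tmap_actE sFW (sf _)).
Qed.

Lemma tmap_tscale M N (F : M -> N) (s : R) (V : tvec M) :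
  tmap F (tscale s V) = tscale s (tmap F V).
Proof.
apply: tvec_ext => //= f; rewrite /tmap_act /=.
by case: asboolP => // _; rewrite mulr0.
Qed.

Lemma vector_field_act M (X : M -> tvec M) f :
  vector_field X -> Cinf M f -> Cinf M (fun p => act (X p) f).
Proof.
move=> [_ sX] Cf; apply/Cinf_smooth => p.
have := sX p (fun V => act V f); apply; apply: smooth_wrt_mem => C sC _.
by apply: sC; right; exists f.
Qed.

End Maps.

Section Curves.
Implicit Types M N P : diffspace R.

Lemma diff_curve_continuous M (c : R -> M) t : diff_curve c t -> {for t, continuous c}.
Proof.
move=> dc U [k [a [e [Ca e0 h]]]].
have cv i : \forall s \near t, `|a i (c t) - a i (c s)| < e.
  have /derivable1_diffP/differentiable_continuous := dc _ (smooth_wrt_mem (c t) (Ca i)).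
  by move=> /(@cvgrPdist_lt _ _ _ (nbhs t)); apply.
have := filter_forall (nbhs_filter t) cv; apply: filterS => s hs.
by apply: h => i; rewrite distrC; exact: hs.
Qed.

Lemma diff_curve_gen M (A : set (M -> R)) (c : R -> M) t : generating A ->
  (forall a, A a -> derivable (a \o c) t 1) -> diff_curve c t.
Proof.
move=> gA h f sf.
have [k [a [phi [W [Aa oW Wp sphi [k' [a' [e [Aa' e0 h']]]]]]]]] := gA.2 _ _ sf.
have cv i : \forall s \near t, `|a' i (c t) - a' i (c s)| < e.
  have /derivable1_diffP/differentiable_continuous := h _ (Aa' i).
  by move=> /(@cvgrPdist_lt _ _ _ (nbhs t)); apply.
have E : \forall s \near t, phi (\row_i a i (c s)) = (f \o c) s.
  have := filter_forall (nbhs_filter t) cv; apply: filterS => s hs.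
  by rewrite /= h' // => i; rewrite distrC; exact: hs.
apply/derivable1_diffP; apply: near_eq_differentiable E _.
apply: (@differentiable_comp _ _ _ _ (fun s => \row_i a i (c s)) phi).
  rewrite (_ : (fun s => _) =
      \sum_(i < k) (fun s => (a i \o c) s *: (delta_mx 0 i : 'rV[R]_k))).
    apply: differentiable_sum => i; apply: differentiableZl.
    by apply/derivable1_diffP; exact: h.
  apply/funext => s; rewrite fct_sumE [LHS]row_sum_delta.
  by apply: eq_bigr => i _; rewrite mxE.
exact: smooth_on_diff sphi Wp.
Qed.

Lemma velocity_actE M (c : R -> M) t f : diff_curve c t -> smooth_at (c t) f ->
  act (velocity c t) f = 'D_1 (f \o c) t.
Proof. by move=> dc sf; rewrite /= /velocity_act asboolT. Qed.

Lemma diff_curve_map M N (F : M -> N) (c : R -> M) t :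
  diff_curve c t -> smooth_map_at F (c t) -> diff_curve (F \o c) t.
Proof. by move=> dc sF f sf; exact: (dc (f \o F) (sF f sf)). Qed.

Lemma velocity_map M N (F : M -> N) (c : R -> M) t :
  diff_curve c t -> smooth_map_at F (c t) ->
  velocity (F \o c) t = tmap F (velocity c t).
Proof.
move=> dc sF; apply: tvec_gen (@generating_Cinf _ N) _ _ => // f Cf.
have sf q : smooth_at q f by exact: smooth_wrt_mem.
rewrite tmap_actE // velocity_actE //; last exact: diff_curve_map.
by rewrite velocity_actE //; exact: sF.
Qed.

End Curves.

End TangentVectors.

(** * Charts *)

Section Charts.
Context {R : realType}.

Lemma euclidean_nbhs n (p : 'rV[R]_n) (N : set 'rV[R]_n) :
  nbhs (p : euclidean n) N <-> nbhs p N.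
Proof.
pose A := [set f : 'rV[R]_n -> R | exists i, f = (fun x => x 0 i)].
have gA : generating (M := euclidean n) A by exact: generating_generated.
split.
  move=> /(near_generating gA) [k [a [e [Aa e0 h]]]].
  have ca i : \forall q \near p, `|a i p - a i q| < e.
    have [j ->] := Aa i.
    have := @coord_continuous R 1 n 0 j p.
    by move=> /(@cvgrPdist_lt _ _ _ (nbhs p)); apply.
  have := filter_forall (nbhs_filter p) ca; apply: filterS => q hq.
  by apply: h => i; rewrite distrC; exact: hq.
move=> /nbhs_ballP [e /= e0 he]; apply: (near_of_generating gA).
exists n, (fun i (x : 'rV[R]_n) => x 0 i), e; split => //; first by move=> i; exists i.
move=> q hq; apply: he; rewrite -ball_normE /=; apply: norm_rV_lt => // i.
by rewrite !mxE distrC; exact: hq.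
Qed.

Lemma euclidean_smooth n (p : 'rV[R]_n) (f : 'rV[R]_n -> R) :
  smooth_at (p : euclidean n) f ->
  exists W : set 'rV[R]_n, [/\ open W, W p & smooth_on W f].
Proof.
pose A := [set f : 'rV[R]_n -> R | exists i, f = (fun x => x 0 i)].
have gA : generating (M := euclidean n) A by exact: generating_generated.
move=> sf; have [k [a [phi [W [Aa oW Wp sphi nf]]]]] := generating_germ gA sf.
have sa i : smooth_on setT (a i) by have [j ->] := Aa i; exact: smooth_on_coord.
have oW' := open_preimage_row openT oW sa.
have [V [oV Vp VE]] : exists V : set 'rV[R]_n,
    [/\ open V, V p & forall q, V q -> f q = phi (\row_i a i q)].
  move: nf => /euclidean_nbhs; rewrite nbhsE => -[V [oV Vp] VE].
  by exists V; split.
exists (V `&` (setT `&` [set x | W (\row_i a i x)])); split.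
- exact: openI.
- by [].
apply: (smooth_on_eq (f := fun q => phi (\row_i a i q))) => [|q [/VE ->]//|].
  exact: openI.
apply: smooth_on_comp oW _ sphi _ => [|i|x [_ []]//].
  exact: openI.
by apply: smooth_onW (sa i).
Qed.

Lemma euclidean_open n (W : set 'rV[R]_n) : open (W : set (euclidean n)) <-> open W.
Proof. by rewrite !openE; split=> h p /h /euclidean_nbhs. Qed.

(** The Euclidean side uses the norm topology and [smooth_on], so that the calculus on row vectors
    applies without passing through [euclidean n]. *)
Variant chart_at n (M : diffspace R) (p : M) : Prop := ChartAt
  (U : set M) (x : 'I_n -> M -> R) (H : 'rV[R]_n -> M) (V : set 'rV[R]_n) of
  open U & U p & open V &
  (forall q, U q -> [/\ V (\row_i x i q), H (\row_i x i q) = q &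
    forall i, smooth_at q (x i)]) &
  (forall y, V y -> [/\ U (H y), \row_i x i (H y) = y &
    forall f, smooth_at (H y) f -> exists W, [/\ open W, W y & smooth_on W (f \o H)]]).

Lemma manifold_chart n (M : diffspace R) (p : M) : manifold n M -> chart_at n p.
Proof.
move=> [_ _ /(_ p) [U [V [F [oU Up oV [hF [H [hH HF FH]]]]]]]].
have rowF q : \row_i F q 0 i = F q by apply/rowP => i; rewrite mxE.
apply: (@ChartAt n M p U (fun i q => F q 0 i) H V) => //.
- exact/euclidean_open.
- move=> q Uq; rewrite rowF; have [Vq sF] := hF q Uq; split => //; first exact: HF.
  move=> i; apply: (sF (fun y : euclidean n => y 0 i)).
  apply: smooth_wrt_mem => C sAC _; apply: sAC; by exists i.
- move=> y Vy; rewrite rowF; have [UH sH] := hH y Vy; split => //; first exact: FH.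
  by move=> f /sH /euclidean_smooth.
Qed.

(* The functions b_i play the role of local coordinates; they may be redundant,
   but unlike the components of a chart they are globally smooth, so that no bump
   functions are needed. *)
Definition factors (M : diffspace R) m (b : 'I_m -> M -> R) (p : M) (f : M -> R) :=
  exists phi W, [/\ open W, W (\row_i b i p), smooth_on W phi &
    \forall q \near p, f q = phi (\row_i b i q)].

Lemma factors_eq (M : diffspace R) m (b : 'I_m -> M -> R) (p : M) f g :
  (\forall q \near p, f q = g q) -> factors b p f -> factors b p g.
Proof.
move=> fg [phi [W [oW Wp sphi nf]]]; exists phi, W; split => //.
by apply: filterS2 fg nf => q <-.
Qed.

Lemma factors_comp (M : diffspace R) m (b : 'I_m -> M -> R) (p : M) k
    (e : 'I_k -> M -> R) (phi : 'rV[R]_k -> R) (W : set 'rV[R]_k) :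
  (forall i, factors b p (e i)) -> open W -> W (\row_i e i p) -> smooth_on W phi ->
  factors b p (fun q => phi (\row_i e i q)).
Proof.
move=> /choice [psi /choice [V hV]] oW Wp sphi.
pose V0 := [set x | forall i, V i x].
have oV0 : open V0.
  rewrite openE => x hx; rewrite /interior.
  have h i : \forall y \near x, V i y.
    by have [oVi _ _ _] := hV i; apply: open_nbhs_nbhs.
  exact: filter_forall (nbhs_filter x) h.
have spsi i : smooth_on V0 (psi i).
  by have [_ _ s _] := hV i; apply: smooth_onW s => x; exact.
have ne : \forall q \near p, forall i, e i q = psi i (\row_j b j q).
  have h i : \forall q \near p, e i q = psi i (\row_j b j q) by have [] := hV i.
  exact: filter_forall (nbhs_filter p) h.
have rowE q : (forall i, e i q = psi i (\row_j b j q)) ->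
    \row_i psi i (\row_j b j q) = \row_i e i q.
  by move=> h; apply/rowP => i; rewrite !mxE h.
have oV1 := open_preimage_row oV0 oW spsi.
exists (fun x => phi (\row_i psi i x)), (V0 `&` [set x | W (\row_i psi i x)]); split => //.
- split=> /=; first by move=> i; have [] := hV i.
  by rewrite rowE //; exact: nbhs_singleton ne.
- apply: (smooth_on_comp oV1 oW _ sphi) => [i|x []//].
  by apply: smooth_onW (spsi i) => x [].
- by apply: filterS ne => q hq; rewrite rowE.
Qed.

(** The part of being a manifold on which uniqueness of integral curves rests. Unlike charts, it is
    inherited by [V alpha] without a dimension count. *)
Definition locally_finite_at (M : diffspace R) (p : M) :=
  exists m (b : 'I_m -> M -> R) (N : set M),
  [/\ nbhs p N, forall i, Cinf M (b i),
      forall q q', N q -> N q' -> \row_i b i q = \row_i b i q' -> q = q' &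
      forall q f, N q -> smooth_at q f -> factors b q f].

(** The chart components at [p] are smooth functions [psi] of finitely many global functions [b].
    Hence [b] determines the chart coordinates, so it separates points near [p], and a germ [f]
    factors as [f \o H \o psi] applied to [b]. *)
Lemma manifold_locally_finite n (M : diffspace R) (p : M) :
  manifold n M -> locally_finite_at p.
Proof.
move=> /(manifold_chart p) [U x H V oU Up oV hU hV].
have sx i : smooth_at p (x i) by have [_ _] := hU p Up; exact.
have [m [b [psi [B [Cb oB Bp spsi nx]]]]] := smooth_wrt_family sx.
have nB : \forall q \near p, B (\row_i b i q).
  by apply: near_row => // i; exact: dtop_continuous.
(* The relation between [x] and [b] is required near [q] and not only at [q], because factoring is a
   statement about the germ at [q]. *)
exists m, b, [set q | [/\ U q, B (\row_i b i q) &
  \forall q' \near q, forall i, x i q' = psi i (\row_j b j q')]]; split => //.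
- have nU : \forall q \near p, U q by exact: open_nbhs_nbhs.
  have nnx := nbhs_interior nx.
  near=> q; split; near: q => //.
- move=> q q' [Uq _ /nbhs_singleton nq] [Uq' _ /nbhs_singleton nq'] e.
  have [_ <- _] := hU q Uq; have [_ <- _] := hU q' Uq'.
  by congr H; apply/rowP => i; rewrite !mxE nq nq' e.
move=> q f [Uq Bq nq] sf; have [Vq Hq _] := hU q Uq.
have [_ _ /(_ f)] := hV _ Vq; rewrite Hq => /(_ sf) [W [oW Wq sfH]].
have sB i : smooth_on B (psi i) := spsi i.
have oB' := open_preimage_row oB oW sB.
have xq : \row_i psi i (\row_j b j q) = \row_i x i q.
  by apply/rowP => i; rewrite !mxE (nbhs_singleton nq).
exists (fun z => f (H (\row_i psi i z))), (B `&` [set z | W (\row_i psi i z)]); split => //.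
- by split=> //=; rewrite xq.
- apply: (smooth_on_comp oB' oW _ sfH) => [i|z []//].
  by apply: smooth_onW (sB i) => z [].
have nU : \forall q' \near q, U q' by exact: open_nbhs_nbhs.
apply: filterS2 nU nq => q' Uq' h'; congr f.
have [_ Hq' _] := hU q' Uq'; rewrite -[LHS]Hq'; congr H.
by apply/rowP => i; rewrite !mxE; exact: h'.
Unshelve. all: by end_near. Qed.

Definition point_separated (M : diffspace R) :=
  forall p q : M, (forall f, Cinf M f -> f p = f q) -> p = q.

(** Points at which all smooth functions agree have the same neighbourhoods in the initial
    topology. *)
Lemma hausdorff_separated (M : diffspace R) : hausdorff_space M -> point_separated M.
Proof.
move=> hM p q h; apply: hM => A B [k [a [e [Ca e0 hA]]]] nB.
exists q; split; last exact: nbhs_singleton nB.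
by apply: hA => i; rewrite (h _ (Ca i)) subrr normr0.
Qed.

End Charts.

(** * Integral curves *)

Section IntegralCurves.
Context {R : realType}.

Lemma is_derive_mull (c t : R) : is_derive t (1 : R) (fun s : R => c * s) c.
Proof.
have := @is_deriveZ R R R (fun s : R => s) c t 1 1 (is_derive_id t 1).
by rewrite /GRing.scale /= mulr1.
Qed.

Lemma linear_ode (u : R -> R) (c : R) :
  (forall t : R, is_derive t (1 : R) u (c * u t)) -> forall t, u t = expR (c * t) * u 0.
Proof.
move=> du t; pose w (s : R) := expR (- c * s) * u s.
have dw (s : R) : is_derive s (1 : R) w 0.
  have d1 := is_derive_mull (- c) s.
  have d2 := @is_derive1_comp R expR (fun s : R => - c * s) s _ _ (is_derive_expR _) d1.
  have d3 := @is_deriveM R _ _ _ s 1 _ _ d2 (du s).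
  apply: is_derive_eq; rewrite /GRing.scale /=; ring.
have := is_derive_0_is_cst t 0 dw; rewrite /w mulr0 expR0 mul1r => <-.
by rewrite mulrA -expRD mulNr subrr expR0 mul1r.
Qed.

Lemma right_derivative (u w : R -> R) (x y : R) :
  is_derive (0 : R) 1 u x -> is_derive (0 : R) 1 w y ->
  (\forall t \near (0 : R), 0 <= t -> u t = w t) -> x = y.
Proof.
move=> [du <-] [dw <-] uw.
have u0 : u 0 = w 0 by exact: (nbhs_singleton uw).
have e : \forall h \near 0^'+, h^-1 *: ((w \o shift (0 : R)) (h *: 1) - w 0) =
   h^-1 *: ((u \o shift (0 : R)) (h *: 1) - u 0).
  near=> h; rewrite u0 /= addr0 scaler1; congr (_ *: (_ - _)).
  have hu : 0 <= h -> u h = w h by near: h; apply: cvg_within.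
  by apply/esym/hu; near: h; exact: nbhs_right_ge.
have /cvg_dnbhs_at_right cu := du; have /cvg_dnbhs_at_right cw := dw.
apply: (cvg_unique _ cu); first exact: norm_hausdorff.
exact: cvg_trans (near_eq_cvg e) cw.
Unshelve. all: by end_near. Qed.

(** At a maximum point [c] of [|u|] the mean value theorem, applied to each coordinate from [T] to
    [c], gives [|u c| <= d * L * |u c|], and [d * L < 1] forces the maximum to be 0. This takes the
    place of Gronwall's inequality. *)
Lemma lipschitz_zero m (u : R -> 'rV[R]_m) (T d L : R) :
  0 <= d -> 0 <= L -> d * L < 1 -> u T = 0 ->
  (forall t i, T <= t <= T + d -> derivable (fun s => u s 0 i) t 1) ->
  (forall t i, T <= t <= T + d -> `|'D_1 (fun s => u s 0 i) t| <= L * `|u t|) ->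
  forall t, T <= t <= T + d -> u t = 0.
Proof.
move=> d0 L0 dL uT du Du.
have cu i t : T <= t <= T + d -> {for t, continuous (fun s => u s 0 i)}.
  by move=> ht; apply: differentiable_continuous; apply/derivable1_diffP; exact: du.
have cnu : {within `[T, T + d], continuous (fun s => `|u s|)}.
  apply: continuous_in_subspaceT => t; rewrite inE /= in_itv /= => ht.
  have c : {for t, continuous u}.
    apply/cvgrPdist_lt => e e0.
    have h i : \forall s \near t, `|u t 0 i - u s 0 i| < e.
      by have /cvgrPdist_lt := cu i t ht; apply.
    have := filter_forall (nbhs_filter t) h; apply: filterS => s hs.
    by apply: norm_rV_lt => // i; rewrite !mxE; exact: hs.
  exact: (@continuous_comp _ _ _ u (fun y => `|y|) t c (@norm_continuous _ _ (u t))).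
have Td : T <= T + d by rewrite lerDl.
have [c cT hc] := EVT_max Td cnu; rewrite in_itv /= in cT.
have S0 : `|u c| <= (d * L) * `|u c|.
  apply: norm_rV_le => [|i]; first by rewrite !mulr_ge0.
  have /andP[Tc cTd] := cT.
  have [||x hx E] := @MVT_segment R (fun s => u s 0 i) (fun s => 'D_1 (fun s => u s 0 i) s) T c Tc.
  - move=> x; rewrite in_itv /= => /andP[Tx xc]; apply: derivableP; apply: du.
    by rewrite ltW //= (le_trans (ltW xc)).
  - apply: continuous_in_subspaceT => x; rewrite inE /= in_itv /= => /andP[Tx xc].
    by apply: cu; rewrite Tx (le_trans xc).
  rewrite in_itv /= in hx; have /andP[Tx xc] := hx.
  have hx' : T <= x <= T + d by rewrite Tx (le_trans xc).
  have uT0 : u T 0 i = 0 by rewrite uT mxE.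
  rewrite uT0 subr0 in E; rewrite E normrM mulrC -mulrA.
  apply: ler_pM => //.
    by rewrite ger0_norm ?subr_ge0 // lerBlDl.
  apply: le_trans (Du x i hx') _; rewrite ler_wpM2l //; apply: hc.
  by rewrite in_itv.
have uc : `|u c| = 0.
  apply/eqP; rewrite eq_le normr_ge0 andbT.
  have : (1 - d * L) * `|u c| <= 0 by rewrite mulrBl mul1r subr_le0.
  by rewrite pmulr_rle0 // subr_gt0.
move=> t ht; apply/eqP; rewrite -normr_eq0 eq_le normr_ge0 andbT -uc.
by apply: hc; rewrite in_itv.
Qed.

(** In the functions [b] both curves solve [y' = phi y] with [phi] Lipschitz on a small ball, so
    their difference satisfies [lipschitz_zero]; injectivity of [b] on [N] brings the equality back
    to [M]. *)
Lemma integral_curve_local (M : diffspace R) (X : M -> tvec M) (J : set R)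
    (c1 c2 : R -> M) (T : R) :
  vector_field X -> locally_finite_at (c1 T) -> open J -> J T ->
  integral_curve X J c1 -> integral_curve X J c2 -> c1 T = c2 T ->
  exists2 d, 0 < d & forall t, T <= t <= T + d -> c1 t = c2 t.
Proof.
move=> [fX sX] [m [b [N [nN Cb sepb lf]]]] oJ JT i1 i2 e12.
set p := c1 T in nN e12.
have sb q i : smooth_at q (b i) by exact: smooth_wrt_mem.
have sXb i : smooth_at p (fun q => act (X q) (b i)).
  have := sX p (fun V => act V (b i)); apply; apply: smooth_wrt_mem => C sAC _.
  by apply: sAC; right; exists (b i).
have Np : N p by exact: nbhs_singleton nN.
have /choice [phi /choice [W hphi]] := fun i => lf p _ Np (sXb i).
pose y1 t := \row_i b i (c1 t); pose y2 t := \row_i b i (c2 t).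
have [r r0 rW] : exists2 r : R, 0 < r & forall i, ball (\row_i b i p) r `<=` W i.
  have : \forall y \near \row_i b i p, forall i, W i y.
    have h i : \forall y \near \row_i b i p, W i y.
      by have [oW Wp _ _] := hphi i; exact: open_nbhs_nbhs.
    exact: filter_forall (nbhs_filter _) h.
  move=> /nbhs_ballP [r /= r0 h]; exists r => // i y /h; exact.
have r2 : r / 2 < r by rewrite ltr_pdivrMr // ltr_pMr // ltr1n.
have /choice [L hL] : forall i, exists L : R, 0 <= L /\
    forall y y' : 'rV[R]_m, ball (\row_i b i p) (r / 2) y -> ball (\row_i b i p) (r / 2) y' ->
    `|phi i y' - phi i y| <= L * `|y' - y|.
  move=> i; have [_ _ sphi _] := hphi i.
  by have [L L0 hL] := ball_lipschitz r2 (smooth_onW (@rW i) sphi); exists L.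
pose K := \sum_i L i.
have K0 : 0 <= K by apply: sumr_ge0 => i _; have [] := hL i.
have good (c : R -> M) : c T = p -> integral_curve X J c -> \forall t \near T,
    [/\ J t, N (c t), ball (\row_i b i p) (r / 2) (\row_i b i (c t)) &
        forall i, act (X (c t)) (b i) = phi i (\row_i b i (c t))].
  move=> cT ic; have dc := (ic T JT).1.
  have cc := diff_curve_continuous dc.
  have h1 : \forall q \near p, [/\ N q, ball (\row_i b i p) (r / 2) (\row_i b i q) &
      forall i, act (X q) (b i) = phi i (\row_i b i q)].
    have nb : \forall q \near p, ball (\row_i b i p) (r / 2) (\row_i b i q).
      apply: (near_row (C := Cinf M)) => [i||].
      - exact: dtop_continuous.
      - exact: ball_open.
      - by apply: ballxx; rewrite divr_gt0.
    have nphi : \forall q \near p, forall i, act (X q) (b i) = phi i (\row_i b i q).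
      have h i : \forall q \near p, act (X q) (b i) = phi i (\row_i b i q).
        by have [_ _ _] := hphi i.
      exact: filter_forall (nbhs_filter p) h.
    by apply: filterS3 nN nb nphi => q; split.
  have h2 : \forall t \near T, J t by exact: open_nbhs_nbhs.
  have h3 : \forall t \near T, [/\ N (c t), ball (\row_i b i p) (r / 2) (\row_i b i (c t)) &
      forall i, act (X (c t)) (b i) = phi i (\row_i b i (c t))].
    by have cp : c t @[t --> T] --> p by [rewrite -cT]; exact: (cp _ h1).
  by apply: filterS2 h2 h3 => t Jt [].
have [g1 g2] := (good c1 erefl i1, good c2 (esym e12) i2).
have [d d0 hd] : exists2 d : R, 0 < d & forall t, T <= t <= T + d ->
    [/\ J t, N (c1 t), ball (\row_i b i p) (r / 2) (y1 t) &
        forall i, act (X (c1 t)) (b i) = phi i (y1 t)] /\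
    [/\ J t, N (c2 t), ball (\row_i b i p) (r / 2) (y2 t) &
        forall i, act (X (c2 t)) (b i) = phi i (y2 t)].
  have /nbhs_ballP [d /= d0 h] : \forall t \near T, 
    [/\ J t, N (c1 t), ball (\row_i b i p) (r / 2) (y1 t) &
        forall i, act (X (c1 t)) (b i) = phi i (y1 t)] /\
    [/\ J t, N (c2 t), ball (\row_i b i p) (r / 2) (y2 t) &
        forall i, act (X (c2 t)) (b i) = phi i (y2 t)].
    by apply: filterS2 g1 g2 => t; split.
  exists (d / 2); first by rewrite divr_gt0.
  move=> t /andP[Tt tT]; apply: h; rewrite -ball_normE /= distrC ger0_norm ?subr_ge0 //.
  by rewrite ltrBlDl (le_lt_trans tT) // ltrD2l ltr_pdivrMr // ltr_pMr // ltr1n.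
have dv (c : R -> M) t i : integral_curve X J c -> J t ->
    is_derive t 1 (b i \o c) (act (X (c t)) (b i)).
  move=> ic Jt; have [dc v] := ic t Jt; split; first exact: dc.
  by rewrite -velocity_actE // v.
(* Up to time [T + d] both curves stay in the good region, and the second bound yields [d' * K < 1];
   [K + 1] since [K] may be 0, and halving gives strict inequalities. *)
pose d' := Num.min d (K + 1)^-1 / 2.
have K1 : 0 < K + 1 by rewrite ltr_wpDl.
have m0 : 0 < Num.min d (K + 1)^-1 by rewrite lt_min d0 invr_gt0.
have d'0 : 0 < d' by rewrite divr_gt0.
have d'm : d' < Num.min d (K + 1)^-1 by rewrite ltr_pdivrMr // ltr_pMr // ltr1n.
have d'd : d' <= d by apply: ltW; move: d'm; rewrite lt_min => /andP[].
have d'K : d' * K < 1.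
  have : d' < (K + 1)^-1 by move: d'm; rewrite lt_min => /andP[].
  rewrite -[_^-1]mul1r ltr_pdivlMr // => /(le_lt_trans _); apply.
  by rewrite ler_wpM2l // ?lerDl // ltW.
exists d' => // t ht.
have sub s : T <= s <= T + d' -> T <= s <= T + d.
  by move=> /andP[-> h] /=; apply: le_trans h _; rewrite lerD2l.
have E (s : R) i : (y1 s - y2 s) 0 i = (b i \o c1) s - (b i \o c2) s by rewrite !mxE.
have D s i : T <= s <= T + d' -> is_derive s 1 (fun s => (y1 s - y2 s) 0 i)
    (phi i (y1 s) - phi i (y2 s)).
  move=> /sub /hd [[Js _ _ h1] [_ _ _ h2]].
  rewrite (_ : (fun s => _) = (b i \o c1) - (b i \o c2)); last by apply/funext => s'; rewrite E.
  have D1 := dv c1 s i i1 Js; have D2 := dv c2 s i i2 Js.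
  by rewrite -h1 -h2; exact: is_deriveB.
have [[_ N1 _ _] [_ N2 _ _]] := hd t (sub t ht).
apply: sepb => //; apply/eqP; rewrite -subr_eq0; apply/eqP.
apply: (@lipschitz_zero m (fun s => y1 s - y2 s) T d' K) => //.
- exact: ltW.
- by rewrite /y1 /y2 -e12 subrr.
- by move=> s i /(D s i) [].
move=> s i hs; have [_ ->] := D s i hs.
have [[_ _ B1 _] [_ _ B2 _]] := hd s (sub s hs).
have [L0 hLi] := hL i.
apply: le_trans (hLi _ _ B2 B1) _; rewrite ler_wpM2r //.
by rewrite /K (bigD1 i) //= lerDl; apply: sumr_ge0 => j _; have [] := hL j.
Qed.

Lemma integral_curve_mono (M : diffspace R) (X : M -> tvec M) (J K : set R) c :
  K `<=` J -> integral_curve X J c -> integral_curve X K c.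
Proof. by move=> KJ ic t /KJ; exact: ic. Qed.

Lemma around01W (d e : R) : d <= e -> around01 d `<=` around01 e.
Proof. by move=> de t /andP[h1 h2]; apply/andP; split; lra. Qed.

(** Let [T] be the supremum of the times up to which the curves agree. They agree at [T] by
    continuity, tested on functions that separate points, and if [T < 1] the local lemma would push
    agreement beyond [T]. *)
Lemma integral_curve_unique (M : diffspace R) (X : M -> tvec M) (d : R)
    (c1 c2 : R -> M) :
  vector_field X -> (forall p : M, locally_finite_at p) -> point_separated M -> 0 < d ->
  integral_curve X (around01 d) c1 -> integral_curve X (around01 d) c2 ->
  c1 0 = c2 0 -> forall t, 0 <= t <= 1 -> c1 t = c2 t.
Proof.
move=> vX lf sep d0 i1 i2 e0.
have oJ : open (around01 d).
  rewrite (_ : around01 d = `](- d), (1 + d)[%classic); first exact: interval_open.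
  by apply/seteqP; split => t; rewrite /= in_itv.
have J01 t : 0 <= t <= 1 -> around01 d t.
  by move=> /andP[t0 t1]; apply/andP; split; lra.
pose E := [set t : R | 0 <= t <= 1 /\ forall s, 0 <= s <= t -> c1 s = c2 s].
have E0 : E 0.
  split; first by rewrite lexx ler01.
  by move=> s /andP[s0 s1]; rewrite (_ : s = 0) //; apply/eqP; rewrite eq_le s0 s1.
have hE : has_sup E.
  by split; [exists 0|exists 1 => t [/andP[]]].
set T := sup E.
have T0 : 0 <= T by exact: sup_upper_bound.
have T1 : T <= 1 by apply: ge_sup; [exists 0|move=> t [/andP[]]].
have lt s : 0 <= s -> s < T -> c1 s = c2 s.
  rewrite -subr_gt0 => s0 h; have [t [_ ht]] := sup_adherent h hE.
  by rewrite -/T opprB addrC subrK => st; apply: ht; rewrite s0 ltW.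
have eT : c1 T = c2 T.
  have [->//|Tn0] := eqVneq T 0.
  have T0' : 0 < T by rewrite lt_neqAle eq_sym Tn0.
  apply: sep => f Cf; apply/eqP; rewrite -subr_eq0; apply: contraT => ne.
  have JT : around01 d T by apply: J01; rewrite T0.
  pose g t := f (c1 t) - f (c2 t).
  have cg : {for T, continuous g}.
    have dg c : integral_curve X (around01 d) c -> {for T, continuous (f \o c)}.
      move=> ic; apply: differentiable_continuous; apply/derivable1_diffP.
      by apply: (ic T JT).1; exact: smooth_wrt_mem.
    by apply: continuousB; [exact: dg|exact: dg].
  have : \forall t \near T, g t != 0 by exact: (cvgr_neq0 _ cg).
  move=> /nbhs_ballP [r /= r0 hr].
  (* A time in [[0, T[] at distance less than [r] from [T]. *)
  pose s := Num.max 0 (T - r / 2).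
  have : g s != 0.
    apply: hr; rewrite -ball_normE /= /s.
    by have [h|h] := leP 0 (T - r / 2); rewrite ger0_norm ?subr_ge0 //; lra.
  rewrite /g lt ?subrr ?eqxx //.
    by rewrite /s le_max lexx.
  by rewrite /s gt_max T0' /= ltrBlDr ltrDl divr_gt0.
have T_1 : T = 1.
  apply/eqP; rewrite eq_le T1 leNgt; apply/negP => Tlt.
  have JT : around01 d T by apply: J01; rewrite T0.
  have [e e_gt0 he] := integral_curve_local vX (lf _) oJ JT i1 i2 eT.
  pose t := Num.min (T + e) 1.
  have tT : T < t by rewrite lt_min ltrDl e_gt0.
  have : E t.
    split; first by rewrite (le_trans T0 (ltW tT)) /t ge_min lexx orbT.
    move=> s /andP[s0 st]; have [sT|Ts] := ltP s T; first exact: lt.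
    by apply: he; rewrite Ts (le_trans st) // /t ge_min lexx.
  by move=> /(sup_upper_bound hE); rewrite leNgt tT.
move=> t /andP[t0 t1]; move: t1; rewrite le_eqVlt => /predU1P[->|tl].
  by rewrite -T_1.
by apply: lt => //; rewrite T_1.
Qed.

End IntegralCurves.

(** * Level sets and submersions *)

Section LevelSets.
Context {R : realType}.

(** The derivative is frozen at [x0] while both [p] and [q] vary, which is what a contraction
    estimate requires; it follows from continuity of the partial derivatives. *)
Lemma strict_differentiable n m (W : set 'rV[R]_n) (A : 'I_m -> 'rV[R]_n -> R) x0 (e : R) :
  open W -> W x0 -> (forall l, smooth_on W (A l)) -> 0 < e ->
  exists rho : R, [/\ 0 < rho, ball x0 rho `<=` W &
    forall l (p q : 'rV[R]_n), ball x0 rho p -> ball x0 rho q ->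
    `|A l q - A l p - \sum_i (q - p) 0 i * partial i (A l) x0| <= e * `|q - p|].
Proof.
(* There are [n] coordinates, each contributing at most [e']; [n.+1] keeps the denominator nonzero
   when [n = 0]. *)
move=> oW Wx0 sA e0; pose e' := e / n.+1%:R.
have e'0 : 0 < e' by rewrite divr_gt0.
have h : \forall y \near x0, forall l i, `|partial i (A l) x0 - partial i (A l) y| < e'.
  have h l : \forall y \near x0, forall i, `|partial i (A l) x0 - partial i (A l) y| < e'.
    have h i : \forall y \near x0, `|partial i (A l) x0 - partial i (A l) y| < e'.
      have c : {for x0, continuous (partial i (A l))}.
        by apply: smooth_on_continuous Wx0; exact: smooth_on_derive.
      by have /cvgrPdist_lt := c; apply.
    exact: filter_forall (nbhs_filter x0) h.
  exact: filter_forall (nbhs_filter x0) h.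
have hW : \forall y \near x0, W y by exact: open_nbhs_nbhs.
have [rho /= rho0 hrho] : exists2 rho : R, 0 < rho & forall y, ball x0 rho y ->
    (forall l i, `|partial i (A l) x0 - partial i (A l) y| < e') /\ W y.
  have : \forall y \near x0,
    (forall l i, `|partial i (A l) x0 - partial i (A l) y| < e') /\ W y.
    by apply: filterS2 h hW => y; split.
  by move=> /nbhs_ballP [rho rho0 hrho]; exists rho.
exists rho; split => // [y /hrho []//|l p q hp hq].
have dA x : ball x0 rho x -> differentiable (A l) x.
  by move=> /hrho [_ Wx]; exact: smooth_on_diff (sA l) Wx.
have [t [ht ->]] := mvt_ball dA hp hq.
have hx := ball_segment hp hq ht.
rewrite derive_partial; last exact: dA.
rewrite -sumrB; apply: le_trans (ler_norm_sum _ _ _) _.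
apply: (@le_trans _ _ (\sum_(i < n) e' * `|q - p|)).
  apply: ler_sum => i _; rewrite -mulrBr normrM mulrC.
  apply: ler_pM => //; last exact: norm_coord_le.
  by rewrite distrC; apply: ltW; have [hh _] := hrho _ hx; exact: hh.
rewrite sumr_const card_ord -mulr_natl mulrA ler_wpM2r //.
rewrite /e' mulrCA ler_piMr //; first exact: ltW.
by rewrite ler_pdivrMr // mul1r ler_nat.
Qed.

(* For small t a point x0 + t v + sum_j y_j B_j with |y| <= e t lies on the level
   set: y is a fixed point of the contraction Phi, found by minimizing |Phi y - y|
   over the compact ball |y| <= e t.  Then psi vanishes there, and e is arbitrary. *)
Lemma level_set_tangent n m (W : set 'rV[R]_n) (A : 'I_m -> 'rV[R]_n -> R)
    (psi : 'rV[R]_n -> R) (x0 v : 'rV[R]_n) (B : 'I_m -> 'rV[R]_n) :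
  open W -> W x0 -> (forall l, smooth_on W (A l)) -> smooth_on W psi ->
  (forall l, \sum_i v 0 i * partial i (A l) x0 = 0) ->
  (forall j l, \sum_i B j 0 i * partial i (A l) x0 = (j == l)%:R) ->
  (forall x, W x -> (forall l, A l x = A l x0) -> psi x = 0) ->
  \sum_i v 0 i * partial i psi x0 = 0.
Proof.
move=> oW Wx0 sA spsi vA BA hpsi.
pose beta := \sum_j `|B j|; pose P : R := \sum_i `|partial i psi x0|.
have beta0 : 0 <= beta by apply: sumr_ge0.
have P0 : 0 <= P by apply: sumr_ge0.
pose yB (y : 'rV[R]_m) : 'rV[R]_n := \sum_j y 0 j *: B j.
have yB_le y : `|yB y| <= beta * `|y|.
  rewrite mulr_suml; apply: le_trans (ler_norm_sum _ _ _) _.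
  apply: ler_sum => j _; rewrite normrZ mulrC ler_wpM2l //; exact: norm_coord_le.
have D_le (w : 'rV[R]_n) : `|\sum_i w 0 i * partial i psi x0| <= P * `|w|.
  rewrite mulr_suml; apply: le_trans (ler_norm_sum _ _ _) _.
  by apply: ler_sum => i _; rewrite normrM mulrC ler_wpM2l //; exact: norm_coord_le.
have D_yB y l : \sum_i (yB y) 0 i * partial i (A l) x0 = y 0 l.
  transitivity (\sum_j y 0 j * \sum_i B j 0 i * partial i (A l) x0).
    under [RHS]eq_bigr do rewrite mulr_sumr.
    rewrite exchange_big /=; apply: eq_bigr => i _; rewrite summxE mulr_suml.
    by apply: eq_bigr => j _; rewrite !mxE mulrA.
  rewrite (bigD1 l) //= BA eqxx mulr1 big1 ?addr0 // => j jl.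
  by rewrite BA (negbTE jl) mulr0.
suff key (e : R) : 0 < e -> e <= 1 ->
    `|\sum_i v 0 i * partial i psi x0| <= e * (1 + P * beta).
  apply/eqP; rewrite -normr_eq0 eq_le normr_ge0 andbT; apply/ler_addgt0Pr => e e0.
  rewrite add0r; pose c := 1 + P * beta.
  have c0 : 0 < c by rewrite /c ltr_pwDl // mulr_ge0.
  pose e1 := Num.min 1 (e / c).
  have e10 : 0 < e1 by rewrite lt_min ltr01 divr_gt0.
  apply: le_trans (key e1 e10 _) _; first by rewrite ge_min lexx.
  by rewrite -ler_pdivlMr // ge_min lexx orbT.
move=> e0 e1.
(* [N] is positive and bounds [|v| + beta]. With [e' = e / (2 N)], a displacement of length at most
   [t * N] costs an error of at most [e * t / 2]. *)
pose N := `|v| + beta + 1.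
have N0 : 0 < N by rewrite ltr_wpDl // addr_ge0.
pose e' := e / (2 * N).
have e'0 : 0 < e' by rewrite divr_gt0 // mulr_gt0.
have [r1 [r10 r1W hA]] := strict_differentiable oW Wx0 sA e'0.
have [r2 [r20 r2W hP]] := strict_differentiable (A := fun _ : 'I_1 => psi) oW Wx0 (fun=> spsi) e'0.
have eN : e' * N = e / 2 by rewrite /e'; field; rewrite gt_eqF.
pose rho := Num.min r1 r2; have rho0 : 0 < rho by rewrite lt_min r10.
(* Then every [X y] with [y] in [K] stays within [t * N = rho / 2] of [x0]. *)
pose t := rho / (2 * N); have t0 : 0 < t by rewrite divr_gt0 // mulr_gt0.
have vN : `|v| <= N by rewrite /N -addrA lerDl addr_ge0.
have bN : beta <= N by rewrite /N addrAC lerDr addr_ge0.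
pose X (y : 'rV[R]_m) : 'rV[R]_n := x0 + (t *: v + yB y).
pose K := [set y : 'rV[R]_m | `|y| <= e * t].
have XK y : K y -> `|X y - x0| <= t * N.
  move=> Ky; rewrite /X addrC addKr; apply: le_trans (ler_normD _ _) _.
  rewrite normrZ (gtr0_norm t0).
  apply: (@le_trans _ _ (t * `|v| + beta * t)); last first.
    by rewrite (mulrC beta) -mulrDr ler_wpM2l ?(ltW t0) // /N lerDl.
  rewrite lerD2l; apply: le_trans (yB_le y) _; rewrite ler_wpM2l //.
  by apply: le_trans Ky _; rewrite ler_piMl // ltW.
have Xrho y : K y -> `|X y - x0| < rho.
  move=> /XK /le_lt_trans; apply.
  by rewrite /t invfM mulrA mulfVK ?gt_eqF // ltr_pdivrMr // ltr_pMr // ltr1n.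
have XB1 y : K y -> ball x0 r1 (X y).
  by move=> /Xrho; rewrite -ball_normE /= distrC lt_min => /andP[].
have XB2 y : K y -> ball x0 r2 (X y).
  by move=> /Xrho; rewrite -ball_normE /= distrC lt_min => /andP[].
(* The derivative of [A] along the [B j] is the identity at [x0], so the subtraction cancels the
   first order in [y] and leaves a map with Lipschitz constant 1/2, as in a simplified Newton
   iteration. *)
pose Phi (y : 'rV[R]_m) : 'rV[R]_m := \row_l (y 0 l - (A l (X y) - A l x0)).
have Phi_lip y y' : K y -> K y' -> `|Phi y' - Phi y| <= 2^-1 * `|y' - y|.
  move=> Ky Ky'; apply: norm_rV_le => [|l]; first by rewrite mulr_ge0 ?invr_ge0.
  have dX : X y' - X y = yB (y' - y).
    rewrite /X opprD addrACA subrr add0r opprD addrACA subrr add0r /yB -sumrB.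
    by apply: eq_bigr => j _; rewrite !mxE scalerBl.
  have := hA l _ _ (XB1 y Ky) (XB1 y' Ky'); rewrite dX D_yB.
  rewrite !mxE => h.
  rewrite (_ : _ - _ = - (A l (X y') - A l (X y) - (y' 0 l - y 0 l))); last by ring.
  rewrite normrN; apply: le_trans h _.
  apply: (@le_trans _ _ (e' * (beta * `|y' - y|))).
    by rewrite ler_wpM2l ?yB_le // ltW.
  rewrite mulrA ler_wpM2r //.
  apply: (@le_trans _ _ (e' * N)); first by rewrite ler_wpM2l // ltW.
  by rewrite eN -[leRHS]mul1r ler_wpM2r // invr_ge0.
have K0 : K 0 by rewrite /K /= normr0 mulr_ge0 // ltW.
have X0 : X 0 - x0 = t *: v.
  rewrite /X addrC addKr /yB big1 ?addr0 // => j _; by rewrite mxE scale0r.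
have bx0 (r : R) : 0 < r -> ball x0 r x0 by move=> ?; exact: ballxx.
(* As [v] is annihilated by the differential of [A], moving by [t *: v] changes [A] only by the
   error term. This half of the radius [e * t] and the contraction constant 1/2 make [Phi] preserve
   [K]. *)
have Phi0 : `|Phi 0| <= e * t / 2.
  apply: norm_rV_le => [|l]; first by rewrite divr_ge0 // mulr_ge0 // ltW.
  have := hA l _ _ (bx0 _ r10) (XB1 0 K0); rewrite X0 !mxE.
  under eq_bigr do rewrite mxE -mulrA.
  rewrite -mulr_sumr vA mulr0 subr0 add0r normrN normrZ (gtr0_norm t0) => /le_trans; apply.
  apply: (@le_trans _ _ (e' * (t * N))).
    by rewrite ler_wpM2l ?ler_wpM2l // ltW.
  by rewrite (mulrC t) mulrA eN mulrAC.
have PhiK y : K y -> K (Phi y).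
  move=> Ky; rewrite /K /= (_ : Phi y = (Phi y - Phi 0) + Phi 0); last by rewrite subrK.
  apply: le_trans (ler_normD _ _) _.
  have := Phi_lip 0 y K0 Ky; rewrite subr0.
  have : `|y| <= e * t by [].
  move: Phi0; lra.
have cK : compact K.
  apply: bounded_closed_compact.
    exists (e * t); split; first exact: num_real.
    by move=> M hM y Ky; exact: le_trans (ltW hM).
  rewrite (_ : K = (fun y => `|y|) @^-1` [set z | z <= e * t]) //.
  by apply: preimage_closed; [move=> y _; exact: norm_continuous|exact: closed_le].
have cPhi : {within K, continuous (fun y => `|Phi y - y|)}.
  apply: continuous_in_subspaceT => y; rewrite inE => Ky.
  pose xi i (z : 'rV[R]_m) := X z 0 i.
  have rowX z : \row_i xi i z = X z by apply/rowP => i; rewrite mxE.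
  have sxi i : smooth_on setT (xi i).
    rewrite (_ : xi i = fun z => (x0 + t *: v) 0 i + \sum_j z 0 j * B j 0 i).
      apply: smooth_onD openT _ _; first exact: smooth_on_cst.
      apply: smooth_on_sum openT _ => j.
      by apply: smooth_onM openT _ _; [exact: smooth_on_coord|exact: smooth_on_cst].
    apply/funext => z; rewrite /xi /X addrA mxE summxE; congr (_ + _).
    by apply: eq_bigr => j _; rewrite !mxE.
  have ob : open (ball x0 r1) by exact: ball_open.
  have oV := open_preimage_row openT ob sxi.
  have Vy : (setT `&` [set z | ball x0 r1 (\row_i xi i z)]) y.
    by split=> //=; rewrite rowX; exact: XB1.
  have c : {for y, continuous (fun z => Phi z - z)}.
    apply/(@cvgrPdist_lt _ _ _ (nbhs y)) => eps eps0.
    have h l : \forall z \near y, `|A l (X y) - A l (X z)| < eps.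
      have : {for y, continuous (fun z => A l (\row_i xi i z))}.
        apply: smooth_on_continuous Vy.
        apply: smooth_on_comp ob _ (smooth_onW r1W (sA l)) _ => // [i|z []//].
        exact: smooth_onW (sxi i).
      move=> /(@cvgrPdist_lt _ _ _ (nbhs y)) /(_ _ eps0); apply: filterS => z.
      by rewrite !rowX.
    have := filter_forall (nbhs_filter y) h; apply: filterS => z hz.
    apply: norm_rV_lt => // l; rewrite !mxE.
    rewrite (_ : _ - _ = - (A l (X y) - A l (X z))); last by ring.
    by rewrite normrN; exact: hz.
  exact: (@continuous_comp _ _ _ (fun z => Phi z - z) (fun z => `|z|) y c (@norm_continuous _ _ _)).
have [y Ky hy] := EVT_min_rV (ex_intro _ 0 K0) cK cPhi; rewrite inE in Ky.
have Phiy : Phi y = y.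
  (* Were [y] not fixed, [Phi y] would be a point of [K] moved at most half as far, against
     minimality. *)
  have h1 := Phi_lip _ _ Ky (PhiK y Ky).
  have := hy (Phi y); rewrite inE => /(_ (PhiK y Ky)) h2.
  have : `|Phi y - y| <= 0 by lra.
  by rewrite normr_le0 subr_eq0 => /eqP.
have AX l : A l (X y) = A l x0.
  have := congr1 (fun z : 'rV[R]_m => z 0 l) Phiy; rewrite mxE => h.
  by apply/eqP; rewrite -subr_eq0; apply/eqP; lra.
have psiX : psi (X y) = 0 by apply: hpsi => //; apply: r1W; exact: XB1.
have psi0 : psi x0 = 0 by exact: hpsi.
(* [psi] vanishes at both ends of the displacement [t *: v + yB y], so its derivative there is
   bounded by the error alone; the part along [yB y] is at most [P * beta * e * t], and division by
   [t] gives the bound. *)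
have := hP ord0 _ _ (bx0 _ r20) (XB2 y Ky).
rewrite psiX psi0 subrr sub0r normrN => h.
have DX : \sum_i (X y - x0) 0 i * partial i psi x0 =
    t * (\sum_i v 0 i * partial i psi x0) + \sum_i (yB y) 0 i * partial i psi x0.
  have XE : X y - x0 = t *: v + yB y by rewrite /X addrC addKr.
  rewrite mulr_sumr -big_split /=; apply: eq_bigr => i _.
  by rewrite XE 2!mxE; ring.
rewrite DX in h.
have h2 : `|\sum_i yB y 0 i * partial i psi x0| <= P * (beta * (e * t)).
  apply: le_trans (D_le _) _; rewrite ler_wpM2l //.
  by apply: le_trans (yB_le y) _; rewrite ler_wpM2l.
have h3 : e' * `|X y - x0| <= e * t.
  apply: (@le_trans _ _ (e' * (t * N))); first by rewrite ler_wpM2l ?XK // ltW.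
  rewrite (mulrC t) mulrA eN mulrAC.
  by have := mulr_gt0 e0 t0; lra.
set Dv := \sum_i v 0 i * _ in h *; set Dy := \sum_i _ in h h2.
have h4 : `|t * Dv| <= e * t + P * (beta * (e * t)).
  rewrite (_ : t * Dv = (t * Dv + Dy) - Dy); last by rewrite addrK.
  apply: le_trans (ler_normB _ _) _; apply: lerD => //; exact: le_trans h3.
rewrite normrM (gtr0_norm t0) in h4.
rewrite -(ler_pM2l t0); apply: le_trans h4 _.
by rewrite le_eqVlt; apply/orP; left; apply/eqP; ring.
Qed.

End LevelSets.

(** * Vectors vertical for a submersion *)

Section Submersions.
Context {R : realType}.
Variables (M N : diffspace R) (F : M -> N).

Lemma act_chart n (p : M) (U : set M) (x : 'I_n -> M -> R) (H : 'rV[R]_n -> M)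
    (V : tvec M) f (W : set 'rV[R]_n) :
  open U -> U (foot V) -> (forall q, U q -> H (\row_i x i q) = q) ->
  (forall i, smooth_at (foot V) (x i)) ->
  open W -> W (\row_i x i (foot V)) -> smooth_on W (f \o H) ->
  act V f = \sum_i act V (x i) * partial i (f \o H) (\row_i x i (foot V)).
Proof.
move=> oU UV HU sx oW Wp sfH; apply: (act_comp_near sx oW Wp sfH).
have nU : \forall q \near foot V, U q by exact: open_nbhs_nbhs.
by apply: filterS nU => q Uq /=; rewrite HU.
Qed.

(** In charts this is [level_set_tangent] for the components [A l] of [F]. The directions [B j],
    dual to their differentials, exist because coordinate vectors of [N] lift through a
    submersion. *)
Lemma vertical_act0 nM nN (V : tvec M) f :
  manifold nM M -> manifold nN N -> submersion F ->
  tmap F V = tzero (F (foot V)) -> smooth_at (foot V) f ->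
  (\forall q \near foot V, F q = F (foot V) -> f q = 0) -> act V f = 0.
Proof.
move=> mM mN [sF lift] Vv sf f0; set p := foot V.
have [U x H C oU Up oC hU hC] := manifold_chart p mM.
have [U' z H' C' oU' Up' oC' hU' hC'] := manifold_chart (F p) mN.
have [Cx Hx sx] := hU p Up; have [Cz Hz sz] := hU' _ Up'.
set x0 := \row_i x i p in Cx Hx; set z0 := \row_i z i (F p) in Cz Hz.
have [_ _ smH] := hC _ Cx; rewrite Hx in smH.
have [_ _ smH'] := hC' _ Cz; rewrite Hz in smH'.
have szF l : smooth_at p (z l \o F) by apply: sF.
have /choice [WA hWA] := fun l => smH _ (szF l).
have [Wf [oWf Wfx sWf]] := smH _ sf.
have HU q : U q -> H (\row_i x i q) = q by move=> /hU [].
(* [chart_at] speaks of functions composed with [H], not of continuity of [H]; but basic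
   neighbourhoods in [M] are cut out by finitely many smooth functions. *)
have cH : {for x0, continuous H}.
  move=> D; rewrite Hx => -[k [a [e [Ca e0 h]]]].
  have c i : \forall y \near x0, `|a i p - a i (H y)| < e.
    have [Wa [oWa Wax sWa]] := smH _ (smooth_wrt_mem p (Ca i)).
    have /(@cvgrPdist_lt _ _ _ (nbhs x0)) := smooth_on_continuous sWa Wax.
    by rewrite /= Hx; apply.
  have := filter_forall (nbhs_filter x0) c; apply: filterS => y hy.
  by apply: h => i; rewrite distrC; exact: hy.
have nW : \forall y \near x0, [/\ C y, forall l, WA l y, Wf y, U' (F (H y)) &
    (F (H y) = F p -> f (H y) = 0)].
  have h1 : \forall y \near x0, C y by exact: open_nbhs_nbhs.
  have h2 : \forall y \near x0, forall l, WA l y.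
    have h l : \forall y \near x0, WA l y.
      by have [oWl Wlx _] := hWA l; exact: open_nbhs_nbhs.
    exact: filter_forall (nbhs_filter x0) h.
  have h3 : \forall y \near x0, Wf y by exact: open_nbhs_nbhs.
  have h45 : \forall q \near p, U' (F q) /\ (F q = F p -> f q = 0).
    have c : \forall q \near p, U' (F q).
      by apply: (smooth_map_at_continuous (sF p)); exact: open_nbhs_nbhs.
    by apply: filterS2 c f0 => q; split.
  have h45' : \forall y \near x0, U' (F (H y)) /\ (F (H y) = F p -> f (H y) = 0).
    by have cH' : H y @[y --> x0] --> p by [rewrite -Hx]; exact: (cH' _ h45).
  by apply: filterS3 (filterI h1 h2) h3 h45' => y [? ?] ? [? ?]; split.
have [W [oW Wx0 hW]] : exists W : set 'rV[R]_nM, [/\ open W, W x0 & forall y, W y ->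
    [/\ C y, forall l, WA l y, Wf y, U' (F (H y)) & (F (H y) = F p -> f (H y) = 0)]].
  by exists (interior [set y | [/\ C y, forall l, WA l y, Wf y, U' (F (H y)) &
    (F (H y) = F p -> f (H y) = 0)]]); split; [exact: open_interior|exact: nW|exact: interior_subset].
have sA l : smooth_on W (z l \o F \o H).
  by have [_ _] := hWA l; apply: smooth_onW => y /hW [].
have sW : smooth_on W (f \o H) by apply: smooth_onW sWf => y /hW [].
have chartE (V' : tvec M) g : foot V' = p -> smooth_on W (g \o H) ->
    act V' g = \sum_i act V' (x i) * partial i (g \o H) x0.
  by move=> V'p sg; rewrite (@act_chart _ p U x H V' g W) ?V'p.
(* The coordinate vectors of [N] at [F p], as velocities of the coordinate lines of the chart. *)
pose E j := velocity (fun t : R => H' (z0 + t *: delta_mx 0 j)) 0.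
have E0 j : z0 + (0 : R) *: delta_mx 0 j = z0 by rewrite scale0r addr0.
have Ef j : foot (E j) = F p by rewrite /= E0.
have dE j : diff_curve (fun t : R => H' (z0 + t *: delta_mx 0 j)) 0.
  move=> g; rewrite E0 Hz => /smH' [Wg [oWg Wgz sg]].
  have [d _] := derivable_line (f := g \o H') (p := z0) (v := delta_mx 0 j) (t := 0)
     ltac:(by rewrite E0; exact: smooth_on_diff sg Wgz).
  exact: d.
have Ez j l : act (E j) (z l) = (j == l)%:R.
  rewrite velocity_actE //; last by rewrite E0 Hz.
  have e : \forall t \near (0 : R), (z l \o (fun t : R => H' (z0 + t *: delta_mx 0 j))) t
      = z0 0 l + t * (delta_mx 0 j : 'rV[R]_nN) 0 l.
    have cl : {for (0 : R), continuous (fun t : R => z0 + t *: (delta_mx 0 j : 'rV[R]_nN))}.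
      apply: continuousD; first exact: cst_continuous.
      exact: scalel_continuous.
    have : \forall t \near (0 : R), C' (z0 + t *: delta_mx 0 j).
      by apply: cl; rewrite E0; exact: open_nbhs_nbhs.
    apply: filterS => t /hC' [_ e _].
    by have := congr1 (fun y : 'rV[R]_nN => y 0 l) e; rewrite !mxE.
  rewrite (near_eq_derive _ e) //.
  have -> : (fun t : R => z0 0 l + t * (delta_mx 0 j : 'rV[R]_nN) 0 l) =
    cst (z0 0 l) + ((delta_mx 0 j : 'rV[R]_nN) 0 l *: (id : R -> R)).
    by apply/funext => t; rewrite mulrC.
  rewrite deriveD; [|exact: derivable_cst|exact: derivableZ].
  rewrite derive_cst add0r deriveZ // derive_id mxE eqxx eq_sym.
  exact: mulr1.
have /choice [B hB] : forall j, exists V' : tvec M, foot V' = p /\ tmap F V' = E j.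
  by move=> j; have [V' ? ?] := lift p (E j) (Ef j); exists V'.
have sFp (V' : tvec M) : foot V' = p -> smooth_map_at F (foot V') by move=> ->.
have actF (V' : tvec M) l : foot V' = p -> act V' (z l \o F) = act (tmap F V') (z l).
  by move=> V'p; rewrite tmap_actE ?V'p //; exact: sFp.
rewrite (chartE V f erefl sW).
pose vv := \row_i act V (x i); pose BB j := \row_i act (B j) (x i).
transitivity (\sum_i vv 0 i * partial i (f \o H) x0).
  by apply: eq_bigr => i _; rewrite mxE.
apply: (level_set_tangent (B := BB) oW Wx0 sA sW).
- move=> l; under eq_bigr do rewrite mxE.
  by rewrite -(chartE V (z l \o F)) ?actF // Vv.
- move=> j l; under eq_bigr do rewrite mxE.
  by have [Bp FB] := hB j; rewrite -(chartE (B j) (z l \o F)) // actF // FB Ez.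
move=> y Wy hy; have [_ _ _ Uy fy] := hW y Wy; apply: fy.
have [_ <- _] := hU' _ Uy; rewrite -Hz; congr H'; apply/rowP => l.
by have := hy l; rewrite /= Hx !mxE.
Qed.

End Submersions.

(** * Coordinates on V alpha *)

Section ValphaGenerators.
Context {R : realType} (G : lie_groupoid R).

Definition Valpha_gens : set (Valpha G -> R) := [set e |
  (exists2 f, Cinf (arr G) f & e = (fun v => f (tilde_tau v))) \/
  (exists2 f, Cinf (arr G) f & e = (fun v => act (vtan v) f))].

Definition AG_gens : set (AG G -> R) := [set e |
  exists2 h, Valpha_gens h & e = (fun a => h (AG_incl a))].

Lemma generating_Valpha : generating Valpha_gens.
Proof.
rewrite (_ : Valpha_gens = [set f | exists2 h,
   [set F : tvec (arr G) -> R |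
    (exists2 f, Cinf (arr G) f & F = (fun V => f (foot V))) \/
    (exists2 f, Cinf (arr G) f & F = (fun V => act V f))] h &
    f = (fun x : Valpha G => h (sval x))]).
  by apply: generating_subspace; exact: generating_generated.
apply/seteqP; split => e.
  by case=> -[f Cf ->]; [exists (fun V => f (foot V)); [left; exists f|] |
    exists (fun V => act V f); [right; exists f|]].
by case=> h [[f Cf ->] ->|[f Cf ->] ->]; [left; exists f | right; exists f].
Qed.

Lemma generating_AG : generating AG_gens.
Proof. by apply: generating_subspace; exact: generating_Valpha. Qed.

Lemma Cinf_tilde_tau f : Cinf (arr G) f -> Cinf (Valpha G) (fun v => f (tilde_tau v)).
Proof. by move=> Cf; apply: generating_Valpha.1; left; exists f. Qed.

Lemma Cinf_act f : Cinf (arr G) f -> Cinf (Valpha G) (fun v => act (vtan v) f).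
Proof. by move=> Cf; apply: generating_Valpha.1; right; exists f. Qed.

Lemma tilde_tau_smooth : smooth_map (@tilde_tau R G).
Proof.
move=> v; apply: (smooth_map_at_gen (@generating_Cinf _ (arr G))) => f Cf.
by apply: smooth_wrt_mem; exact: Cinf_tilde_tau.
Qed.

Lemma src_smooth : smooth_map (@src R G).
Proof. by have [] := src_submersion G. Qed.

Lemma tgt_smooth : smooth_map (@tgt R G).
Proof. by have [] := tgt_submersion G. Qed.

Lemma arr_point_separated : point_separated (arr G).
Proof. by have [n [h _ _]] := arr_manifold G; exact: hausdorff_separated. Qed.

Lemma obj_point_separated : point_separated (obj G).
Proof. by have [n [h _ _]] := obj_manifold G; exact: hausdorff_separated. Qed.

Lemma vtan_inj : injective (@vtan R G).
Proof. by move=> [V hV] [W hW] /= e; apply: eq_exist. Qed.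

Lemma AG_incl_inj : injective (@AG_incl R G).
Proof. by move=> [V hV] [W hW] /= e; apply: eq_exist. Qed.

Lemma Valpha_point_separated : point_separated (Valpha G).
Proof.
move=> v w h; apply: vtan_inj.
apply: (tvec_gen (@generating_Cinf _ (arr G))) => [|f Cf].
  by apply: arr_point_separated => f Cf; exact: (h _ (Cinf_tilde_tau Cf)).
exact: (h _ (Cinf_act Cf)).
Qed.

Lemma AG_foot (a : AG G) : tilde_tau (AG_incl a) = unit_arr (AG_tau a).
Proof. by have [q e] := svalP a; rewrite /AG_tau e src_unit. Qed.

End ValphaGenerators.

Section ValphaCharts.
Context {R : realType} (G : lie_groupoid R).

(** If [f = phi(b)] near the foot of [v], then [v f] is the sum of the [(v b_i)] times the partial
    derivatives of [phi] at [b]. So the functions [b] of the foot together with [v |-> v b_i]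
    suffice. *)
Lemma Valpha_locally_finite (w : Valpha G) : locally_finite_at w.
Proof.
have [n mG] := arr_manifold G.
have [m [b [N [nN Cb sepb lf]]]] := manifold_locally_finite (tilde_tau w) mG.
have sb q i : smooth_at q (b i) by exact: smooth_wrt_mem.
pose c (i : 'I_(m + m)) : Valpha G -> R := match fintype.split i with
  | inl j => fun v => b j (tilde_tau v) | inr j => fun v => act (vtan v) (b j) end.
have cl v : lsubmx (\row_i c i v) = \row_i b i (tilde_tau v).
  by apply/rowP => i; rewrite !mxE /c (unsplitK (inl i)).
have cr v : rsubmx (\row_i c i v) = \row_i act (vtan v) (b i).
  by apply/rowP => i; rewrite !mxE /c (unsplitK (inr i)).
have Cc i : Cinf (Valpha G) (c i).
  by rewrite /c; case: fintype.split => j; [exact: Cinf_tilde_tau|exact: Cinf_act].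
have actE (v : Valpha G) f phi W : open W -> W (\row_i b i (tilde_tau v)) ->
    smooth_on W phi -> (\forall q \near tilde_tau v, f q = phi (\row_i b i q)) ->
    act (vtan v) f = \sum_i act (vtan v) (b i) * partial i phi (\row_i b i (tilde_tau v)).
  by move=> oW Wv sphi nf; exact: (@act_comp_near _ _ (vtan v) m b phi W f (sb _)).
pose N' := @tilde_tau R G @^-1` N.
have ct v : {for v, continuous (@tilde_tau R G)}.
  exact: (smooth_map_at_continuous (@tilde_tau_smooth R G v)).
have sA v f : Cinf (arr G) f -> N' v -> factors c v (fun v => act (vtan v) f) /\
    factors c v (fun v => f (tilde_tau v)).
  move=> Cf Nv.
  have [phi [W [oW Wv sphi nf]]] := lf _ f Nv (smooth_wrt_mem _ Cf).
  have oW' : open (lsubmx @^-1` W : set 'rV[R]_(m + m)).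
    by apply: open_comp => // x _; exact: continuous_lsubmx.
  have Wc : (lsubmx @^-1` W) (\row_i c i v) by rewrite /= cl.
  have slin (g : 'rV[R]_m -> R) : smooth_on W g -> smooth_on (lsubmx @^-1` W : set 'rV[R]_(m + m)) (g \o lsubmx).
    by move=> sg k; apply: (Ck_on_comp_linear (L := lsubmx) _ _ (sg k)) => //;
      exact: continuous_lsubmx.
  (* The identity is needed as a germ at each moving foot [tilde_tau v'], since [v'] differentiates
     it there. *)
  have nfA : \forall v' \near v, \forall q \near tilde_tau v', f q = phi (\row_i b i q).
    exact: (ct v _ (nbhs_interior nf)).
  have nfA2 : \forall v' \near v, W (\row_i b i (tilde_tau v')).
    have nW : \forall q \near tilde_tau v, W (\row_i b i q).
      by apply: (near_row (C := Cinf (arr G))) => // i; exact: dtop_continuous.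
    exact: (ct v _ nW).
  split.
    exists (fun x => \sum_i rsubmx x 0 i * (partial i phi \o lsubmx) x), (lsubmx @^-1` W).
    split => //.
    - apply: smooth_on_sum => // i; apply: smooth_onM => //.
        rewrite (_ : (fun x => _) = fun x : 'rV[R]_(m + m) => x 0 (rshift m i)).
          exact: smooth_on_coord.
        by apply/funext => x; rewrite mxE.
      by apply: slin; exact: smooth_on_derive.
    - apply: filterS2 nfA nfA2 => v' nv' Wv'; rewrite cr /= cl.
      rewrite (actE v' f phi W) //; apply: eq_bigr => i _; by rewrite mxE.
  exists (phi \o lsubmx), (lsubmx @^-1` W); split => //; first exact: slin.
  by apply: filterS nfA => v' /nbhs_singleton ->; rewrite /= cl.
exists (m + m)%N, c, N'; split => //.
- exact: (ct w _ nN).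
- move=> v v' Nv Nv' e; apply: vtan_inj.
  have e1 : tilde_tau v = tilde_tau v' by apply: sepb => //; rewrite -!cl e.
  have e2 i : act (vtan v) (b i) = act (vtan v') (b i).
    by have := congr1 (fun x => rsubmx x 0 i) e; rewrite !cr !mxE.
  apply: (tvec_gen (@generating_Cinf _ (arr G))) => // f Cf.
  have [phi [W [oW Wv sphi nf]]] := lf _ f Nv (smooth_wrt_mem _ Cf).
  rewrite (actE v f phi W) // (actE v' f phi W) // -?e1 //.
  by apply: eq_bigr => i _; rewrite e2.
- move=> v f Nv sf.
  have [k [a [phi [W [Aa oW Wp sphi nf]]]]] := generating_germ (@generating_Valpha _ G) sf.
  have : factors c v (fun q => phi (\row_i a i q)).
    apply: factors_comp oW Wp sphi => i.
    by have [[g Cg ->]|[g Cg ->]] := Aa i; have [] := sA v g Cg Nv.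
  by apply: factors_eq; apply: filterS nf => q ->.
Qed.

End ValphaCharts.

(** * Alpha-fibres and Psi *)

Section Fibres.
Context {R : realType} (G : lie_groupoid R).

Definition fibre_gens (q : obj G) : set (alpha_fibre q -> R) :=
  [set f | exists2 h, Cinf (arr G) h & f = (fun x => h (fibre_incl x))].

Lemma generating_fibre q : generating (@fibre_gens q).
Proof. by apply: generating_subspace; exact: generating_Cinf. Qed.

Lemma fibre_incl_smooth q : smooth_map (@fibre_incl R G q).
Proof.
move=> h; apply: (smooth_map_at_gen (@generating_Cinf _ (arr G))) => f Cf.
by apply: smooth_wrt_mem; apply: (generating_fibre q).1; exists f.
Qed.

Lemma fibre_incl_inj q : injective (@fibre_incl R G q).
Proof. by move=> [x hx] [y hy] /= e; apply: eq_exist. Qed.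

Lemma near_fibre q (p : alpha_fibre q) (N : set (alpha_fibre q)) : nbhs p N ->
  \forall g \near (fibre_incl p : arr G),
    forall h : alpha_fibre q, @fibre_incl R G q h = g -> N h.
Proof.
move=> /(near_generating (generating_fibre q)) [k [a [e [Aa e0 h]]]].
have /choice [b hb] : forall i, exists b, Cinf (arr G) b /\ a i = fun x : alpha_fibre q => b (fibre_incl x).
  by move=> i; have [b Cb E] := Aa i; exists b.
exists k, b, e; split => // [i|g hg x xg]; first by have [] := hb i.
apply: h => i; have [_ ->] := hb i; rewrite xg; exact: hg.
Qed.

(* A tangent vector v vertical for src acts on a function f of the alpha-fibre
   through any smooth extension h of f; vertical_act0 makes this well defined. *)
Section Lift.
Variables (v : Valpha G).
Let g := tilde_tau v.
Let p : alpha_fibre (src g) := exist _ g erefl.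

Let extends (f : alpha_fibre (src g) -> R) (h : arr G -> R) :=
  smooth_at g h /\ \forall x \near p, h (fibre_incl x) = f x.

Let extends_ex f : smooth_at p f -> exists h, extends f h.
Proof.
move=> sf; have [k [a [phi [W [Aa oW Wp sphi nf]]]]] := generating_germ (generating_fibre _) sf.
have /choice [b hb] : forall i, exists b, Cinf (arr G) b /\ a i = fun x : alpha_fibre (src g) => b (fibre_incl x).
  by move=> i; have [b Cb E] := Aa i; exists b.
have E x : \row_i a i x = \row_i b i (fibre_incl x).
  by apply/rowP => i; rewrite !mxE; have [_ ->] := hb i.
exists (fun y => phi (\row_i b i y)); split.
  apply: smooth_at_comp oW _ sphi; last by rewrite E in Wp.
  by move=> i; apply: smooth_wrt_mem; have [] := hb i.
by apply: filterS nf => x ->; rewrite E.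
Qed.

Let extends_act f h h' : extends f h -> extends f h' -> act (vtan v) h = act (vtan v) h'.
Proof.
move=> [sh nh] [sh' nh']; apply/eqP; rewrite -subr_eq0 -act_sub //; apply/eqP.
have [n mG] := arr_manifold G; have [n' mQ] := obj_manifold G.
apply: (vertical_act0 mG mQ (src_submersion G) (svalP v)); first exact: smooth_at_sub.
have : \forall x \near p, h (fibre_incl x) - h' (fibre_incl x) = 0.
  by apply: filterS2 nh nh' => x -> ->; rewrite subrr.
by move=> /near_fibre; apply: filterS => y hy e; apply: (hy (exist _ y e)).
Qed.

Let lift_act (f : alpha_fibre (src g) -> R) : R :=
  if `[< smooth_at p f >] then act (vtan v) (xget (fun=> 0) (extends f)) else 0.

Let lift_actE f h : smooth_at p f -> extends f h -> lift_act f = act (vtan v) h.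
Proof.
move=> sf eh; rewrite /lift_act asboolT //; apply: (@extends_act f) => //.
exact: (xgetI (fun=> 0) eh).
Qed.

Let smooth_fg h : smooth_at g h -> smooth_at p (h \o @fibre_incl R G (src g)).
Proof. exact: (@fibre_incl_smooth (src g) p h). Qed.

Lemma fibre_tangent : exists V : tvec (alpha_fibre (src (tilde_tau v))),
  fibre_incl (foot V) = tilde_tau v /\ tmap (@fibre_incl R G _) V = vtan v.
Proof.
have L (c : R) f1 f2 : smooth_at p f1 -> smooth_at p f2 ->
    lift_act (fun x => c * f1 x + f2 x) = c * lift_act f1 + lift_act f2.
  move=> s1 s2; have [h1 e1] := extends_ex s1; have [h2 e2] := extends_ex s2.
  have s12 := smooth_at_lin c s1 s2.
  have e12 : extends (fun x => c * f1 x + f2 x) (fun y => c * h1 y + h2 y).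
    split; first exact: (smooth_at_lin c e1.1 e2.1).
    by apply: filterS2 e1.2 e2.2 => x -> ->.
  rewrite (lift_actE s1 e1) (lift_actE s2 e2) (lift_actE s12 e12).
  exact: (act_lin c e1.1 e2.1).
have B f1 f2 : smooth_at p f1 -> smooth_at p f2 ->
    lift_act (fun x => f1 x * f2 x) = lift_act f1 * f2 p + f1 p * lift_act f2.
  move=> s1 s2; have [h1 e1] := extends_ex s1; have [h2 e2] := extends_ex s2.
  have s12 := smooth_at_mul s1 s2.
  have e12 : extends (fun x => f1 x * f2 x) (fun y => h1 y * h2 y).
    split; first exact: (smooth_at_mul e1.1 e2.1).
    by apply: filterS2 e1.2 e2.2 => x -> ->.
  rewrite (lift_actE s1 e1) (lift_actE s2 e2) (lift_actE s12 e12).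
  rewrite (act_leibniz e1.1 e2.1) -(nbhs_singleton e1.2) -(nbhs_singleton e2.2).
  by [].
have O f : ~ smooth_at p f -> lift_act f = 0 by move=> nf; rewrite /lift_act asboolF.
exists (Tvec L B O); split => //.
apply: (tvec_gen (@generating_Cinf _ (arr G))) => // f Cf.
have sf : smooth_at g f by exact: smooth_wrt_mem.
rewrite (tmap_actE (V := Tvec L B O) (@fibre_incl_smooth (src g) p) sf).
rewrite -[LHS]/(lift_act (f \o @fibre_incl R G (src g))).
apply: lift_actE; first exact: smooth_fg.
by rewrite /extends; split => //; near=> x.
Unshelve. all: by end_near.
Qed.

End Lift.

(** This is [l_{g^{-1}}] on the alpha-fibre of [g], the translation that enters [Psi], not [l_g]. *)
Definition left_translation (g : arr G) (h : alpha_fibre (src g)) : arr G :=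
  mul_arr (inv_arr g) (fibre_incl h).

Definition composable :=
  Defs.subspace (M := prodspace (arr G) (arr G)) (fun gh => tgt gh.1 = src gh.2).

Definition mul_map (gh : composable) : arr G := mul_arr (sval gh).1 (sval gh).2.

Definition composable_gens : set (composable -> R) :=
  [set f | exists2 h, Cinf (arr G) h & f = (fun x => h (sval x).1) \/ f = (fun x => h (sval x).2)].

Lemma generating_composable : generating composable_gens.
Proof.
pose A : set (arr G * arr G -> R) := [set f |
    (exists2 h, Cinf (arr G) h & f = (fun x => h x.1)) \/
    (exists2 h, Cinf (arr G) h & f = (fun x => h x.2))].
have gA : generating (M := prodspace (arr G) (arr G)) A by exact: generating_generated.
rewrite (_ : composable_gens = [set f | exists2 h, A h & f = (fun x : composable => h (sval x))]).
  exact: generating_subspace.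
apply/seteqP; split => e.
  by case=> h Ch [->|->]; [exists (fun x => h x.1) | exists (fun x => h x.2)] => //;
    [left|right]; exists h.
by case=> h [[f Cf ->] ->|[f Cf ->] ->]; exists f => //; [left|right].
Qed.

Lemma mul_map_smooth : smooth_map mul_map.
Proof. exact: mul_smooth. Qed.

Lemma left_translation_smooth g : smooth_map (@left_translation g).
Proof.
have e (h : alpha_fibre (src g)) : tgt (inv_arr g) = src (fibre_incl h).
  by rewrite tgt_inv; exact/esym/(svalP h).
pose k (h : alpha_fibre (src g)) : composable := exist _ (inv_arr g, fibre_incl h) (e h).
move=> h; apply: (@smooth_map_at_comp _ _ _ _ k mul_map); last exact: mul_map_smooth.
apply: (smooth_map_at_gen generating_composable) => _ [f Cf [->|->]].
  exact: (smooth_at_cst h (f (inv_arr g))).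
exact: (@fibre_incl_smooth (src g) h f (smooth_wrt_mem _ Cf)).
Qed.

Lemma left_translation_self (g : arr G) (h : alpha_fibre (src g)) :
  fibre_incl h = g -> left_translation h = unit_arr (tgt g).
Proof. by rewrite /left_translation => ->; exact: inv_mul. Qed.

Lemma src_left_translation (g : arr G) (h : alpha_fibre (src g)) :
  src (left_translation h) = tgt g.
Proof.
rewrite /left_translation src_mul ?src_inv // tgt_inv.
exact/esym/(svalP h).
Qed.

(** Restrictions of functions on [G] generate the structure of the fibre, so the vector tangent to
    the fibre is determined by its image in the tangent space of [G]. *)
Lemma left_translated_unique (v : Valpha G) (w w' : AG G) :
  left_translated v w -> left_translated v w' -> w = w'.
Proof.
move=> [V [hV hw]] [V' [hV' hw']].
have VV' : V = V'.
  have f : foot V = foot V'.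
    apply: fibre_incl_inj.
    by move: (congr1 (@foot _ _) hV) (congr1 (@foot _ _) hV') => /= -> ->.
  apply: (tvec_gen (generating_fibre _)) => // _ [h Ch ->].
  have sh q : smooth_at q h by exact: smooth_wrt_mem.
  have := congr1 (fun W => act W h) (etrans hV (esym hV')).
  by rewrite !tmap_actE //; exact: fibre_incl_smooth.
apply: AG_incl_inj; apply: vtan_inj; by rewrite -hw -hw' VV'.
Qed.

Lemma left_translated_ex (v : Valpha G) : exists w, left_translated v w.
Proof.
have [V [Vg hV]] := fibre_tangent v.
set g := tilde_tau v in V Vg hV *.
pose W := tmap (@left_translation g) V.
have Wf : foot W = unit_arr (tgt g) by exact: left_translation_self.
(* [src] takes the constant value [tgt g] on the translated fibre. *)
have Wv : vertical W.
  rewrite /vertical /W tmap_comp; [|exact: left_translation_smooth|exact: src_smooth].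
  apply: (tvec_gen (@generating_Cinf _ (obj G))) => // f Cf.
  rewrite tmap_actE; last exact: smooth_wrt_mem.
    rewrite (_ : _ \o _ = fun=> f (tgt g)); first exact: act_cst.
    by apply/funext => h; rewrite /= src_left_translation.
  by apply: smooth_map_at_comp; [exact: left_translation_smooth|exact: src_smooth].
pose Wa : Valpha G := exist _ W Wv.
exists (exist _ Wa (ex_intro _ (tgt g) Wf)).
by exists V.
Qed.

Lemma left_translated_Psi (v : Valpha G) : left_translated v (Psi v).
Proof. by have [w hw] := left_translated_ex v; exact: (xgetI _ hw). Qed.

Lemma Psi_eq (v : Valpha G) w : left_translated v w -> Psi v = w.
Proof. by apply: left_translated_unique; exact: left_translated_Psi. Qed.

(** A single vector on the fibre computes both [v] and [Psi v], as derivatives along the inclusion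
    and along the translation; this makes each expressible through the other. *)
Lemma fibre_vector (v : Valpha G) : exists V : tvec (alpha_fibre (src (tilde_tau v))),
  [/\ fibre_incl (foot V) = tilde_tau v,
      forall f, Cinf (arr G) f -> act (vtan v) f = act V (f \o @fibre_incl R G _) &
      forall f, Cinf (arr G) f ->
        act (vtan (AG_incl (Psi v))) f = act V (f \o @left_translation (tilde_tau v))].
Proof.
have [V [hV hw]] := left_translated_Psi v; exists V; split.
- exact: (congr1 (@foot _ _) hV).
- by move=> f Cf; rewrite -hV tmap_actE //; [exact: fibre_incl_smooth|exact: smooth_wrt_mem].
- by move=> f Cf; rewrite -hw tmap_actE //; [exact: left_translation_smooth|exact: smooth_wrt_mem].
Qed.

Lemma tilde_tau_Psi (v : Valpha G) : tilde_tau (AG_incl (Psi v)) = unit_arr (tgt (tilde_tau v)).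
Proof.
have [V [hV hw]] := left_translated_Psi v; rewrite /tilde_tau -hw.
by apply: left_translation_self; exact: (congr1 (@foot _ _) hV).
Qed.

End Fibres.

(** * [V alpha] as the pull-back of [AG], in terms of germs *)

Section Translations.
Context {R : realType} (G : lie_groupoid R).

(* Generators on the space of composable pairs depend on one factor only; each is
   written a_i g + b_i h with one of the two summands zero. *)
Lemma mul_germ f (g0 h0 : arr G) : Cinf (arr G) f -> tgt g0 = src h0 ->
  exists k (a b : 'I_k -> arr G -> R) phi (W : set 'rV[R]_k) (N1 N2 : set (arr G)),
  [/\ forall i, Cinf (arr G) (a i) /\ Cinf (arr G) (b i), open W, smooth_on W phi,
      nbhs g0 N1 /\ nbhs h0 N2 &
      forall g h, N1 g -> N2 h -> W (\row_i (a i g + b i h)) /\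
        (tgt g = src h -> f (mul_arr g h) = phi (\row_i (a i g + b i h)))].
Proof.
move=> Cf e0; pose pt : composable G := exist _ (g0, h0) e0.
have C0 (T : diffspace R) : Cinf T (fun=> 0) by apply/Cinf_smooth => q; exact: smooth_at_cst.
have split_gen (c : composable G -> R) : composable_gens c ->
    exists ab : (arr G -> R) * (arr G -> R),
    [/\ Cinf (arr G) ab.1, Cinf (arr G) ab.2 & c = fun x => ab.1 (sval x).1 + ab.2 (sval x).2].
  move=> [h Ch [->|->]]; [exists (h, fun=> 0)|exists (fun=> 0, h)]; split => //=.
    by apply/funext => x; rewrite addr0.
  by apply/funext => x; rewrite add0r.
have sf : smooth_at pt (f \o @mul_map _ G).
  by apply: mul_map_smooth; exact: smooth_wrt_mem.
have [k [c [phi [W [Ac oW Wp sphi [k' [c' [e [Ac' e_gt0 hc']]]]]]]]] :=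
  (generating_composable G).2 _ _ sf.
have /choice [ab hab] := fun i => split_gen _ (Ac i).
have /choice [ab' hab'] := fun i => split_gen _ (Ac' i).
have cE x : \row_i c i x = \row_i ((ab i).1 (sval x).1 + (ab i).2 (sval x).2).
  by apply/rowP => i; rewrite !mxE; have [_ _ ->] := hab i.
have [d d0 dW] : exists2 d : R, 0 < d & ball (\row_i c i pt) d `<=` W.
  have : nbhs (\row_i c i pt) W by exact: open_nbhs_nbhs.
  by move=> /nbhs_ballP [d d0 h]; exists d.
have near_lt (b : arr G -> R) (x : arr G) (r : R) : Cinf (arr G) b -> 0 < r ->
    \forall y \near x, `|b y - b x| < r.
  by move=> Cb r0; exists 1%N, (fun=> b), r; split => // y /(_ ord0).
have d2 : 0 < d / 2 by rewrite divr_gt0.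
have e2 : 0 < e / 2 by rewrite divr_gt0.
(* Every coordinate is a sum over the two factors, so each factor receives half of the tolerance:
   [d] keeps the point in [W], [e] keeps the germ identity valid. The result is a product
   neighbourhood. *)
pose N1 := [set g | (forall i, `|(ab i).1 g - (ab i).1 g0| < d / 2) /\
                    (forall i, `|(ab' i).1 g - (ab' i).1 g0| < e / 2)].
pose N2 := [set h | (forall i, `|(ab i).2 h - (ab i).2 h0| < d / 2) /\
                    (forall i, `|(ab' i).2 h - (ab' i).2 h0| < e / 2)].
have nN1 : nbhs g0 N1.
  apply: filterI.
    have h i : \forall g \near g0, `|(ab i).1 g - (ab i).1 g0| < d / 2.
      by have [? _ _] := hab i; exact: near_lt.
    exact: filter_forall (nbhs_filter g0) h.
  have h i : \forall g \near g0, `|(ab' i).1 g - (ab' i).1 g0| < e / 2.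
    by have [? _ _] := hab' i; exact: near_lt.
  exact: filter_forall (nbhs_filter g0) h.
have nN2 : nbhs h0 N2.
  apply: filterI.
    have h i : \forall g \near h0, `|(ab i).2 g - (ab i).2 h0| < d / 2.
      by have [_ ? _] := hab i; exact: near_lt.
    exact: filter_forall (nbhs_filter h0) h.
  have h i : \forall g \near h0, `|(ab' i).2 g - (ab' i).2 h0| < e / 2.
    by have [_ ? _] := hab' i; exact: near_lt.
  exact: filter_forall (nbhs_filter h0) h.
have sum_lt (x y x0 y0 r : R) : `|x - x0| < r / 2 -> `|y - y0| < r / 2 ->
    `|(x + y) - (x0 + y0)| < r.
  move=> h1 h2; rewrite opprD addrACA; apply: le_lt_trans (ler_normD _ _) _; lra.
exists k, (fun i => (ab i).1), (fun i => (ab i).2), phi, W, N1, N2; split => //.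
  by move=> i; have [] := hab i.
move=> g h [h1 h1'] [h2 h2']; split.
  apply: dW; rewrite -ball_normE /= distrC; apply: norm_rV_lt => // i.
  by rewrite cE !mxE; apply: sum_lt; [exact: h1|exact: h2].
move=> eg; rewrite -[LHS]/((f \o @mul_map _ G) (exist _ (g, h) eg : composable G)).
rewrite hc' ?cE // => i; have [_ _ ->] := hab' i.
by apply: sum_lt; [exact: h1'|exact: h2'].
Qed.

Lemma act_shifted (M : diffspace R) (V : tvec M) k (a : 'I_k -> R) (b : 'I_k -> M -> R)
    phi (W : set 'rV[R]_k) (f : M -> R) :
  (forall i, smooth_at (foot V) (b i)) -> open W -> W (\row_i (a i + b i (foot V))) ->
  smooth_on W phi -> (\forall q \near foot V, f q = phi (\row_i (a i + b i q))) ->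
  act V f = \sum_i act V (b i) * partial i phi (\row_i (a i + b i (foot V))).
Proof.
move=> sb oW Wp sphi nf.
have sab i : smooth_at (foot V) (fun q => a i + b i q).
  by apply: smooth_at_add (sb i); exact: smooth_at_cst.
rewrite (act_comp_near sab oW Wp sphi nf); apply: eq_bigr => i _; congr (_ * _).
by rewrite act_add ?act_cst ?add0r //; exact: smooth_at_cst.
Qed.

Lemma partial_smooth_at (M : diffspace R) (p : M) k (a : 'I_k -> M -> R) phi (W : set 'rV[R]_k) i :
  (forall i, smooth_at p (a i)) -> open W -> W (\row_i a i p) -> smooth_on W phi ->
  smooth_at p (fun q => partial i phi (\row_i a i q)).
Proof.
by move=> sa oW Wp sphi; apply: smooth_at_comp sa oW Wp _; exact: smooth_on_derive.
Qed.

(** The coefficients [theta] depend smoothly on the foot and not on the vector. With [x] and [y]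
    being [vtan] and its composite with [Psi], in either order, it expresses [Psi] and its fibrewise
    inverse. *)
Definition translation_coeffs f (g0 : arr G) (k : nat) (b : 'I_k -> arr G -> R)
    (theta : 'I_k -> arr G -> R) (x y : Valpha G -> tvec (arr G)) :=
  [/\ forall i, Cinf (arr G) (b i), forall i, smooth_at g0 (theta i) &
      \forall g \near g0, forall v : Valpha G, tilde_tau v = g ->
        act (x v) f = \sum_i act (y v) (b i) * theta i g].

(* Differentiate h |-> f (g^-1 h) along the alpha-fibre at h = g. *)
Lemma act_Psi_germ f (g0 : arr G) : Cinf (arr G) f ->
  exists k b theta, @translation_coeffs f g0 k b theta
    (fun v => vtan (AG_incl (Psi v))) (@vtan R G).
Proof.
move=> Cf; have [k [a [b [phi [W [N1 [N2 [Cab oW sphi [nN1 nN2] hN]]]]]]]] :=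
  mul_germ Cf (tgt_inv g0).
have sb i q : smooth_at q (b i) by apply: smooth_wrt_mem; have [] := Cab i.
have sa i q : smooth_at q (a i) by apply: smooth_wrt_mem; have [] := Cab i.
have sai i (q : arr G) : smooth_at q (fun g => a i (inv_arr g)) by apply: (inv_smooth (p := q)).
have sab i (q : arr G) : smooth_at q (fun g => a i (inv_arr g) + b i g).
  exact: smooth_at_add (sai i q) (sb i q).
have ci : {for g0, continuous (@inv_arr R G)}.
  exact: (smooth_map_at_continuous (@inv_smooth R G g0)).
have n1 : \forall g \near g0, N1 (inv_arr g) by exact: (ci _ nN1).
(* [N2] has to be a neighbourhood of the moving point [g], because the derivative is taken at
   [g]. *)
have n2 : \forall g \near g0, \forall h \near g, N2 h by exact: nbhs_interior nN2.
exists k, b, (fun i g => partial i phi (\row_i (a i (inv_arr g) + b i g))); split.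
- by move=> i; have [] := Cab i.
- move=> i; apply: (partial_smooth_at i _ oW _ sphi) => [j|]; first exact: sab.
  by have [] := hN _ _ (nbhs_singleton nN1) (nbhs_singleton nN2).
apply: filterS2 n1 n2 => g N1g nN2g v vg.
have [V [Vf hV hPsi]] := fibre_vector v; rewrite hPsi //.
subst g; set g := tilde_tau v in V Vf hV hPsi N1g nN2g *.
have N2g := nbhs_singleton nN2g.
have sbi i : smooth_at (foot V) (b i \o @fibre_incl R G (src g)).
  by apply: fibre_incl_smooth; exact: sb.
have nf : \forall h \near foot V, (f \o @left_translation _ G g) h =
    phi (\row_i (a i (inv_arr g) + (b i \o @fibre_incl R G (src g)) h)).
  have cf : {for foot V, continuous (@fibre_incl R G (src g))}.
    exact: (smooth_map_at_continuous (@fibre_incl_smooth _ G (src g) (foot V))).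
  have : \forall h \near foot V, N2 (fibre_incl h).
    by apply: cf; rewrite Vf.
  apply: filterS => h N2h; have [_] := hN _ _ N1g N2h; apply.
  by rewrite tgt_inv; exact/esym/(svalP h).
rewrite (act_shifted sbi oW _ sphi nf).
  by apply: eq_bigr => i _; rewrite /= Vf hV //; have [] := Cab i.
by rewrite /= Vf; have [] := hN _ _ N1g N2g.
Qed.

(* Differentiate h |-> f (g (g^-1 h)) along the alpha-fibre at h = g: V alpha is the
   pull-back of AG, so a tangent vector to V alpha is determined by its images under
   the tangent maps of tilde_tau and Psi. *)
Lemma act_germ f (g0 : arr G) : Cinf (arr G) f ->
  exists k b theta, @translation_coeffs f g0 k b theta
    (@vtan R G) (fun v => vtan (AG_incl (Psi v))).
Proof.
move=> Cf; have e0 : tgt g0 = src (unit_arr (tgt g0)) by rewrite src_unit.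
have [k [a [b [phi [W [N1 [N2 [Cab oW sphi [nN1 nN2] hN]]]]]]]] := mul_germ Cf e0.
have sb i q : smooth_at q (b i) by apply: smooth_wrt_mem; have [] := Cab i.
have sa i q : smooth_at q (a i) by apply: smooth_wrt_mem; have [] := Cab i.
pose ut (g : arr G) := unit_arr (tgt g).
have sut (q : arr G) : smooth_map_at ut q.
  apply: (@smooth_map_at_comp _ _ _ _ (@tgt R G) (@unit_arr R G)); first exact: tgt_smooth.
  exact: unit_smooth.
have sab i (q : arr G) : smooth_at q (fun g => a i g + b i (ut g)).
  exact: smooth_at_add (sa i q) (sut q _ (sb i _)).
have cu : {for g0, continuous ut} by exact: (smooth_map_at_continuous (sut g0)).
have n2 : \forall g \near g0, \forall h \near ut g, N2 h.
  exact: (cu _ (nbhs_interior nN2)).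
exists k, b, (fun i g => partial i phi (\row_i (a i g + b i (ut g)))); split.
- by move=> i; have [] := Cab i.
- move=> i; apply: (partial_smooth_at i _ oW _ sphi) => [j|]; first exact: sab.
  by have [] := hN _ _ (nbhs_singleton nN1) (nbhs_singleton nN2).
apply: filterS2 nN1 n2 => g N1g nN2g v vg.
have [V [Vf hV hPsi]] := fibre_vector v; rewrite hV //.
subst g; set g := tilde_tau v in V Vf hV hPsi N1g nN2g *.
have N2g := nbhs_singleton nN2g.
have Lf : left_translation (foot V) = ut g by exact: left_translation_self.
have sbi i : smooth_at (foot V) (b i \o @left_translation _ G g).
  by apply: left_translation_smooth; exact: sb.
have nf : \forall h \near foot V, (f \o @fibre_incl R G (src g)) h =
    phi (\row_i (a i g + (b i \o @left_translation _ G g) h)).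
  have cf : {for foot V, continuous (@left_translation _ G g)}.
    exact: (smooth_map_at_continuous (@left_translation_smooth _ G g (foot V))).
  have : \forall h \near foot V, N2 (left_translation h).
    by apply: cf; rewrite Lf.
  apply: filterS => h N2h; have [_ <-] := hN _ _ N1g N2h.
    rewrite /= /left_translation -mul_assoc ?tgt_inv ?src_inv //; last exact/esym/(svalP h).
    have hs : src (fibre_incl h) = src g := svalP h.
    have := unit_mul (fibre_incl h); rewrite hs => {1}<-.
    by rewrite mul_inv.
  by rewrite src_left_translation.
rewrite (act_shifted sbi oW _ sphi nf).
  by apply: eq_bigr => i _; rewrite /= Lf hPsi //; have [] := Cab i.
by rewrite /= Lf; have [] := hN _ _ N1g N2g.
Qed.

Lemma near_tilde_tau (v : Valpha G) (P : arr G -> Prop) :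
  (\forall g \near tilde_tau v, P g) -> \forall w \near v, P (tilde_tau w).
Proof.
by have := smooth_map_at_continuous (@tilde_tau_smooth R G v); apply.
Qed.

(** A function of the foot of [Psi v] is one of the unit at [tgt]; a fibre coordinate of [Psi v] is,
    by [act_Psi_germ], a combination of fibre coordinates of [v] with coefficients smooth in the
    foot. *)
Lemma Psi_smooth : smooth_map (@Psi R G).
Proof.
move=> v; apply: (smooth_map_at_gen (generating_AG G)) => _ [h [] [f Cf ->] ->].
  have E : (fun a : AG G => f (tilde_tau (AG_incl a))) \o @Psi R G =
      (f \o (@unit_arr R G \o @tgt R G)) \o @tilde_tau R G.
    by apply/funext => w; rewrite /= tilde_tau_Psi.
  rewrite E; apply: tilde_tau_smooth; apply: smooth_map_at_comp.
  - exact: tgt_smooth.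
  - exact: unit_smooth.
  - exact: smooth_wrt_mem.
have [k [b [theta [Cb stheta nE]]]] := act_Psi_germ (tilde_tau v) Cf.
apply: (@smooth_at_eq _ _ _ (fun w : Valpha G =>
    \sum_i act (vtan w) (b i) * theta i (tilde_tau w))).
  by apply: filterS (near_tilde_tau nE) => w /(_ w erefl) /= ->.
apply: smooth_at_sum => i; apply: smooth_at_mul.
  by apply: smooth_wrt_mem; exact: Cinf_act.
by apply: (@tilde_tau_smooth R G v); exact: stheta.
Qed.

End Translations.

(** * Homogeneity of the SODE and of its lift *)

Section Homogeneity.
Context {R : realType} (G : lie_groupoid R).

Definition scaleV (s : R) (v : Valpha G) : Valpha G :=
  exist _ (tscale s (vtan v)) (vertical_scale s (svalP v)).

Lemma scaleA_scale (r s : R) (a : AG G) : scaleA r (scaleA s a) = scaleA (r * s) a.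
Proof.
apply: AG_incl_inj; apply: vtan_inj; apply: tvec_ext => //= f.
by rewrite mulrA.
Qed.

Lemma scaleA1 (a : AG G) : scaleA 1 a = a.
Proof.
by apply: AG_incl_inj; apply: vtan_inj; apply: tvec_ext => //= f; rewrite mul1r.
Qed.

Lemma scaleA0 (a : AG G) : scaleA 0 a = zeroA (AG_tau a).
Proof.
apply: AG_incl_inj; apply: vtan_inj; apply: tvec_ext => /= [|f]; last by rewrite mul0r.
exact: AG_foot.
Qed.

Lemma Psi_scale s (v : Valpha G) : Psi (scaleV s v) = scaleA s (Psi v).
Proof.
apply: Psi_eq; have [V [hV hw]] := left_translated_Psi v.
exists (tscale s V); split; first by rewrite tmap_tscale hV.
by rewrite tmap_tscale hw.
Qed.

Lemma diff_curve_scaleA (k : R -> R) (a : AG G) t :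
  derivable k t 1 -> diff_curve (fun s => scaleA (k s) a) t.
Proof.
move=> dk; apply: (diff_curve_gen (generating_AG G)) => _ [h [] [f Cf ->] ->].
  rewrite (_ : _ \o _ = cst (f (tilde_tau (AG_incl a)))); first exact: derivable_cst.
  exact/funext.
have -> : (fun b : AG G => act (vtan (AG_incl b)) f) \o (fun s => scaleA (k s) a) =
    act (vtan (AG_incl a)) f *: k by apply/funext => s /=; rewrite mulrC.
exact: derivableZ.
Qed.

Lemma Cinf_actA f : Cinf (arr G) f -> Cinf (AG G) (fun a => act (vtan (AG_incl a)) f).
Proof.
move=> Cf; apply: (generating_AG G).1; exists (fun v => act (vtan v) f) => //.
by right; exists f.
Qed.

Section Gamma.
Variables (Gamma : AG G -> tvec (AG G)).
Hypotheses (vG : vector_field Gamma) (qG : homogeneous_quadratic Gamma).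

Lemma act_euler (a : AG G) E : Cinf (AG G) E ->
  is_derive (0 : R) (1 : R) (fun t : R => E (scaleA (expR t) a)) (act (euler a) E).
Proof.
move=> CE; have dc : diff_curve (fun t => scaleA (expR t) a) 0.
  by apply: diff_curve_scaleA; exact: derivable_expR.
have sE : smooth_at (scaleA (expR 0) a) E by exact: smooth_wrt_mem.
by split; [exact: (dc E sE)|rewrite /euler velocity_actE].
Qed.

(* The fibre coordinate d satisfies [euler d = d], so the bracket condition reads
   [euler (Gamma d) = 2 Gamma d], a linear equation along t |-> e^t a. *)
Lemma Gamma_exp f (a : AG G) (t : R) : Cinf (arr G) f ->
  act (Gamma (scaleA (expR t) a)) (fun b => act (vtan (AG_incl b)) f) =
  expR (2 * t) * act (Gamma a) (fun b => act (vtan (AG_incl b)) f).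
Proof.
move=> Cf; set d := fun b : AG G => act (vtan (AG_incl b)) f.
have Cd : Cinf (AG G) d by exact: Cinf_actA.
have CE := vector_field_act vG Cd; set E := fun p => act (Gamma p) d in CE.
have ed : (fun b => act (euler b) d) = d.
  apply/funext => b; have [_ <-] := act_euler b Cd.
  rewrite (_ : (fun t => _) = d b *: (expR : R -> R)); last first.
    by apply/funext => s; rewrite /d /= mulrC.
  by rewrite deriveZ // derive_val expR0; exact: mulr1.
have eE b : act (euler b) E = 2 * E b.
  have h : E b = act (euler b) E - E b by have := qG Cd b; rewrite ed.
  have -> : act (euler b) E = E b + E b by rewrite {1}h subrK.
  by ring.
have := @linear_ode R (fun t => E (scaleA (expR t) a)) 2 _ t.
rewrite expR0 scaleA1; apply => s.
have [d0 e0] := act_euler (scaleA (expR s) a) CE.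
(* Dilations form a one-parameter group, so the derivative at time [s] is the derivative at 0 along
   the orbit starting at [e^s a], which is [euler] there. *)
have E2 : (fun t => E (scaleA (expR t) a)) =
    (fun t => E (scaleA (expR t) (scaleA (expR s) a))) \o (fun t => t - s).
  by apply/funext => r; rewrite /= scaleA_scale -expRD subrK.
rewrite E2 -eE -e0.
have ds : is_derive s (1 : R) (fun t => t - s) 1.
  have := @is_deriveB R _ _ (fun t : R => t) (cst s) s 1 1 0 (is_derive_id s 1) (is_derive_cst _ _ _).
  by rewrite subr0.
set F := fun t : R => E (scaleA (expR t) (scaleA (expR s) a)) in d0 *.
have d1 : is_derive (s - s) 1 F ('D_1 F 0) by rewrite subrr; exact: DeriveDef.
have := @is_derive1_comp R F (fun t => t - s) s _ _ d1 ds.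
by rewrite mulr1.
Qed.

(** Degree 2 is claimed on fibre coordinates only; on functions of the base point a SODE has degree
    1. *)
Lemma Gamma_scale f (a : AG G) (s : R) : Cinf (arr G) f -> 0 <= s ->
  act (Gamma (scaleA s a)) (fun b => act (vtan (AG_incl b)) f) =
  s ^+ 2 * act (Gamma a) (fun b => act (vtan (AG_incl b)) f).
Proof.
move=> Cf; rewrite le_eqVlt => /predU1P[<-|s0].
  (* No orbit of positive dilations joins [a] to the zero vector. But the zero vector is fixed by
     them, so its value [x] satisfies [x = e^2 x], whence [x = 0]. *)
  have := Gamma_exp (scaleA 0 a) 1 Cf; rewrite scaleA_scale mulr0 expr0n mul0r mulr1.
  set x := act _ _ => h; have : (1 - expR 2) * x = 0 by rewrite mulrBl mul1r -h subrr.
  move=> /eqP; rewrite mulf_eq0 => /orP[|/eqP//].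
  have : (1 : R) < expR 2 by rewrite expR_gt1.
  by rewrite subr_eq0 => /[swap] /eqP <-; rewrite ltxx.
have := Gamma_exp a (ln s) Cf; rewrite lnK // => ->; congr (_ * _).
by rewrite expRM_natl lnK.
Qed.

End Gamma.

End Homogeneity.

(** * The lift of the SODE to [V alpha] *)

Section LiftedSODE.
Context {R : realType} (G : lie_groupoid R).
Variables (Gamma : AG G -> tvec (AG G)) (tGamma : Valpha G -> tvec (Valpha G)).
Hypotheses (Gamma_SODE : SODE (@AG_tau R G) (@AG_anchor R G) Gamma)
  (Gamma_quadratic : homogeneous_quadratic Gamma)
  (tGamma_SODE : SODE (@tilde_tau R G) (@vtan R G) tGamma)
  (tGamma_related : forall v, tmap (@Psi R G) (tGamma v) = Gamma (Psi v)).

Let foot_tG v : foot (tGamma v) = v.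
Proof. by have [[h _] _] := tGamma_SODE. Qed.

Lemma tGamma_base v f : smooth_at (tilde_tau v) f ->
  act (tGamma v) (fun w => f (tilde_tau w)) = act (vtan v) f.
Proof.
have [_ h] := tGamma_SODE => sf; rewrite -h tmap_actE ?foot_tG //.
exact: tilde_tau_smooth.
Qed.

Lemma tGamma_fibre v (f : AG G -> R) : smooth_at (Psi v) f ->
  act (tGamma v) (f \o @Psi R G) = act (Gamma (Psi v)) f.
Proof.
move=> sf; rewrite -tGamma_related tmap_actE ?foot_tG //.
exact: Psi_smooth.
Qed.

(** The Leibniz rule applied to the expansion of [v f] from [act_germ]: [Psi]-relatedness evaluates
    the factors that come from [AG], and the SODE condition evaluates the [theta i], which depend on
    the foot only. *)
Lemma tGamma_act_formula v f k b theta :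
  @translation_coeffs _ _ f (tilde_tau v) k b theta (@vtan R G) (fun w => vtan (AG_incl (Psi w))) ->
  act (tGamma v) (fun w => act (vtan w) f) =
  \sum_i (act (Gamma (Psi v)) (fun a => act (vtan (AG_incl a)) (b i)) * theta i (tilde_tau v)
          + act (vtan (AG_incl (Psi v))) (b i) * act (vtan v) (theta i)).
Proof.
move=> [Cb sth nE].
pose d i (a : AG G) := act (vtan (AG_incl a)) (b i).
have sd i a : smooth_at a (d i) by apply: smooth_wrt_mem; exact: Cinf_actA.
have s1 i : smooth_at v (d i \o @Psi R G) by apply: (Psi_smooth (p := v)); exact: sd.
have s2 i : smooth_at v (fun w => theta i (tilde_tau w)).
  by apply: (@tilde_tau_smooth R G v); exact: sth.
rewrite (@act_near _ _ _ _ (fun w => \sum_i (d i \o @Psi R G) w * theta i (tilde_tau w))).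
  rewrite act_sum ?foot_tG; last by move=> i; exact: smooth_at_mul.
  apply: eq_bigr => i _; rewrite act_leibniz ?foot_tG //.
  by rewrite tGamma_fibre // tGamma_base.
rewrite foot_tG; apply: filterS (near_tilde_tau nE) => w; exact.
Qed.

(** Scaling keeps the foot, so one expansion serves [v] and [s v]. The first summand has the degree
    of [Gamma], and the second is a product of two factors linear in [v]. *)
Lemma tGamma_scale v f (s : R) : Cinf (arr G) f -> 0 <= s ->
  act (tGamma (scaleV s v)) (fun w => act (vtan w) f) =
  s ^+ 2 * act (tGamma v) (fun w => act (vtan w) f).
Proof.
move=> Cf s0; have [k [b [theta h]]] := act_germ (tilde_tau v) Cf.
rewrite (@tGamma_act_formula v f k b theta h).
rewrite (@tGamma_act_formula (scaleV s v) f k b theta h) mulr_sumr.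
have [Cb _ _] := h; have [vG _] := Gamma_SODE.
apply: eq_bigr => i _; rewrite Psi_scale (Gamma_scale vG) //.
rewrite -[act (vtan (scaleV s v)) _]/(s * act (vtan v) (theta i)).
rewrite -[act (vtan (AG_incl (scaleA s _))) _]/(s * act (vtan (AG_incl (Psi v))) (b i)).
rewrite -[tilde_tau (scaleV s v)]/(tilde_tau v); ring.
Qed.

(** On functions of the foot the change of time gives the factor [s], as the SODE condition
    requires; on fibre coordinates the scaling contributes a second factor [s], matching degree
    2. *)
Lemma integral_curve_rescale (c : R -> Valpha G) (d s : R) : 0 < d -> 0 <= s <= 1 ->
  integral_curve tGamma (around01 d) c ->
  integral_curve tGamma (around01 d) (fun t => scaleV s (c (s * t))).
Proof.
move=> d0 /andP[s0 s1] ic t /andP[td1 td2].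
(* The interval contains 0 and [0 <= s <= 1], so multiplying by [s] does not leave it. *)
have Jst : around01 d (s * t).
  have [t0|t0] := leP 0 t.
    apply/andP; split; first by rewrite (@lt_le_trans _ _ 0) ?oppr_lt0 ?mulr_ge0.
    by apply: le_lt_trans td2; rewrite ler_piMl.
  apply/andP; split.
    have : 0 <= (1 - s) * (- t) by rewrite mulr_ge0 ?subr_ge0 // oppr_ge0 ltW.
    by move=> h; apply: lt_le_trans td1 _; lra.
  by rewrite (@le_lt_trans _ _ 0) ?mulr_ge0_le0 ?(ltW t0) // addr_gt0.
have [dc vc] := ic _ Jst.
have dcomp (e : Valpha G -> R) : Cinf (Valpha G) e ->
    is_derive t 1 (fun t => e (c (s * t))) (s * act (tGamma (c (s * t))) e).
  move=> Ce; have se : smooth_at (c (s * t)) e by exact: smooth_wrt_mem.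
  have d1 : is_derive (s * t) 1 (e \o c) (act (tGamma (c (s * t))) e).
    by split; [exact: dc|rewrite -vc velocity_actE].
  have d2 := is_derive_mull s t.
  have := @is_derive1_comp R (e \o c) (fun t : R => s * t) t _ _ d1 d2.
  by rewrite mulrC.
have D e : Valpha_gens e -> is_derive t 1 (e \o (fun t => scaleV s (c (s * t))))
    (act (tGamma (scaleV s (c (s * t)))) e).
  move=> [] [f Cf ->].
    have := dcomp _ (Cinf_tilde_tau Cf).
    by rewrite !tGamma_base //; exact: smooth_wrt_mem.
  have := dcomp _ (Cinf_act Cf); rewrite tGamma_scale // => D.
  have := @is_deriveZ R _ _ _ s t 1 _ D; rewrite /GRing.scale /= mulrA -expr2.
  exact.
have dc' : diff_curve (fun t => scaleV s (c (s * t))) t.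
  by apply: (diff_curve_gen (generating_Valpha G)) => e /D [].
split=> //; apply: (tvec_gen (generating_Valpha G)); first by rewrite foot_tG.
move=> e Ve; rewrite velocity_actE //; last by apply: smooth_wrt_mem; exact: (generating_Valpha G).1.
by have [] := D e Ve.
Qed.

Lemma integral_curve_base (c : R -> Valpha G) (J : set R) :
  integral_curve tGamma J c -> forall t, J t ->
  diff_curve (@tilde_tau R G \o c) t /\ vtan (c t) = velocity (@tilde_tau R G \o c) t.
Proof.
move=> ic t Jt; have [dc vc] := ic t Jt; have [_ h] := tGamma_SODE.
split; first by apply: (diff_curve_map dc); exact: tilde_tau_smooth.
by rewrite (velocity_map dc) ?vc ?h //; exact: tilde_tau_smooth.
Qed.

(** Every smooth function of [src] has derivative 0 along [s], and smooth functions separate the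
    objects. *)
Lemma vertical_velocity_fibre (d : R) (s : R -> arr G) : 0 < d ->
  (forall t, around01 d t -> diff_curve s t /\ vertical (velocity s t)) ->
  forall t, around01 d t -> src (s t) = src (s 0).
Proof.
move=> d0 hs t Jt; apply: obj_point_separated => f Cf.
have J0 : around01 d 0 by apply/andP; split; lra.
have D r : around01 d r -> is_derive r 1 (fun r => f (src (s r))) 0.
  move=> /hs [ds vs]; have ds' := diff_curve_map ds (src_smooth (p := s r)).
  have sf : smooth_at (src (s r)) f by exact: smooth_wrt_mem.
  split; first exact: (ds' f sf).
  rewrite -[fun r => _]/(f \o (@src R G \o s)) -velocity_actE //.
  by rewrite velocity_map // ?vs //; exact: src_smooth.
have cst (x y : R) : x <= y -> around01 d x -> around01 d y -> f (src (s y)) = f (src (s x)).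
  move=> xy /andP[x1 x2] /andP[y1 y2].
  have [||z _ E] := @MVT_segment R (fun r => f (src (s r))) (cst 0) x y xy.
  - by move=> z; rewrite in_itv /= => /andP[h1 h2]; apply: D; apply/andP; split; lra.
  - apply: derivable_within_continuous => z; rewrite in_itv /= => /andP[h1 h2].
    have /D [] // : around01 d z by apply/andP; split; lra.
  by apply/eqP; rewrite -subr_eq0 E mul0r.
by have [h|/ltW h] := leP 0 t; [exact: cst|apply/esym; exact: cst].
Qed.

End LiftedSODE.

(** * The exponential map *)

Theorem proposition4p3 (R : realType) (G : lie_groupoid R)
    (Gamma : AG G -> tvec (AG G)) (tGamma : Valpha G -> tvec (Valpha G))
    (Phi : R -> Valpha G -> Valpha G) (UU : set (AG G)) (U : set (arr G))
    (Gamma_SODE : SODE (@AG_tau R G) (@AG_anchor R G) Gamma)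
    (Gamma_quadratic : homogeneous_quadratic Gamma)
    (tGamma_SODE : SODE (@tilde_tau R G) (@vtan R G) tGamma)
    (tGamma_related : forall v, tmap (@Psi R G) (tGamma v) = Gamma (Psi v))
    (UU_open : open UU) (U_open : open U) (UU_star : starshaped UU)
    (Phi_flow : flow01 tGamma (@AG_incl R G @` UU) Phi)
    (exp_diffeo : diffeo_on UU U (exp_map Phi)) :
  forall q : obj G, (exists2 a, UU a & AG_tau a = q) ->
    [/\ exp_map Phi (zeroA q) = unit_arr q,
        forall v : AG G, UU v -> AG_tau v = q ->
          (exists s, trajectory tGamma (AG_incl v) s) /\
          (forall s, trajectory tGamma (AG_incl v) s ->
             forall t : R, 0 <= t <= 1 ->
               U (s t) /\ exp_map Phi (scaleA t v) = s t) &
        forall (u : tvec (obj G)) (v : AG G), foot u = q -> AG_tau v = q ->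
          tmap (exp_map Phi) (ident_AG u v) = ident_G u v].
Proof.
have [vtG _] := tGamma_SODE.
have traj_ex (v : AG G) : UU v -> exists s, trajectory tGamma (AG_incl v) s.
  move=> Uv; have [P0 [d d0 ic]] := Phi_flow _ (ex_intro2 _ _ v Uv erefl).
  have h := integral_curve_base tGamma_SODE ic.
  exists (@tilde_tau R G \o (Phi^~ (AG_incl v))), d => //; split.
    apply: vertical_velocity_fibre => // t Jt; have [dc vc] := h t Jt.
    by split; rewrite -?vc //; exact: (svalP (Phi t (AG_incl v))).
  by exists (Phi^~ (AG_incl v)); split.
have traj_exp (v : AG G) s : UU v -> trajectory tGamma (AG_incl v) s ->
    forall t : R, 0 <= t <= 1 -> exp_map Phi (scaleA t v) = s t.
  move=> Uv [d d0 [_ [c [hc c0 ic]]]] t t01.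
  have [P0 [e e0 ie]] := Phi_flow _ (ex_intro2 _ _ _ (UU_star _ _ Uv t01) erefl).
  have i1 := integral_curve_rescale Gamma_SODE Gamma_quadratic tGamma_SODE tGamma_related d0 t01 ic.
  (* The trajectory and the flow line through [t v] come with different margins around [[0, 1]];
     uniqueness is applied on the smaller one. At time 1 the rescaled curve is [t c(t)], whose foot
     is [s t]. *)
  pose m := Num.min d e; have m0 : 0 < m by rewrite lt_min d0.
  have md : m <= d by rewrite /m ge_min lexx.
  have me : m <= e by rewrite /m ge_min lexx orbT.
  have E := integral_curve_unique vtG (@Valpha_locally_finite R G)
    (@Valpha_point_separated R G) m0 (integral_curve_mono (around01W md) i1)
    (integral_curve_mono (around01W me) ie).
  rewrite /exp_map; have := E _ 1 _; rewrite mulr0 c0 P0 mulr1 => /(_ erefl) <-;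
    last by rewrite ler01 lexx.
  have /andP[t0 t1] := t01.
  have Jt : around01 d t by apply/andP; split; lra.
  by have [_ vc] := hc t Jt; exact: (congr1 (@foot _ _) vc).
have exp0 q : (exists2 a, UU a & AG_tau a = q) -> exp_map Phi (zeroA q) = unit_arr q.
  (* The zero vector is [0 a], so its exponential is the starting point of the trajectory of [a]. *)
  move=> [a Ua <-]; have [s hs] := traj_ex a Ua.
  have := traj_exp a s Ua hs 0; rewrite scaleA0 => -> //; last by rewrite lexx ler01.
  have [d d0 [_ [c [hc c0 _]]]] := hs; rewrite -AG_foot -c0.
  have J0 : around01 d 0 by apply/andP; split; lra.
  by have [_ vc] := hc 0 J0; exact/esym/(congr1 (@foot _ _) vc).
move=> q hq; have [a Ua aq] := hq; split; first exact: exp0.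
  move=> v Uv vq; split; first exact: traj_ex.
  move=> s hs t t01; have E := traj_exp v s Uv hs t t01; split => //.
  by rewrite -E; have [h _] := exp_diffeo; have [] := h _ (UU_star _ _ Uv t01).
move=> u v uq vq.
have U0 : UU (zeroA q) by rewrite -aq -scaleA0; apply: UU_star => //; rewrite lexx ler01.
have sexp : smooth_map_at (exp_map Phi) (zeroA q) by have [h _] := exp_diffeo; have [] := h _ U0.
have dsc : diff_curve (fun t => scaleA t v) 0.
  by apply: (diff_curve_scaleA (k := id)); exact: derivable_id.
have s0 : scaleA 0 v = zeroA q by rewrite scaleA0 vq.
have szero (x : obj G) : smooth_map_at (@zeroA R G) x.
  apply: (smooth_map_at_gen (generating_AG G)) => _ [h [] [f Cf ->] ->].
    exact: (unit_smooth (smooth_wrt_mem _ Cf)).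
  by rewrite (_ : _ \o _ = fun=> 0); [exact: smooth_at_cst|exact/funext].
rewrite /ident_AG /ident_G tmap_tadd /=; last by rewrite uq.
  congr (tadd _ _).
    rewrite tmap_comp ?uq //; apply: tmap_near.
      by rewrite uq; apply: smooth_map_at_comp.
    (* [exp_map Phi] agrees with the units only where the zero vector lies in [UU]; openness makes
       this a neighbourhood of [q], enough for the tangent map. *)
    have : \forall x \near q, UU (zeroA x).
      by apply: (smooth_map_at_continuous (szero q)); exact: open_nbhs_nbhs.
    by rewrite -uq; apply: filterS => x Ux; apply: exp0; exists (zeroA x) => //; exact: src_unit.
  rewrite -velocity_map ?s0 //.
  have dexp : diff_curve (exp_map Phi \o (fun t => scaleA t v)) 0.
    by apply: diff_curve_map => //; rewrite s0.
  (* exp (t v) = s (t / r) is only known for t >= 0; since the left side is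
     differentiable at 0, its right derivative suffices. *)
  have [r r0 Ur] : exists2 r : R, 0 < r & UU (scaleA r v).
    have : \forall t \near (0 : R), UU (scaleA t v).
      have c := diff_curve_continuous dsc; apply: c; rewrite s0.
      exact: open_nbhs_nbhs.
    move=> /nbhs_ballP [r /= r0 h]; exists (r / 2); first by rewrite divr_gt0.
    by apply: h; rewrite -ball_normE /= sub0r normrN gtr0_norm ?divr_gt0 //; lra.
  have [s hs] := traj_ex _ Ur; have E := traj_exp _ s Ur hs.
  have [d d0 [_ [c [hc c0 _]]]] := hs.
  have J0 : around01 d 0 by apply/andP; split; lra.
  have [ds vs] := hc 0 J0; rewrite c0 in vs.
  have foot0 : exp_map Phi (scaleA 0 v) = tilde_tau (AG_incl v).
    by rewrite s0 exp0 // AG_foot vq.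
  apply: (tvec_gen (@generating_Cinf _ (arr G))) => [|f Cf]; first exact: foot0.
  have sf x : smooth_at x f by exact: smooth_wrt_mem.
  rewrite velocity_actE //.
  have Du : is_derive (0 : R) (1 : R) (f \o (exp_map Phi \o (fun t => scaleA t v)))
      ('D_1 (f \o (exp_map Phi \o (fun t => scaleA t v))) 0).
    by apply: derivableP; exact: dexp.
  (* [s] has initial velocity [r v]; reparametrizing by [t / r] restores [v]. The base point is
     written [r^-1 * 0] to fit the chain rule. *)
  have Ds : is_derive (r^-1 * 0 : R) (1 : R) (f \o s) (r * act (vtan (AG_incl v)) f).
    rewrite mulr0; split; first exact: ds.
    by rewrite -velocity_actE // -vs.
  have dr : is_derive (0 : R) (1 : R) (fun t : R => r^-1 * t) r^-1 by exact: is_derive_mull.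
  have Dw := @is_derive1_comp R (f \o s) (fun t : R => r^-1 * t) 0 _ _ Ds dr.
  rewrite mulrC mulrA mulVf ?gt_eqF // mul1r in Dw.
  apply: (right_derivative Du Dw).
  near=> t => t0 /=; congr f.
  have /(_ t0) tr : 0 <= t -> t <= r by near: t; exact: lt_nbhsl_le.
  rewrite -E; last by rewrite mulr_ge0 ?invr_ge0 ?(ltW r0) //= mulrC ler_pdivrMr // mul1r.
  by rewrite scaleA_scale mulrAC mulVf ?gt_eqF // mul1r.
by rewrite s0 uq.
Unshelve. all: by end_near. Qed.
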